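(* Let $q$ be a prime power and $r$ a positive integer. Then $s_{q^{2r}/q}(3,2)=r+2$ holds if any one of the following is true: (a) $r\not\equiv 3,5 \pmod 6$ and $r\ge4$; (b) $r$ is odd and there is an integer $s$ with $1\le s\le r$, $\gcd(r,s)=1$ and $\gcd\big(r,(q^{2s}-q^s+1)!\big)=1$; (c) $r=5$ and $q=p^{15h+s}$ with $p\in\{2,3\}$, $h\ge0$ an integer and $\gcd(s,15)=1$; (d) $r=5$ and $q=5^{15h+1}$ with $h\ge0$ an integer; (e) $r=5$ and either $q$ is odd with $q\equiv 2,3\pmod 5$, or $q=2^{2h+1}$ with $h\ge1$.
   Context: An $[n,k]_{q^{2r}/q}$ system is an $n$-dimensional $\mathbb{F}_q$-subspace $\mathcal{U}\le\mathbb{F}_{q^{2r}}^k$ with $\langle\mathcal{U}\rangle_{\mathbb{F}_{q^{2r}}}=\mathbb{F}_{q^{2r}}^k$; its linear set is $L_\mathcal{U}=\{\langle u\rangle:u\in\mathcal{U}\setminus\{0\}\}\subseteq\mathrm{PG}(k-1,q^{2r})$. A point set is $t$-saturating if every point of $\mathrm{PG}(k-1,q^{2r})$ lies in the span of some $t+1$ of its points and $t$ is minimal with this property; $\mathcal{U}$ is rank-$\rho$-saturating if $L_\mathcal{U}$ is $(\rho-1)$-saturating. $s_{q^{2r}/q}(k,\rho)$ is the minimum $n$ such that an $[n,k]_{q^{2r}/q}$ rank-$\rho$-saturating system exists. *)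

(* Defs.v *)
From HB Require Import structures.
From mathcomp Require Export all_boot all_order all_algebra all_field.

Set Implicit Arguments.
Unset Strict Implicit.
Unset Printing Implicit Defensive.

Import GRing.Theory.

Local Open Scope ring_scope.

Section Systems.

Variables (F : finFieldType) (L : fieldExtType F) (k : nat).

(* L^k is used in two guises: {ffun 'I_k -> L} carries its F-vector space
   structure and 'rV[L]_k its L-vector space structure; Lrow identifies them. *)
Definition Lrow (u : {ffun 'I_k -> L}) : 'rV[L]_k := \row_i u i.

(* The L-span of U; see Lspan_subP for its universal property. *)
Definition Lspan (U : {vspace {ffun 'I_k -> L}}) : {vspace 'rV[L]_k} :=
  <<[seq Lrow u | u <- vbasis U]>>%VS.

Lemma Lspan_subP (U : {vspace {ffun 'I_k -> L}}) (W : {vspace 'rV[L]_k}) :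
  reflect (forall u, u \in U -> Lrow u \in W) (Lspan U <= W)%VS.
Proof.
apply: (iffP span_subvP) => [sUW u uU | sUW _ /mapP[u uU ->]].
  rewrite (coord_vbasis uU).
  have -> : Lrow (\sum_i coord (vbasis U) i u *: (vbasis U)`_i)
      = \sum_i (coord (vbasis U) i u)%:A *: Lrow (vbasis U)`_i.
    apply/rowP => j; rewrite !mxE sum_ffunE summxE; apply: eq_bigr => i _.
    by rewrite !mxE ffunE mulr_algl.
  apply: memv_suml => i _; apply/memvZ/sUW/map_f/mem_nth.
  by rewrite size_tuple.
by apply: sUW; apply: vbasis_mem.
Qed.

Definition is_system (n : nat) (U : {vspace {ffun 'I_k -> L}}) : Prop :=
  \dim U = n /\ Lspan U = fullv.

(* Points of PG(k-1, L) are the one-dimensional L-subspaces of L^k. *)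
Definition is_point (P : {vspace 'rV[L]_k}) : Prop := \dim P = 1%N.

Definition linear_set (U : {vspace {ffun 'I_k -> L}})
    (P : {vspace 'rV[L]_k}) : Prop :=
  exists u, [/\ u \in U, u != 0 & P = <[Lrow u]>%VS].

Definition saturates (t : nat) (S : {vspace 'rV[L]_k} -> Prop) : Prop :=
  forall Q, is_point Q ->
    exists Ps : t.+1.-tuple {vspace 'rV[L]_k},
      [/\ uniq Ps, forall P, P \in Ps -> S P & (Q <= \sum_(P <- Ps) P)%VS].

Definition saturating (t : nat) (S : {vspace 'rV[L]_k} -> Prop) : Prop :=
  saturates t S /\ forall t', saturates t' S -> (t <= t')%N.

(* Only positive rho is meaningful, so that rho - 1 is not truncated. *)
Definition rank_saturating (rho : nat) (U : {vspace {ffun 'I_k -> L}}) : Prop :=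
  (0 < rho)%N /\ saturating rho.-1 (linear_set U).

Definition has_rank_saturating_system (rho n : nat) : Prop :=
  exists U, is_system n U /\ rank_saturating rho U.

End Systems.

(* "s_{L/F}(k, rho) = n": n is the minimum length of an [n, k]_{L/F}
   rank-rho-saturating system. *)
Definition min_length_saturating (F : finFieldType) (L : fieldExtType F)
    (k rho n : nat) : Prop :=
  has_rank_saturating_system L k rho n /\
  forall m, has_rank_saturating_system L k rho m -> (n <= m)%N.

Definition prime_power (q : nat) : Prop :=
  exists p e : nat, [/\ prime p, (0 < e)%N & q = (p ^ e)%N].

(* Main.v *)
From HB Require Import structures.
Require Import Defs.
From mathcomp Require Import all_boot all_order all_algebra all_field.
From mathcomp Require Import all_fingroup all_solvable.
From mathcomp Require Import zify ring.

(** Let [q = #|F|] and let [K] be the subfield of order [q^r] of [L]. A scattered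
    [F]-subspace [U] of [K^3] of dimension [r + 2] (every [K]-point has weight at
    most one) is rank-2-saturating over [L]: since [L] is quadratic over [K], each
    point of [PG(2, L)] lies on a line defined over [K], and that line meets [U] in
    dimension at least [2], hence in two distinct points. Conversely, counting the
    planes of [U] up to [GL_2(F)] shows that no shorter system saturates.

    Write [T] for the field of order [q^3]. Scattered subspaces are obtained as
    follows.
    - [r = 1 mod 3]: identify [K^3] with the field [K T] and extend scattered
      [T]-subspaces greedily; a bad extension comes with a free orbit of the affine
      group of [F], which leaves room up to dimension [r + 2].
    - [r = 2 t]: [U = {x + w f(x)}] over the field [E] of order [q^t], with
      [K = E + w E] and [f] an irreducible semilinear map of [E^3].
    - [r] prime to [q (q^2 - 1)] (cases (b) and (e)):
      [U = {(y^q, y^(q^2) + a, y + b)}]. A scalar [l] violating scatteredness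
      satisfies [l^q = M(l)] for a Moebius map [M] over [F]; as [M] has order prime
      to [r], this forces [l] into [F].
    - [r = 5], [q = p^e] with [p <= 5] and [e] prime to [15]: [U = T + T g + F z] in
      [K T]. A scalar violating scatteredness is a common zero over [F] of three
      quadrics in [PG(3, q)] with coefficients in [F_p]; their eight intersection
      points have degree [3] or [5] over [F_p], so none is rational over [F]. *)

Set Implicit Arguments.
Unset Strict Implicit.
Unset Printing Implicit Defensive.

Import GRing.Theory.
Local Open Scope ring_scope.

(** * Fixed fields of powers of the Frobenius *)

(** A scattered subspace of [K^3] has dimension at most [3r/2], so [r + 2] is within reach only from
    [r = 4] on. If [r = 1 mod 3], then [3] divides [r + 2] and [U] can be [T]-linear; the last
    greedy step meets up to about [q^(3r+1)] witnesses against [q^(3r)] vectors, so the orbits of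
    size [q (q - 1)] have to be divided out. If [r = 2 mod 3], greedy [T]-subspaces stop at
    dimension [r + 1]; for [r = 5] the missing dimension is the summand [F z], which breaks
    [T]-linearity and forces an explicit determinant. For [r = 2 t] the space has the extremal
    dimension [3 t] and is cut down: a scalar outside [E] would make the span of [x] and [f x] a
    proper [f]-stable subspace. The form of [f] depends on whether [E^3] can be taken to be the
    field [E T], that is, on whether [3] divides [t]. In the Moebius construction, eliminating [y]
    leaves a relation between [l], [l^q] and [l^(q^2)]; the work lies in finding an invariant in [F]
    that lowers it to one between an element and its [q]-th power. *)

Section Frobenius.

Variables (M : fieldType) (q : nat).
Hypothesis q_gt1 : (1 < q)%N.
Hypothesis exprDq : forall x y : M, (x + y) ^+ q = x ^+ q + y ^+ q.

Definition fixq d : {pred M} := [pred x | x ^+ (q ^ d) == x].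

Lemma fixqP d x : reflect (x ^+ (q ^ d) = x) (x \in fixq d).
Proof. exact: eqP. Qed.

Lemma expqD d (x y : M) : (x + y) ^+ (q ^ d) = x ^+ (q ^ d) + y ^+ (q ^ d).
Proof. by elim: d => [|d IHd]; rewrite ?expr1 // expnSr !exprM IHd exprDq. Qed.

Lemma expq0 d : (0 : M) ^+ (q ^ d) = 0.
Proof. by rewrite expr0n expn_eq0; case: q q_gt1. Qed.

Lemma expqN d (x : M) : (- x) ^+ (q ^ d) = - x ^+ (q ^ d).
Proof. by apply/eqP; rewrite -addr_eq0 -expqD addNr expq0. Qed.

Lemma expqB d (x y : M) : (x - y) ^+ (q ^ d) = x ^+ (q ^ d) - y ^+ (q ^ d).
Proof. by rewrite expqD expqN. Qed.

Lemma expq_sum d I (r : seq I) (P : pred I) (G : I -> M) :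
  (\sum_(i <- r | P i) G i) ^+ (q ^ d) = \sum_(i <- r | P i) G i ^+ (q ^ d).
Proof. by elim/big_rec2: _ => [|i x y _ <-]; rewrite ?expq0 ?expqD. Qed.

Lemma expqA d e (x : M) : x ^+ (q ^ d) ^+ (q ^ e) = x ^+ (q ^ (d + e)).
Proof. by rewrite -exprM -expnD. Qed.

Lemma expq_inj d : injective (fun x : M => x ^+ (q ^ d)).
Proof.
move=> x y /eqP; rewrite -subr_eq0 -expqB expf_eq0 subr_eq0.
by case/andP=> _ /eqP.
Qed.

Lemma fixq0 d : 0 \in fixq d.
Proof. by apply/fixqP; rewrite expq0. Qed.
Lemma fixq1 d : 1 \in fixq d.
Proof. by apply/fixqP; rewrite expr1n. Qed.
Lemma fixqD d x y : x \in fixq d -> y \in fixq d -> x + y \in fixq d.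
Proof. by move=> /fixqP Ex /fixqP Ey; apply/fixqP; rewrite expqD Ex Ey. Qed.
Lemma fixqN d x : x \in fixq d -> - x \in fixq d.
Proof. by move=> /fixqP Ex; apply/fixqP; rewrite expqN Ex. Qed.
Lemma fixqB d x y : x \in fixq d -> y \in fixq d -> x - y \in fixq d.
Proof. by move=> Ex Ey; rewrite fixqD ?fixqN. Qed.
Lemma fixqM d x y : x \in fixq d -> y \in fixq d -> x * y \in fixq d.
Proof. by move=> /fixqP Ex /fixqP Ey; apply/fixqP; rewrite exprMn Ex Ey. Qed.
Lemma fixqX d x n : x \in fixq d -> x ^+ n \in fixq d.
Proof. by move=> /fixqP Ex; apply/fixqP; rewrite exprAC Ex. Qed.
Lemma fixqV d x : x \in fixq d -> x^-1 \in fixq d.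
Proof. by move=> /fixqP Ex; apply/fixqP; rewrite exprVn Ex. Qed.
Lemma fixqf d x y : x \in fixq d -> y \in fixq d -> x / y \in fixq d.
Proof. by move=> Ex Ey; rewrite fixqM ?fixqV. Qed.
Lemma fixq_nat d n : n%:R \in fixq d.
Proof. by elim: n => [|n IHn]; rewrite ?fixq0 // mulrS fixqD ?fixq1. Qed.

Lemma fixq_mull d k x : x \in fixq d -> x ^+ (q ^ (d * k)) = x.
Proof.
move=> /fixqP Ex; elim: k => [|k IHk]; first by rewrite muln0.
by rewrite mulnS -expqA Ex.
Qed.

Lemma fixq_dvd d e x : (d %| e)%N -> x \in fixq d -> x \in fixq e.
Proof. by case/dvdnP=> k -> /fixq_mull E; apply/fixqP; rewrite mulnC. Qed.

Lemma fixq_gcd d e x : x \in fixq d -> x \in fixq e -> x \in fixq (gcdn d e).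
Proof.
case: d => [|d] Ex Fx; first by rewrite gcd0n.
have [km kn E _] := egcdnP e (ltn0Sn d).
apply/fixqP; rewrite -{2}(fixq_mull km Ex) mulnC E addnC -expqA.
by have /fixqP-> : x ^+ (q ^ gcdn d.+1 e) \in fixq (kn * e);
  first by rewrite fixqX //; apply: fixq_dvd Fx; apply: dvdn_mull.
Qed.

Lemma fixq_coprime d e x :
  coprime d e -> x \in fixq d -> x \in fixq e -> x ^+ q = x.
Proof.
by move=> /eqP co Ex Fx; have /fixqP := fixq_gcd Ex Fx; rewrite co expn1.
Qed.

(** The coefficients of [P] are fixed, so every conjugate [x ^+ (q ^ (d * i))] with [i < n] is a
    root. Primality of [n] makes these distinct, too many for a nonzero [P]: the element [x] has
    degree [n] over [fixq d]. *)
Lemma poly_fixq_eq0 d n x (P : {poly M}) :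
    prime n -> x \in fixq (d * n) -> x \notin fixq d ->
    (size P <= n)%N -> (forall i, P`_i \in fixq d) -> P.[x] = 0 -> P = 0.
Proof.
move=> n_pr xdn x'd szP cP Px; apply: contraNeq x'd => nzP.
pose s := [seq x ^+ (q ^ (d * i)) | i <- iota 0 n].
suffices: ~~ uniq s.
  apply: contraNT => x'd; rewrite map_inj_in_uniq ?iota_uniq // => i j.
  wlog lt_ij : i j / (i < j)%N => [IH|].
    by move=> hi hj E; case: (ltngtP i j) => // h;
       [apply: IH|apply/esym/IH].
  rewrite !mem_iota /= add0n => lt_in lt_jn E.
  (* Applying [n - i] further Frobenius steps to the coincidence of conjugates closes the cycle;
     then [j - i] is prime to [n]. *)
  have {E} : x ^+ (q ^ (d * (n + (j - i)))) = x.
    rewrite -[RHS](fixqP _ _ xdn).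
    have -> : (d * (n + (j - i)) = d * j + d * (n - i))%N by nia.
    have -> : (d * n = d * i + d * (n - i))%N by nia.
    by rewrite -expqA -E expqA.
  rewrite mulnDr -expqA (fixqP _ _ xdn) => /fixqP E.
  case/negP: x'd; have := fixq_gcd E xdn.
  rewrite -muln_gcdr; have /eqP-> : coprime (j - i) n.
    by rewrite coprime_sym prime_coprime // gtnNdvd; lia.
  by rewrite muln1.
apply: contraL szP => us; rewrite -ltnNge.
have <- : size s = n by rewrite size_map size_iota.
apply: max_poly_roots => //; apply/allP=> _ /mapP[i _ ->].
rewrite rootE -(expq0 (d * i)) -{}Px !horner_coef expq_sum.
apply/eqP; apply: eq_bigr => j _; rewrite exprMn exprAC.
by rewrite (fixq_mull _ (cP j)).
Qed.

Lemma fixq_indep3 d x a0 a1 a2 :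
    x \in fixq (d * 3) -> x \notin fixq d ->
    a0 \in fixq d -> a1 \in fixq d -> a2 \in fixq d ->
    a0 + a1 * x + a2 * x ^+ 2 = 0 -> [/\ a0 = 0, a1 = 0 & a2 = 0].
Proof.
move=> xd x'd h0 h1 h2 E.
have P0 : Poly [:: a0; a1; a2] = 0.
  apply: (@poly_fixq_eq0 d 3 x) => //; first exact: size_Poly.
    by move=> [|[|[|i]]]; rewrite coef_Poly //= nth_nil fixq0.
  by rewrite horner_Poly /= -[RHS]E; ring.
by split; [move/(congr1 (fun P : {poly M} => P`_0)): P0 | move/(congr1 (fun P : {poly M} => P`_1)): P0
  | move/(congr1 (fun P : {poly M} => P`_2)): P0]; rewrite coef_Poly coef0.
Qed.

Lemma fixq_indep5 d x a0 a1 a2 a3 a4 :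
    x \in fixq (d * 5) -> x \notin fixq d ->
    a0 \in fixq d -> a1 \in fixq d -> a2 \in fixq d -> a3 \in fixq d ->
    a4 \in fixq d ->
    a0 + a1 * x + a2 * x ^+ 2 + a3 * x ^+ 3 + a4 * x ^+ 4 = 0 ->
  [/\ a0 = 0, a1 = 0, a2 = 0, a3 = 0 & a4 = 0].
Proof.
move=> xd x'd h0 h1 h2 h3 h4 E.
have P0 : Poly [:: a0; a1; a2; a3; a4] = 0.
  apply: (@poly_fixq_eq0 d 5 x) => //; first exact: size_Poly.
    by move=> [|[|[|[|[|i]]]]]; rewrite coef_Poly //= nth_nil fixq0.
  by rewrite horner_Poly /= -[RHS]E; ring.
by split; [move/(congr1 (fun P : {poly M} => P`_0)): P0 | move/(congr1 (fun P : {poly M} => P`_1)): P0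
  | move/(congr1 (fun P : {poly M} => P`_2)): P0 | move/(congr1 (fun P : {poly M} => P`_3)): P0
  | move/(congr1 (fun P : {poly M} => P`_4)): P0]; rewrite coef_Poly coef0.
Qed.

End Frobenius.

Arguments fixq : clear implicits.
Arguments fixqP {M q d x}.

Lemma XnsubX_dvd (R : idomainType) (m n : nat) :
  (0 < m)%N -> (0 < n)%N -> (m.-1 %| n.-1)%N ->
  ('X^m - 'X : {poly R}) %| 'X^n - 'X.
Proof.
case: m => // m; case: n => // n _ _ /dvdnP[k /= ->].
have E j : 'X^(j.+1) - 'X = 'X * ('X^j - 1) :> {poly R}.
  by rewrite mulrBr mulr1 exprS.
by rewrite !E dvdp_mul // mulnC exprM [X in _ %| X]subrX1 dvdp_mulr.
Qed.

Section FixqCard.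

Variables (M : finFieldType) (q : nat).
Hypothesis q_gt1 : (1 < q)%N.

Let qX_gt1 d : (0 < d)%N -> (1 < q ^ d)%N.
Proof. by move=> d_gt0; rewrite -(exp1n d) ltn_exp2r. Qed.

Let size_XnsubX d : (0 < d)%N -> size ('X^(q ^ d) - 'X : {poly M}) = (q ^ d).+1.
Proof.
by move=> d0; rewrite size_polyDl size_polyXn // size_polyN size_polyX ltnS qX_gt1.
Qed.

Lemma root_XnsubX d x : root ('X^(q ^ d) - 'X : {poly M}) x = (x \in fixq M q d).
Proof. by rewrite rootE !hornerE subr_eq0. Qed.

Lemma card_fixq_le d : (0 < d)%N -> (#|fixq M q d| <= q ^ d)%N.
Proof.
move=> d0; rewrite -ltnS -size_XnsubX // cardE max_poly_roots ?enum_uniq //.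
  by rewrite -size_poly_eq0 size_XnsubX.
by apply/allP=> x; rewrite mem_enum root_XnsubX.
Qed.

(** With [q ^ D] roots in [M], the polynomial [X^(q^D) - X] is a product of distinct linear factors
    there. Its divisor [X^(q^d) - X] inherits this, hence has as many roots as its degree. *)
Lemma card_fixq D d : (0 < D)%N -> (d %| D)%N ->
  #|fixq M q D| = (q ^ D)%N -> #|fixq M q d| = (q ^ d)%N.
Proof.
move=> D0 dvD cD; have d0 : (0 < d)%N by apply: dvdn_gt0 dvD.
apply/eqP; rewrite eqn_leq card_fixq_le //=.
have ED : 'X^(q ^ D) - 'X = \prod_(x <- enum (fixq M q D)) ('X - x%:P) :> {poly M}.
  have sz : size ('X^(q ^ D) - 'X : {poly M}) = (size (enum (fixq M q D))).+1.
    by rewrite size_XnsubX // -cardE cD.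
  rewrite (all_roots_prod_XsubC sz) ?uniq_rootsE ?enum_uniq //; last first.
    by apply/allP=> x; rewrite mem_enum root_XnsubX.
  by rewrite lead_coefDl ?size_polyXn ?size_polyN ?size_polyX ?ltnS ?qX_gt1 //
     lead_coefXn scale1r.
have: ('X^(q ^ d) - 'X : {poly M}) %| 'X^(q ^ D) - 'X.
  apply: XnsubX_dvd; rewrite ?expn_gt0 ?(ltnW q_gt1) //.
  case/dvdnP: dvD => k ->; rewrite mulnC expnM.
  by rewrite (predn_exp (q ^ d)) dvdn_mulr.
rewrite ED => /dvdp_prod_XsubC[m Em].
have: size ('X^(q ^ d) - 'X : {poly M}) = (size (mask m (enum (fixq M q D)))).+1.
  by rewrite (eqp_size Em) (size_prod_XsubC _ id).
rewrite size_XnsubX // => -[->].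
rewrite -(card_uniqP _) ?mask_uniq ?enum_uniq //.
apply/subset_leq_card/subsetP=> x xm.
by rewrite -root_XnsubX (eqp_root Em) root_prod_XsubC.
Qed.

Lemma fixq_exp_neq1 n D : #|fixq M q D| = (q ^ D)%N ->
  (0 < n)%N -> (n.+1 < q ^ D)%N ->
  exists2 x, x \in fixq M q D & (x != 0) && (x ^+ n != 1).
Proof.
move=> cD n0 nqD; apply/exists_inP; apply: contraLR nqD.
rewrite negb_exists_in -leqNgt => /forall_inP H.
rewrite -cD (cardD1 0) -add1n leq_add ?leq_b1 //.
have := @max_poly_roots M ('X^n - 1) (enum [predD1 fixq M q D & 0]).
rewrite -cardE size_XnsubC // ltnS; apply; rewrite ?enum_uniq //.
  by rewrite -size_poly_eq0 size_XnsubC.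
apply/allP=> x; rewrite mem_enum !inE /= => /andP[x0 /H].
by rewrite x0 /= negbK rootE !hornerE subr_eq0.
Qed.

End FixqCard.

(** * The lower bound *)

Lemma card_finvect (F : finFieldType) (vT : vectType F) :
  #|finvect_type vT| = (#|F| ^ \dim {:vT})%N.
Proof.
have := card_vspacef (Vector.class (finvect_type vT : vectType F)).
by rewrite (card_vspace (cvT := Vector.class (finvect_type vT : vectType F))).
Qed.

(** Allows a dimension to be bounded by a mere predicate, such as a subfield [fixq], without giving
    that predicate a vector space structure. *)
Lemma dim_leq_card (F : finFieldType) (vT : vectType F) (U : {vspace vT}) n
    (A : {pred finvect_type vT}) :
  {subset U <= A} -> (#|A| <= #|F| ^ n)%N -> (\dim U <= n)%N.
Proof.
move=> sUA cA; rewrite -(leq_exp2l _ _ (finNzRing_gt1 F)).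
apply: leq_trans cA; have <- : \dim {: subvs_of U} = \dim U by rewrite dimvf.
rewrite -card_finvect.
pose f (u : finvect_type (subvs_of U)) : finvect_type vT := vsval u.
have f_inj : injective f by move=> u v; apply: (@val_inj _ _ (subvs_of U)).
rewrite -(card_imset _ f_inj); apply/subset_leq_card/subsetP=> _ /imsetP[u _ ->].
exact/sUA/subvsP.
Qed.

Lemma exists_subv (K : fieldType) (vT : vectType K) (U : {vspace vT}) n :
  (n <= \dim U)%N -> exists2 W : {vspace vT}, (W <= U)%VS & \dim W = n.
Proof.
move=> le_n; exists <<take n (vbasis U)>>%VS.
  apply/span_subvP=> x /mem_take; exact: vbasis_mem.
have: free (take n (vbasis U)).
  by have := basis_free (vbasisP U); rewrite -{1}(cat_take_drop n (vbasis U));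
     apply: catl_free.
by move/eqP->; rewrite size_takel // size_tuple.
Qed.

Lemma big_ord2 (R : nmodType) (G : 'I_2 -> R) : \sum_i G i = G 0 + G 1.
Proof.
rewrite big_ord_recl big_ord1; congr (G _ + G _); exact: val_inj.
Qed.

Lemma big_ord3 (R : nmodType) (G : 'I_3 -> R) :
  \sum_i G i = G 0 + G 1 + G (inord 2).
Proof.
rewrite !big_ord_recl big_ord0 addr0 addrA.
congr (G _ + G _ + G _); apply: val_inj => //=; by rewrite inordK.
Qed.

Lemma indep2_inj (R : pzRingType) (W : lmodType R) (u v : W) :
    (forall c d : R, c *: u + d *: v = 0 -> c = 0 /\ d = 0) ->
  forall a b c d : R, a *: u + b *: v = c *: u + d *: v -> a = c /\ b = d.
Proof.
move=> ind a b c d /eqP; rewrite -subr_eq0 opprD addrACA -!scalerBl.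
by move=> /eqP/ind[/subr0_eq-> /subr0_eq->].
Qed.

Section System.

Variables (F : finFieldType) (L : fieldExtType F) (r : nat).
Local Notation q := #|F|.
Local Notation V := {ffun 'I_3 -> L}.
Local Notation Lf := (finvect_type L).
Hypotheses (r_gt0 : (0 < r)%N) (dimL : \dim {:L} = (2 * r)%N).

Let q_gt1 : (1 < q)%N := finNzRing_gt1 F.

Let card_L : #|Lf| = (q ^ (2 * r))%N.
Proof. by rewrite card_finvect dimL. Qed.

Let card_X : #|{ffun 'I_3 -> Lf}| = (q ^ (6 * r))%N.
Proof. by rewrite card_ffun card_ord card_L -expnM; congr (_ ^ _)%N; lia. Qed.

Let card_U (U : {vspace V}) : #|finvect_type (subvs_of U)| = (q ^ \dim U)%N.
Proof. by rewrite card_finvect dimvf. Qed.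

Lemma Lrow_inj : injective (@Lrow F L 3).
Proof.
by move=> u v /rowP E; apply/ffunP=> i; have := E i; rewrite !mxE.
Qed.

Lemma LrowK (x : 'rV[L]_3) : Lrow [ffun i => x 0 i] = x.
Proof. by apply/rowP=> i; rewrite mxE ffunE. Qed.

Lemma Lrow_eq0 (u : V) : (Lrow u == 0) = (u == 0).
Proof.
rewrite -(inj_eq Lrow_inj); congr (_ == _).
by apply/rowP=> i; rewrite !mxE ffunE.
Qed.

Lemma fixq1_alg (c : L) : c ^+ q = c -> exists a : F, c = a%:A.
Proof.
move=> cq; suff /vlineP[a ->] : c \in 1%VS by exists a.
by rewrite -[1%VS]/(asval (aspace1 L)) Fermat's_little_theorem dimv1 expn1 cq.
Qed.

Lemma card_fixqL d : (d %| 2 * r)%N -> #|fixq (FinFieldExtType L) q d| = (q ^ d)%N.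
Proof.
move=> dv; apply: (@card_fixq _ _ q_gt1 (2 * r)) => //; first by lia.
rewrite -card_L; apply: eq_card => x; rewrite !inE -card_L.
by rewrite [X in X == _](@expf_card (FinFieldExtType L)) eqxx.
Qed.

Let vsval_lin (U : {vspace V}) (c d : F) (u v : subvs_of U) j :
  vsval (c *: u + d *: v) j = in_alg L c * vsval u j + in_alg L d * vsval v j.
Proof. by rewrite linearD !linearZ !ffunE !mulr_algl. Qed.

(** An [F]-relation between representatives of the two points would make the points equal.
    Independence over [F] is what is recorded, because the group acting in the count is
    [GL_2(F)]. *)
Lemma saturates1_decomp (U : {vspace V}) (x : V) :
    saturates 1 (linear_set U) -> x != 0 ->
  exists u v : subvs_of U, exists a b : L,
    (forall c d : F, c *: u + d *: v = 0 -> c = 0 /\ d = 0) /\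
    forall j, x j = a * vsval u j + b * vsval v j.
Proof.
move=> sat nz_x; have [|Ps [uPs sPs]] := sat <[Lrow x]>%VS.
  by rewrite /is_point dim_vline Lrow_eq0 nz_x.
case: Ps uPs sPs => [[|P1 [|P2 [|? ?]]] szP] //=; rewrite inE andbT => neqP sP.
have [u [uU nzu E1]] := sP P1 (mem_head _ _).
have [v [vU nzv E2]] : linear_set U P2 by apply: sP; rewrite !inE eqxx orbT.
rewrite big_cons big_seq1 -memvE => /memv_addP[y1 y1P [y2 y2P E]].
move: y1P y2P E; rewrite E1 E2 => /vlineP[a ->] /vlineP[b ->] E.
exists (Subvs uU), (Subvs vU), a, b; split=> [c d /(congr1 vsval)|j].
  rewrite linearD !linearZ linear0 /= => E0.
  have E0L : c%:A *: Lrow u + d%:A *: Lrow v = 0 :> 'rV[L]_3.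
    apply/rowP=> j; move/ffunP/(_ j): E0.
    by rewrite !mxE !ffunE !mulr_algl.
  have [c0|nzc] := eqVneq c 0; have [d0|nzd] := eqVneq d 0; first by [].
  - move/eqP: E0L; rewrite c0 !scale0r add0r scaler_eq0 Lrow_eq0 (negPf nzv) orbF.
    by rewrite scaler_eq0 oner_eq0 orbF (negPf nzd).
  - move/eqP: E0L; rewrite d0 !scale0r addr0 scaler_eq0 Lrow_eq0 (negPf nzu) orbF.
    by rewrite scaler_eq0 oner_eq0 orbF (negPf nzc).
  case/eqP: neqP; rewrite E1 E2; apply/eqP.
  have nzcA : c%:A != 0 :> L by rewrite scaler_eq0 oner_eq0 orbF.
  have Eu : Lrow u = (- (d%:A / c%:A)) *: Lrow v.
    apply: (scalerI nzcA); rewrite scalerA mulrN mulrC divfK // scaleNr.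
    by apply/eqP; rewrite -addr_eq0 E0L.
  rewrite Eu; apply/eqP/vspaceP=> y; apply/vlineP/vlineP=> -[k ->].
    by exists (k * - (d%:A / c%:A)); rewrite scalerA.
  exists (k / - (d%:A / c%:A)); rewrite scalerA divfK //.
  by rewrite oppr_eq0 mulf_neq0 ?invr_eq0 // scaler_eq0 oner_eq0 orbF.
by move/rowP/(_ j): E; rewrite !mxE.
Qed.

(* [GL_2(F)] acts freely on the decompositions [x = a u + b v]. *)
Lemma saturates1_dim (U : {vspace V}) :
  saturates 1 (linear_set U) -> (r + 2 <= \dim U)%N.
Proof.
move=> sat; pose Uf := finvect_type (subvs_of U).
have dec (x : {ffun 'I_3 -> Lf}) : exists t : Uf * Uf * (Lf * Lf), x != 0 ->
    (forall c d : F, c *: t.1.1 + d *: t.1.2 = 0 -> c = 0 /\ d = 0) /\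
    forall j, x j = t.2.1 * vsval t.1.1 j + t.2.2 * vsval t.1.2 j.
  have [->|nzx] := eqVneq x 0; first by exists (0, 0, (0, 0)).
  have [u [v [a [b H]]]] := saturates1_decomp sat nzx.
  by exists (u, v, (a, b)).
have [t Ht] := fin_all_exists dec => {dec}.
pose A (g : 'M[F]_2) i j := in_alg L (g i j).
(* The vectors [(u, v)] are moved by [g] and the coefficients [(a, b)] by its inverse, so the sum
   [a u + b v] does not change. *)
pose act (w : {ffun 'I_3 -> Lf} * {'GL_2[F]}) : Uf * Uf * (Lf * Lf) :=
  let u := (t w.1).1.1 in let v := (t w.1).1.2 in
  let a := (t w.1).2.1 in let b := (t w.1).2.2 in
  let g := GLval w.2 in let h := invmx g in
  (g 0 0 *: u + g 0 1 *: v, g 1 0 *: u + g 1 1 *: v,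
   (a * A h 0 0 + b * A h 1 0, a * A h 0 1 + b * A h 1 1)).
have actE (w : {ffun 'I_3 -> Lf} * {'GL_2[F]}) : w.1 != 0 -> forall j,
    w.1 j = (act w).2.1 * vsval (act w).1.1 j + (act w).2.2 * vsval (act w).1.2 j.
  case: w => x g nzx; have [_ Hx] := Ht x nzx; move=> j /=; rewrite Hx.
  have /matrixP E : invmx (GLval g) *m GLval g = 1%:M.
    by rewrite mulVmx //; apply: GL_unitmx.
  have EA i k : A (invmx (GLval g)) i 0 * A (GLval g) 0 k
      + A (invmx (GLval g)) i 1 * A (GLval g) 1 k = (i == k)%:R.
    have := E i k; rewrite !mxE big_ord2 => /(congr1 (in_alg L)).
    by rewrite rmorphD !rmorphM rmorph_nat.
  rewrite (vsval_lin (GLval g 0 0)) (vsval_lin (GLval g 1 0)).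
  rewrite -/(A (GLval g) 0 0) -/(A (GLval g) 0 1) -/(A (GLval g) 1 0).
  rewrite -/(A (GLval g) 1 1).
  move: (EA 0 0) (EA 0 1) (EA 1 0) (EA 1 1) => /=.
  set a := (t x).2.1; set b := (t x).2.2.
  set u := (vsval (t x).1.1) j; set v := (vsval (t x).1.2) j.
  move: (A (GLval g)) (A _) => G H E00 E01 E10 E11.
  transitivity (a * u * (H 0 0 * G 0 0 + H 0 1 * G 1 0)
    + a * v * (H 0 0 * G 0 1 + H 0 1 * G 1 1)
    + b * u * (H 1 0 * G 0 0 + H 1 1 * G 1 0)
    + b * v * (H 1 0 * G 0 1 + H 1 1 * G 1 1)).
    by rewrite E00 E01 E10 E11; ring.
  by ring.
(* The sum [a u + b v] gives back [x]; the independence of the pair chosen for [x] then gives back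
   [g]. *)
have act_inj : {in [pred w | w.1 != 0] &, injective act}.
  move=> w w' /=; rewrite !inE => nzw nzw' E.
  have Ex : w.1 = w'.1 by apply/ffunP=> j; rewrite actE // E -actE.
  case: w w' Ex E nzw {nzw'} => [x g] [_ g'] /= <- E /Ht[ind _].
  have E1 := congr1 (fun z => z.1.1) E; have E2 := congr1 (fun z => z.1.2) E.
  congr (_, _); apply: val_inj; apply/matrixP=> i k.
  have gE l : GLval g l 0 *: (t x).1.1 + GLval g l 1 *: (t x).1.2
      = GLval g' l 0 *: (t x).1.1 + GLval g' l 1 *: (t x).1.2.
    case: l => -[|[|//]] ltl.
      have -> : Ordinal ltl = 0 by apply: val_inj.
      exact: E1.
    have -> : Ordinal ltl = 1 by apply: val_inj.
    exact: E2.
  have [e0 e1] := indep2_inj ind (gE i).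
  case: k => -[|[|//]] ltk.
    have -> : Ordinal ltk = 0 by apply: val_inj.
    exact: e0.
  have -> : Ordinal ltk = 1 by apply: val_inj.
  exact: e1.
have := @leq_card_in _ _ act _ act_inj.
have -> : #|[pred w : {ffun 'I_3 -> Lf} * {'GL_2[F]} | w.1 != 0]|
    = ((q ^ (6 * r)).-1 * (q * q.-1 ^ 2 * q.+1))%N.
  rewrite -card_X -(cardC1 (0 : {ffun 'I_3 -> Lf})) -card_GL_2 cardsT -cardX.
  by apply: eq_card => -[x g]; rewrite !inE andbT.
(* If [\dim U <= r + 1], there are at most [q^(2r+2) q^(4r) = q^(6r) q^2] targets for
   [(q^(6r) - 1) |GL_2(F)|] sources. *)
rewrite !card_prod card_L card_U; apply: contraTT; rewrite -!ltnNge => dimU.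
have le_U : (q ^ \dim U <= q ^ r.+1)%N by rewrite leq_exp2l //; lia.
apply: leq_ltn_trans (_ : (q ^ r.+1 * q ^ r.+1 * (q ^ (2 * r) * q ^ (2 * r)) < _)%N).
  by rewrite leq_mul // leq_mul.
have -> : (q ^ r.+1 * q ^ r.+1 * (q ^ (2 * r) * q ^ (2 * r)) = q ^ (6 * r) * q ^ 2)%N.
  by rewrite -!expnD; congr (_ ^ _)%N; lia.
have : (q ^ 2 <= q ^ (6 * r))%N by rewrite leq_exp2l //; lia.
move: (q ^ (6 * r))%N => N; move: q_gt1; case: (q) => [|[|k]] // _.
rewrite /= => leN.
(* With [q = k.+2] this reads [q^2 + 2 <= |GL_2(F)|], an equality for [q = 2]. The surplus [2]
   compensates for the excluded zero vector. *)
have : (k.+2 ^ 2 + 2 <= k.+2 * k.+1 ^ 2 * k.+3)%N by rewrite /=; nia.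
move: (k.+2 * k.+1 ^ 2 * k.+3)%N => B leB.
have lt4 : (4 <= k.+2 ^ 2)%N by rewrite -[4%N]/(2 ^ 2)%N leq_exp2r.
move: leN leB lt4; move: (k.+2 ^ 2)%N => Q leN leB lt4.
apply: leq_trans (_ : N.-1 * (Q + 2) <= _)%N.
  nia.
by rewrite leq_mul2l leB orbT.
Qed.

End System.

(** * Scattered subspaces are saturating *)

Definition scattered (F : finFieldType) (L : fieldExtType F) (r : nat)
    (U : {vspace {ffun 'I_3 -> L}}) : Prop :=
  (forall u j, u \in U -> u j \in fixq L #|F| r) /\
  (forall u c, u \in U -> u != 0 -> c \in fixq L #|F| r ->
     [ffun j => c * u j] \in U -> c ^+ #|F| = c).

Section Scattered.

Variables (F : finFieldType) (L : fieldExtType F) (r : nat).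
Local Notation q := #|F|.
Local Notation V := {ffun 'I_3 -> L}.
Local Notation Lf := (finvect_type L).
Hypotheses (r_gt0 : (0 < r)%N) (dimL : \dim {:L} = (2 * r)%N).
Hypothesis exprDq : forall x y : L, (x + y) ^+ q = x ^+ q + y ^+ q.

Let q_gt1 : (1 < q)%N := finNzRing_gt1 F.

Variable U : {vspace V}.
Hypotheses (dimU : \dim U = (r + 2)%N) (scatU : scattered r U).

Definition dotp (h x : V) : L := \sum_j h j * x j.

(** Pigeonhole: [K^3] has [q^(3r)] elements while the values [dotp h x] lie in [L], of order
    [q^(2r)]. The difference of two colliding vectors gives a line over [K] through the point. *)
Lemma exists_fixq_dot0 (x : V) :
  exists h : V, [/\ h != 0, forall j, h j \in fixq L q r & dotp h x = 0].
Proof.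
pose A : {pred {ffun 'I_3 -> Lf}} := family (fun=> fixq (FinFieldExtType L) q r).
pose f (h : {ffun 'I_3 -> Lf}) : Lf := dotp h x.
have : ~~ [forall h in A, forall h' in A, (f h == f h') ==> (h == h')].
  apply/negP=> /forall_inP H.
  have f_inj : {in A &, injective f}.
    move=> h h' hA h'A E; move/H/forall_inP/(_ h' h'A): hA.
    by rewrite E eqxx => /eqP.
  have := @leq_card_in _ _ f _ f_inj; rewrite card_family card_finvect dimL.
  rewrite foldrE big_map big_enum /= prod_nat_const card_ord.
  by rewrite (card_fixqL r_gt0 dimL) ?dvdn_mull // -expnM leq_exp2l //; lia.
rewrite negb_forall_in => /exists_inP[h hA].
rewrite negb_forall_in => /exists_inP[h' h'A]; rewrite negb_imply.
case/andP=> /eqP E ne; exists (h - h' : V); split; first by rewrite subr_eq0.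
  move=> j; rewrite !ffunE; apply: fixqB => //.
  by move/familyP: hA; apply.
  by move/familyP: h'A; apply.
have -> : dotp (h - h' : V) x = dotp h x - dotp h' x.
  by rewrite /dotp -sumrB; apply: eq_bigr => j _; rewrite !ffunE mulrBl.
by apply/eqP; rewrite subr_eq0; apply/eqP.
Qed.

Lemma dotp_linear h : linear (dotp h : V -> L).
Proof.
move=> a u v; rewrite /dotp scaler_sumr -big_split; apply: eq_bigr => j _ /=.
by rewrite !ffunE mulrDr scalerAr.
Qed.

(** On [U] the form [dotp h] is [F]-linear with values in [K], of dimension [r] over [F]. Its kernel
    in [U] therefore has dimension at least [(r + 2) - r = 2]. *)
Lemma exists_indep_dot0 (h : V) : (forall j, h j \in fixq L q r) ->
  exists u v, [/\ u \in U, v \in U, u != 0, v \notin <[u]>%VS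
                & dotp h u = 0 /\ dotp h v = 0].
Proof.
move=> hK.
pose fl := GRing.isLinear.Build F V L *:%R (dotp h) (dotp_linear h).
pose f : {linear V -> L} := HB.pack (dotp h) fl.
pose phi := linfun f.
have dim_im : (\dim (phi @: U) <= r)%N.
  apply: (@dim_leq_card F L _ r (fixq (FinFieldExtType L) q r)).
    move=> _ /memv_imgP[u uU ->]; rewrite lfunE /= /dotp.
    elim/big_rec: _ => [|j x _ xK]; first exact: fixq0.
    apply: (fixqD exprDq) => //.
    by apply: fixqM; [apply: hK|apply: scatU.1].
  by rewrite (card_fixqL r_gt0 dimL) ?dvdn_mull.
have := limg_ker_dim phi U; set B := (U :&: lker phi)%VS => dimB.
have dimB2 : (2 <= \dim B)%N by rewrite -(leq_add2r (\dim (phi @: U))) dimB dimU addnC leq_add2r.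
have nzB : B != 0%VS by rewrite -dimv_eq0; lia.
pose u := vpick B.
have nzu : u != 0 by rewrite vpick0.
have : ~~ (B <= <[u]>)%VS.
  by apply/negP=> /dimvS; rewrite dim_vline nzu; lia.
case/subvPn=> v vB v'u; exists u, v.
have : u \in B by apply: memv_pick.
move: vB; rewrite !memv_cap !memv_ker !lfunE /=.
by move=> /andP[vU /eqP hv] /andP[uU /eqP hu].
Qed.

Lemma scattered_saturates : saturates 1 (linear_set U).
Proof.
move=> Q; rewrite /is_point => dimQ; pose x := vpick Q.
have nzQ : Q != 0%VS by rewrite -dimv_eq0 dimQ.
have nzx : x != 0 by rewrite vpick0.
have EQ : Q = <[x]>%VS.
  apply/esym/eqP; rewrite eqEdim -memvE memv_pick dim_vline nzx dimQ.
  by [].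
have [h [nzh hK hx]] := exists_fixq_dot0 [ffun j => x 0 j].
have [u [v [uU vU nzu v'u [hu hv]]]] := exists_indep_dot0 hK.
(* Scatteredness upgrades independence over [F] to independence over [L]: a factor [c] with
   [v = c u] is a ratio of coordinates, so it lies in [K], and then in [F]. *)
have Luv : Lrow v \notin <[Lrow u]>%VS.
  apply/negP=> /vlineP[c Ev].
  have Evu : v = [ffun j => c * u j].
    by apply/ffunP=> j; move/rowP/(_ j): Ev; rewrite !mxE ffunE.
  have [j nzuj] : exists j, u j != 0.
    apply/existsP; apply: contraNT nzu; rewrite negb_exists => /forallP H.
    by apply/eqP/ffunP=> j; rewrite ffunE; apply/eqP; have := H j; rewrite negbK.
  have cK : c \in fixq L q r.
    have -> : c = v j / u j by rewrite Evu ffunE mulfK.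
    by apply: fixqf; apply: scatU.1.
  have [|a Ea] := @fixq1_alg F L c; first by apply: (scatU.2 u); rewrite -?Evu.
  case/negP: v'u; apply/vlineP; exists a; rewrite Evu Ea.
  by apply/ffunP=> k; rewrite !ffunE mulr_algl.
have nzLu : Lrow u != 0 by rewrite Lrow_eq0.
exists [tuple <[Lrow u]>%VS; <[Lrow v]>%VS]; split.
- rewrite /= inE andbT; apply: contraNneq Luv => ->; exact: memv_line.
- have nzv : v != 0 by apply: contraNneq v'u => ->; apply: mem0v.
  by move=> P; rewrite !inE => /orP[]/eqP->; [exists u|exists v].
rewrite /= big_cons big_seq1 EQ -memvE.
(* The line is the kernel of the form [h] over [L]. It has dimension at most [2], so the independent
   [u] and [v] already span it. *)
pose H : 'M[L]_(3, 1) := (Lrow h)^T; pose phi := linfun (mulmxr H : 'rV[L]_3 -> 'M[L]_1).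
have phiE (y : V) : phi (Lrow y) = (dotp h y)%:M.
  rewrite lfunE /=; apply/matrixP=> i j; rewrite !ord1 !mxE eqxx mulr1n.
  by apply: eq_bigr => k _; rewrite !mxE mulrC.
have sub : (<[Lrow u]> + <[Lrow v]> <= lker phi)%VS.
  by rewrite subv_add -!memvE !memv_ker !phiE hu hv !raddf0 eqxx.
have dim2 : \dim (<[Lrow u]> + <[Lrow v]>) = 2.
  have : free [:: Lrow v; Lrow u].
    by rewrite free_cons span_seq1 Luv seq1_free.
  by rewrite /free span_cons span_seq1 addvC => /eqP.
have dimk : (\dim (lker phi) <= 2)%N.
  have := limg_ker_dim phi fullv; rewrite capfv dimvf /dim /= mul1n.
  suff: (0 < \dim (phi @: fullv))%N by lia.
  rewrite lt0n dimv_eq0; apply: contraNneq nzh => im0; apply/eqP/ffunP=> j.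
  have := memv_img phi (memvf (Lrow [ffun k => (k == j)%:R])).
  rewrite im0 memv0 phiE ffunE => /eqP/matrixP/(_ 0 0).
  rewrite !mxE eqxx mulr1n /dotp (bigD1 j) //= ffunE eqxx mulr1 big1 ?addr0 //.
  by move=> k /negPf kj; rewrite ffunE kj mulr0.
have : (lker phi <= <[Lrow u]> + <[Lrow v]>)%VS.
  by have := dimv_leqif_sup sub => -[_ <-]; rewrite eqn_leq dimvS //= dim2.
move/subvP; apply; rewrite memv_ker -(LrowK x) phiE.
by rewrite (_ : dotp _ _ = 0) ?raddf0.
Qed.

Lemma linear_set_Lspan P : linear_set U P -> (P <= Lspan U)%VS.
Proof.
case=> u [uU _ ->]; rewrite -memvE; exact: (Lspan_subP U (Lspan U) (subvv _)).
Qed.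

(** Saturation asks for the least [t], so [t = 0] must be excluded. Otherwise each of the
    [q^(6r) - 1] nonzero vectors would be [a u] with [a] in [L] and [u] in [U], and there are only
    [q^(3r+2)] such pairs. *)
Lemma scattered_not_saturates0 : ~ saturates 0 (linear_set U).
Proof.
move=> sat; pose Uf := finvect_type (subvs_of U).
have dec (x : {ffun 'I_3 -> Lf}) : exists t : Uf * Lf, x != 0 ->
    forall j, x j = t.2 * vsval t.1 j.
  have [->|nzx] := eqVneq x 0; first by exists (0, 0).
  have [|Ps [_ sPs]] := sat <[Lrow (x : V)]>%VS.
    by rewrite /is_point dim_vline Lrow_eq0 nzx.
  case: Ps sPs => [[|P [|? ?]] szP] //= sP.
  have [u [uU _ ->]] := sP P (mem_head _ _).
  rewrite big_seq1 -memvE => /vlineP[a /rowP E].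
  exists (Subvs uU, a) => _ j /=; by have := E j; rewrite !mxE.
have [t Ht] := fin_all_exists dec.
have t_inj : {in [pred x : {ffun 'I_3 -> Lf} | x != 0] &, injective t}.
  move=> x y; rewrite !inE => nzx nzy E; apply/ffunP=> j.
  by rewrite (Ht x nzx) E -(Ht y nzy).
have := @leq_card_in _ _ t _ t_inj.
rewrite cardC1 card_ffun card_prod !card_finvect dimL card_ord dimvf [dim _]dimU.
rewrite -expnM -expnD.
have : (q ^ (r + 2 + 2 * r) * 2 <= q ^ (2 * r * 3))%N.
  apply: leq_trans (_ : q ^ (r + 2 + 2 * r) * q ^ 1 <= _)%N.
    by rewrite leq_mul2l orbC expn1 q_gt1.
  by rewrite -expnD leq_exp2l //; lia.
have : (1 < q ^ (r + 2 + 2 * r))%N.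
  by apply: leq_ltn_trans (ltn_expl _ q_gt1); lia.
move: (q ^ (r + 2 + 2 * r))%N (q ^ (2 * r * 3))%N => a b; lia.
Qed.

Lemma scattered_system : has_rank_saturating_system L 3 2 (r + 2).
Proof.
exists U; split; last first.
  split=> //; split; first exact: scattered_saturates.
  by case=> // /scattered_not_saturates0.
split=> //; apply/eqP; rewrite eqEsubv subvf /=; apply/subvP=> x _.
have [->|nzx] := eqVneq x 0; first exact: mem0v.
have [|Ps [_ sP]] := scattered_saturates (Q := <[x]>%VS).
  by rewrite /is_point dim_vline nzx.
move=> sub; rewrite memvE; apply: subv_trans sub _.
rewrite big_seq; elim/big_rec: _ => [|P W /sP PU sW]; first exact: sub0v.
by rewrite subv_add sW linear_set_Lspan.
Qed.

End Scattered.

(** Subspaces of a scattered space are scattered, so a construction may overshoot the dimension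
    [r + 2]. *)
Theorem scattered_min_length (F : finFieldType) (L : fieldExtType F) (r : nat)
    (U : {vspace {ffun 'I_3 -> L}}) :
    (0 < r)%N -> \dim {:L} = (2 * r)%N ->
    (forall x y : L, (x + y) ^+ #|F| = x ^+ #|F| + y ^+ #|F|) ->
    (r + 2 <= \dim U)%N -> scattered r U ->
  min_length_saturating L 3 2 (r + 2).
Proof.
move=> r0 dimL exprDq dimU [UK Usc].
have [W sWU dimW] := exists_subv dimU.
split.
  apply: (@scattered_system F L r r0 dimL exprDq W dimW); split.
    by move=> u j uW; apply: UK; apply: (subvP sWU).
  by move=> u c uW nzu cK cuW; apply: (Usc u) => //; apply: (subvP sWU).
move=> m [W' [[<- _] [_ [sat _]]]].
exact: (saturates1_dim r0 dimL sat).
Qed.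

(** * Scattered subspaces presented as finite sets, in [K^3] or in the field [K T] *)

Section ScatteredSet.

Variables (F : finFieldType) (L : fieldExtType F) (r : nat).
Local Notation q := #|F|.
Local Notation V := {ffun 'I_3 -> L}.
Local Notation Lf := (finvect_type L).
Hypotheses (r_gt0 : (0 < r)%N) (dimL : \dim {:L} = (2 * r)%N).
Hypothesis exprDq : forall x y : L, (x + y) ^+ q = x ^+ q + y ^+ q.

Let q_gt1 : (1 < q)%N := finNzRing_gt1 F.

(** A set closed under addition and [F]-scaling is its own span, so the dimension can be read off
    from its cardinality. The explicit families are images of injective maps, for which counting is
    easier than exhibiting a basis. *)
Lemma scattered_set_min_length (S : {pred {ffun 'I_3 -> Lf}}) :
    (0 : V) \in S ->
    (forall u v : V, u \in S -> v \in S -> (u + v : V) \in S) ->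
    (forall (c : L) (u : V), c ^+ q = c -> u \in S -> [ffun j => c * u j] \in S) ->
    (forall (u : V) j, u \in S -> u j \in fixq L q r) ->
    (forall (u : V) c, u \in S -> u != 0 -> c \in fixq L q r ->
       [ffun j => c * u j] \in S -> c ^+ q = c) ->
    (q ^ (r + 2) <= #|S|)%N ->
  min_length_saturating L 3 2 (r + 2).
Proof.
move=> S0 SD SZ SK Ssc cardS.
have alg_fix (a : F) : a%:A ^+ q = a%:A :> L.
  by rewrite -in_algE -rmorphXn /= expf_card.
pose U : {vspace V} := <<enum S : seq V>>%VS.
have US u : u \in U -> u \in S.
  move=> uU; rewrite (@coord_span _ _ _ (in_tuple (enum S : seq V)) u uU).
  elim/big_rec: _ => [|i x _ xS] //; apply: SD => //.
  set w := _`_i; have wS : w \in S.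
    have : w \in enum S by apply: mem_nth; case: (i).
    by rewrite (@mem_enum {ffun 'I_3 -> Lf}).
  have := SZ _ _ (alg_fix (coord (in_tuple (enum S : seq V)) i u)) wS.
  by congr (_ \in S); apply/ffunP=> j; rewrite !ffunE mulr_algl.
have SU u : u \in S -> u \in U.
  by move=> uS; apply: memv_span; rewrite (@mem_enum {ffun 'I_3 -> Lf}).
apply: (@scattered_min_length F L r U) => //; last first.
  split=> [u j /US|u c /US uS nzu cK /US]; first exact: SK.
  exact: Ssc.
rewrite -(leq_exp2l _ _ q_gt1); apply: leq_trans cardS _.
have <- : \dim {: subvs_of U} = \dim U by rewrite dimvf.
rewrite -card_finvect.
pose f (u : {ffun 'I_3 -> Lf}) : finvect_type (subvs_of U) := vsproj U u.
apply: (@leq_card_in _ _ f) => u v /SU uU /SU vU /(congr1 vsval).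
by rewrite !vsprojK.
Qed.

Variables (M : finFieldType) (i : {rmorphism L -> M}) (c : M).
Hypothesis exprDqM : forall x y : M, (x + y) ^+ q = x ^+ q + y ^+ q.
Hypotheses (c3 : c \in fixq M q 3) (c1 : c \notin fixq M q 1) (r3 : ~~ (3 %| r)%N).

Let c'r : c \notin fixq M q r.
Proof.
apply: contra c1 => cr; apply/fixqP; rewrite expn1.
by apply: (fixq_coprime _ c3 cr); rewrite prime_coprime.
Qed.

Let i_fix d x : (i x \in fixq M q d) = (x \in fixq L q d).
Proof. by rewrite !inE -rmorphXn (inj_eq (fmorph_inj i)). Qed.

Let iota (u : V) := i (u 0) + i (u 1) * c + i (u (inord 2)) * c ^+ 2.

Let iotaZ (a : L) (u : V) : iota [ffun j => a * u j] = i a * iota u.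
Proof. by rewrite /iota !ffunE !rmorphM; ring. Qed.

Let iotaD (u v : V) : iota (u + v) = iota u + iota v.
Proof. by rewrite /iota !ffunE !rmorphD; ring. Qed.

Let ord3E (j : 'I_3) : [\/ j = 0, j = 1 | j = inord 2].
Proof.
by case: j => -[|[|[|//]]] lt; [constructor 1|constructor 2|constructor 3];
  apply: val_inj; rewrite //= inordK.
Qed.

Let iota_inj0 (u : V) : (forall j, u j \in fixq L q r) -> iota u = 0 -> u = 0.
Proof.
move=> uK E.
have cr3 : c \in fixq M q (r * 3) by apply: fixq_dvd c3; apply: dvdn_mull.
have [] := fixq_indep3 q_gt1 exprDqM cr3 c'r _ _ _ E; rewrite ?i_fix //.
move=> /eqP e0 /eqP e1 /eqP e2; apply/ffunP=> j; rewrite ffunE; apply/eqP.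
by move: e0 e1 e2; rewrite !fmorph_eq0; case: (ord3E j) => ->.
Qed.

(** Since [3] does not divide [r], the generator [c] of [T] still has degree [3] over [K], and [1],
    [c], [c^2] is a [K]-basis of [K T]. The coordinate map [iota] is [K]-linear, so it carries the
    scattered condition over to [K^3]. *)
Lemma scattered_ext_min_length (W : {pred M}) :
    0 \in W -> (forall x y, x \in W -> y \in W -> x + y \in W) ->
    (forall a x, a ^+ q = a -> x \in W -> a * x \in W) ->
    {subset W <= fixq M q (3 * r)} ->
    (forall a x, x \in W -> x != 0 -> a \in fixq M q r -> a * x \in W ->
       a ^+ q = a) ->
    (q ^ (r + 2) <= #|W|)%N ->
  min_length_saturating L 3 2 (r + 2).
Proof.
move=> W0 WD WZ Wfix Wsc cardW.
pose K3 : {pred {ffun 'I_3 -> Lf}} := family (fun=> fixq (FinFieldExtType L) q r).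
have K3P (u : V) : reflect (forall j, u j \in fixq L q r) (u \in K3).
  exact: familyP.
pose S : {pred {ffun 'I_3 -> Lf}} := [pred u | (u \in K3) && (iota u \in W)].
have SE (u : V) : (u \in S) = (u \in K3) && (iota u \in W) by [].
have io_inj : {in K3 &, injective (iota : {ffun 'I_3 -> Lf} -> M)}.
  move=> u v /K3P uK /K3P vK E; apply/eqP; rewrite -subr_eq0; apply/eqP.
  have := @iota_inj0 (u - v : V); apply.
    by move=> j; rewrite !ffunE; apply: fixqB.
  rewrite iotaD E; have -> : iota (- v : V) = - iota v.
    by rewrite /iota !ffunE !rmorphN; ring.
  exact: subrr.
(* Surjectivity by counting: [iota] is injective on [q^(3r)] vectors, and its target has at most
   that many elements. *)
have io_im : [set iota u | u : {ffun 'I_3 -> Lf} in K3] = [set x in fixq M q (3 * r)].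
  apply/eqP; rewrite eqEcard; apply/andP; split.
    apply/subsetP=> _ /imsetP[u /K3P uK ->]; rewrite inE.
    have uK3 j : i (u j) \in fixq M q (3 * r).
      by apply: (@fixq_dvd _ _ r); rewrite ?dvdn_mull // i_fix.
    have c3r : c \in fixq M q (3 * r) by apply: fixq_dvd c3; apply: dvdn_mulr.
    by do ![apply: fixqD | apply: fixqM | apply: fixqX | exact: uK3 | exact: c3r].
  rewrite card_in_imset // cardsE (leq_trans (card_fixq_le _ q_gt1 _)) ?muln_gt0 //.
  rewrite card_family foldrE big_map big_enum /= prod_nat_const card_ord.
  by rewrite (card_fixqL r_gt0 dimL) ?dvdn_mull // -expnM mulnC.
apply: (@scattered_set_min_length S).
- rewrite SE; apply/andP; split; first by apply/K3P=> j; rewrite ffunE fixq0.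
  by have -> : iota (0 : V) = 0 by rewrite /iota !ffunE !rmorph0 !mul0r !addr0.
- move=> u v; rewrite !SE => /andP[/K3P uK uW] /andP[/K3P vK vW].
  rewrite iotaD WD // andbT; apply/K3P=> j; rewrite ffunE.
  exact: fixqD.
- move=> a u aq; rewrite !SE => /andP[/K3P uK uW].
  rewrite iotaZ WZ // -?rmorphXn ?aq // andbT; apply/K3P=> j; rewrite ffunE.
  by apply: fixqM => //; apply: fixq_dvd (dvd1n r) _; apply/fixqP; rewrite expn1.
- by move=> u j; rewrite SE => /andP[/K3P].
- move=> u a; rewrite !SE => /andP[/K3P uK uW] nzu aK /andP[_]; rewrite iotaZ.
  move=> auW; apply: (fmorph_inj i); rewrite rmorphXn.
  apply: (Wsc _ (iota u)); rewrite ?i_fix //.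
  by apply: contraNneq nzu => /(iota_inj0 uK) ->.
apply: leq_trans cardW _.
have -> : #|S| = #|[set iota u | u : {ffun 'I_3 -> Lf} in S]|.
  by rewrite card_in_imset // => u v; rewrite !inE => /andP[uK _] /andP[vK _]; apply: io_inj.
apply/subset_leq_card/subsetP=> x xW.
have : x \in [set iota u | u : {ffun 'I_3 -> Lf} in K3] by rewrite io_im inE Wfix.
by case/imsetP=> u uK Ex; apply/imsetP; exists u; rewrite // inE uK -Ex.
Qed.

End ScatteredSet.

(** * Finite extensions of L *)

Lemma finField_exprD (F : finFieldType) (R : fieldType) (f : {rmorphism F -> R})
    (x y : R) : (x + y) ^+ #|F| = x ^+ #|F| + y ^+ #|F|.
Proof.
have [p p_pr pF] := finPcharP F.
rewrite exprDn_pchar //; apply/pnatP=> [|l l_pr]; first exact/ltnW/finNzRing_gt1.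
have /p_natP[k ->] : p.-nat #|F|.
  by rewrite -cardsT; apply: (abelem_pgroup (fin_ring_pchar_abelem pF)).
rewrite Euclid_dvdX // dvdn_prime2 // => /andP[/eqP-> _].
exact: (rmorph_pchar f).
Qed.

Lemma finField_natr_card (F : finFieldType) (R : fieldType)
  (f : {rmorphism F -> R}) : #|F|%:R = 0 :> R.
Proof.
rewrite -(rmorph_nat f) (_ : #|F|%:R = 0) ?rmorph0 //.
have [p p_pr pF] := finPcharP F; apply/eqP; rewrite -(dvdn_pcharf pF).
have /p_natP[k Ek] : p.-nat #|F|.
  by rewrite -cardsT; apply: (abelem_pgroup (fin_ring_pchar_abelem pF)).
have := finNzRing_gt1 F; rewrite Ek; case: k {Ek} => // k _.
by rewrite expnS dvdn_mulr.
Qed.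

Lemma exists_split_ext (F : finFieldType) (L : fieldExtType F) (P : {poly L}) :
  P != 0 -> exists (M : finFieldType) (i : {rmorphism L -> M}) (zs : seq M),
    map_poly i P %= \prod_(z <- zs) ('X - z%:P).
Proof.
move=> nzP; have [L' [zs Dzs _]] := @FinSplittingFieldFor (FinFieldExtType L) P nzP.
by exists (FinFieldExtType L'), (in_alg L' : {rmorphism L -> L'}), zs.
Qed.

(** [M] is a splitting field of [(X^(q^D) - X) P]. The first factor has derivative [-1], so its
    [q ^ D] roots are distinct. *)
Lemma exists_fixq_ext (F : finFieldType) (L : fieldExtType F) (D : nat)
    (P : {poly L}) : (0 < D)%N -> P != 0 ->
  exists (M : finFieldType) (i : {rmorphism L -> M}) (zs : seq M),
    [/\ forall x y : M, (x + y) ^+ #|F| = x ^+ #|F| + y ^+ #|F|,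
        #|fixq M #|F| D| = (#|F| ^ D)%N
      & map_poly i P %= \prod_(z <- zs) ('X - z%:P)].
Proof.
move=> D0 nzP; set q := #|F|; have q_gt1 : (1 < q)%N := finNzRing_gt1 F.
have qD_gt1 : (1 < q ^ D)%N by rewrite -(exp1n D) ltn_exp2r.
have szQ (R : idomainType) : size ('X^(q ^ D) - 'X : {poly R}) = (q ^ D).+1.
  by rewrite size_polyDl size_polyXn // size_polyN size_polyX ltnS.
have [|M [i [zs Dzs]]] := @exists_split_ext F L (('X^(q ^ D) - 'X) * P).
  by rewrite mulf_neq0 // -size_poly_eq0 szQ.
have [m1 E1] : {m1 | map_poly i P %= \prod_(z <- mask m1 zs) ('X - z%:P)}.
  by apply: dvdp_prod_XsubC; rewrite -(eqp_dvdr _ Dzs) rmorphM dvdp_mull.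
have [m2 E2] : {m2 | ('X^(q ^ D) - 'X : {poly M})
    %= \prod_(z <- mask m2 zs) ('X - z%:P)}.
  apply: dvdp_prod_XsubC; rewrite -(eqp_dvdr _ Dzs) rmorphM /=.
  by rewrite rmorphB /= map_polyXn map_polyX dvdp_mulr.
pose iF : {rmorphism F -> M} := i \o in_alg L.
exists M, i, (mask m1 zs); split=> //; first exact: (finField_exprD iF).
have uzs : uniq (mask m2 zs).
  rewrite -separable_prod_XsubC -(eqp_separable E2) unlock.
  rewrite derivB derivXn derivX -mulr_natr.
  have -> : (q ^ D)%:R = 0 :> {poly M}.
    rewrite natrX (_ : q%:R = 0) ?expr0n ?gtn_eqF //.
    by rewrite -polyC_natr (finField_natr_card iF).
  rewrite mulr0 add0r -[- 1 in X in coprimep _ X]scaleN1r.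
  by rewrite coprimepZr ?oppr_eq0 ?oner_eq0 // coprimep1.
transitivity (size (mask m2 zs)).
  rewrite -(card_uniqP uzs); apply: eq_card => x.
  by rewrite -root_XnsubX (eqp_root E2) root_prod_XsubC.
by apply: succn_inj; rewrite -(size_prod_XsubC _ id) -(eqp_size E2) szQ.
Qed.

Lemma exists_fixq3_ext (F : finFieldType) (L : fieldExtType F) (r : nat) :
  (0 < r)%N -> exists (M : finFieldType) (i : {rmorphism L -> M}) (c : M),
    [/\ forall x y : M, (x + y) ^+ #|F| = x ^+ #|F| + y ^+ #|F|,
        forall d, (d %| 3 * r)%N -> #|fixq M #|F| d| = (#|F| ^ d)%N,
        c \in fixq M #|F| 3 & c \notin fixq M #|F| 1].
Proof.
move=> r0; have q_gt1 := finNzRing_gt1 F.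
have r30 : (0 < 3 * r)%N by lia.
have [M [i [_ [exD cD _]]]] := @exists_fixq_ext F L (3 * r) 1 r30 (oner_neq0 _).
have cd d : (d %| 3 * r)%N -> #|fixq M #|F| d| = (#|F| ^ d)%N.
  by move=> dv; apply: card_fixq cD.
have /subsetPn[c c3 c1] : ~~ (fixq M #|F| 3 \subset fixq M #|F| 1).
  apply/negP=> /subset_leq_card; rewrite !cd ?dvdn_mulr ?dvd1n //.
  by rewrite leq_exp2l.
by exists M, i, c.
Qed.

(** * Exponents prime to the order of GL_2(F) *)

Definition mk3 (R : Type) (x y z : R) : {ffun 'I_3 -> R} :=
  [ffun j : 'I_3 => nth x [:: x; y; z] j].

Lemma mk3_0 (R : Type) (x y z : R) : mk3 x y z 0 = x.
Proof. by rewrite ffunE. Qed.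
Lemma mk3_1 (R : Type) (x y z : R) : mk3 x y z 1 = y.
Proof. by rewrite ffunE. Qed.
Lemma mk3_2 (R : Type) (x y z : R) : mk3 x y z (inord 2) = z.
Proof. by rewrite ffunE inordK. Qed.

Lemma ffun3P (R : Type) (u v : {ffun 'I_3 -> R}) :
  u 0 = v 0 -> u 1 = v 1 -> u (inord 2) = v (inord 2) -> u = v.
Proof.
move=> e0 e1 e2; apply/ffunP; case=> -[|[|[|//]]] lt.
- by rewrite (_ : Ordinal lt = 0) //; apply: val_inj.
- by rewrite (_ : Ordinal lt = 1) //; apply: val_inj.
by rewrite (_ : Ordinal lt = inord 2) //; apply: val_inj; rewrite /= inordK.
Qed.

Section Moebius.

Variables (F : finFieldType) (L : fieldExtType F) (r : nat).
Local Notation q := #|F|.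
Let exprDq : forall x y : L, (x + y) ^+ q = x ^+ q + y ^+ q.
Proof. exact: (finField_exprD (in_alg L)). Qed.
Let q_gt1 : (1 < q)%N := finNzRing_gt1 F.

(* The Frobenius orbit of [x] is an orbit of an element of [GL_2(F)]. *)
Lemma fixq_moebius (g : 'M[F]_2) (x : L) :
    g \in unitmx -> coprime r (q * q.-1 ^ 2 * q.+1) -> x \in fixq L q r ->
    x ^+ q * ((g 1 0)%:A * x + (g 1 1)%:A) = (g 0 0)%:A * x + (g 0 1)%:A ->
  x ^+ q = x.
Proof.
move=> Ug co xr E.
pose G := map_mx (in_alg L) g; pose t := (g 1 0)%:A * x + (g 1 1)%:A.
pose v k : 'cV[L]_2 := \col_j (if j == 0 then x ^+ (q ^ k) else 1).
have algq (a : F) k : a%:A ^+ (q ^ k) = a%:A :> L.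
  have a1 : a%:A \in fixq L q 1.
    by apply/fixqP; rewrite expn1 -in_algE -rmorphXn /= expf_card.
  by apply/fixqP; apply: fixq_dvd a1; apply: dvd1n.
have I2 (j : 'I_2) : j = 0 \/ j = 1.
  by case: j => -[|[|//]] lt; [left|right]; apply: val_inj.
(* [v k] represents the point [x^(q^k)] of the projective line. The entries of [g] are fixed by
   Frobenius, so [g] moves every point of the orbit to the next one, with the denominator [t] and
   its conjugates as scalars. *)
have Gv k : G *m v k = t ^+ (q ^ k) *: v k.+1.
  apply/colP=> j; rewrite !mxE big_ord2 !mxE /= mulr1.
  rewrite -(algq (g j 0) k) -(algq (g j 1) k) -exprMn -(expqD exprDq).
  rewrite expnS exprM; case: (I2 j) => -> /=; last by rewrite mulr1.
  by rewrite -E mulrC exprMn.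
have UG : G \in unitmx by rewrite map_unitmx.
have nzt : t != 0.
  apply/eqP=> t0; have := Gv 0%N; rewrite t0 expn0 expr1 scale0r.
  move/(congr1 (mulmx (invmx G))); rewrite mulKmx // mulmx0 => /colP/(_ 1).
  by rewrite !mxE /= => /eqP; rewrite oner_eq0.
have Gn k : exists2 T, T != 0 & G ^+ k *m v 0%N = T *: v k.
  elim: k => [|k [T nzT IHk]]; first by exists 1; rewrite ?oner_eq0 // mul1mx scale1r.
  exists (T * t ^+ (q ^ k)); first by rewrite mulf_neq0 ?expf_neq0.
  by rewrite exprS -mulmxA IHk -scalemxAr Gv scalerA.
(* By Lagrange [G ^+ n = 1], whence [x ^+ (q ^ n) = x]; this exponent is prime to [r]. *)
pose n := #|'GL_2[F]%g|.
have gn1 : g ^+ n = 1.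
  have := expg_cardG (in_setT (FinRing.unit 'M[F]_2 Ug : {'GL_2[F]})).
  by move/(congr1 val); rewrite FinRing.val_unitX /= => ->.
have [T _] := Gn n; rewrite -rmorphXn gn1 rmorph1 mul1mx => /colP EQ.
have := EQ 1; have := EQ 0; rewrite !mxE /= mulr1 expn0 expr1 => Ex ET.
apply: (fixq_coprime (d := r) (e := n)) => //; first by rewrite /n card_GL_2.
by apply/fixqP; rewrite -[LHS]mul1r [1]ET -Ex.
Qed.

Lemma fixq_moebiusL (m00 m01 m10 m11 x : L) :
    m00 ^+ q = m00 -> m01 ^+ q = m01 -> m10 ^+ q = m10 -> m11 ^+ q = m11 ->
    m00 * m11 - m01 * m10 != 0 ->
    coprime r (q * q.-1 ^ 2 * q.+1) -> x \in fixq L q r ->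
    x ^+ q * (m10 * x + m11) = m00 * x + m01 ->
  x ^+ q = x.
Proof.
move=> /fixq1_alg[a00 ->] /fixq1_alg[a01 ->] /fixq1_alg[a10 ->] /fixq1_alg[a11 ->].
move=> nz_det co xr.
pose g : 'M[F]_2 := \matrix_(i, j) if i == 0 then if j == 0 then a00 else a01
  else if j == 0 then a10 else a11.
suff Ug : g \in unitmx by move=> E; apply: (fixq_moebius Ug co xr); rewrite !mxE.
rewrite unitmxE unitfE (expand_det_row _ 0) big_ord2 /cofactor !det_mx11 !mxE /=.
rewrite (_ : a00 * _ + _ = a00 * a11 - a01 * a10); last by rewrite !expr0 ?expr1; ring.
apply: contraNneq nz_det => /(congr1 (in_alg L)).
by rewrite rmorphB !rmorphM rmorph0 => <-.
Qed.

End Moebius.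

Section CoprimeCase.

Variables (F : finFieldType) (L : fieldExtType F) (r : nat).
Local Notation q := #|F|.
Local Notation V := {ffun 'I_3 -> L}.
Local Notation Lf := (finvect_type L).
Hypotheses (r_gt0 : (0 < r)%N) (dimL : \dim {:L} = (2 * r)%N).
Hypothesis co_r : coprime r (q * q.-1 ^ 2 * q.+1).

Let exprDq : forall x y : L, (x + y) ^+ q = x ^+ q + y ^+ q.
Proof. exact: (finField_exprD (in_alg L)). Qed.
Let q_gt1 : (1 < q)%N := finNzRing_gt1 F.
Let exprBq (x y : L) : (x - y) ^+ q = x ^+ q - y ^+ q.
Proof. by have := expqB q_gt1 exprDq 1 x y; rewrite !expn1. Qed.

(* When [(a, a')] and [(b, b')] are not proportional, the Moebius relation comes from
   the Frobenius invariance of [(rho^q - 1) (rho - 1) / rho], where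
   [rho := (a l - a') / (b l - b')]. *)
Lemma coprime_case_scattered (l Y a a' b b' : L) :
    l \in fixq L q r -> a ^+ q = a -> a' ^+ q = a' -> b ^+ q = b -> b' ^+ q = b' ->
    Y != 0 -> (l ^+ q - l) * Y = a * l - a' ->
    (l ^+ q - l ^+ q ^+ q) * Y = b * l ^+ q ^+ q - b' ->
  l ^+ q = l.
Proof.
move=> lr aq a'q bq b'q nzY E1 E2; apply/eqP; apply: contraT => nl.
have l0 : l ^+ q - l != 0 by rewrite subr_eq0.
have l1 : l ^+ q - l ^+ q ^+ q != 0.
  rewrite subr_eq0; apply: contra nl => /eqP E.
  have := expq_inj q_gt1 exprDq (d := 1); rewrite expn1 => H.
  by apply/eqP/H; rewrite -E.
have nzA : a * l - a' != 0 by rewrite -E1 mulf_neq0.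
have nzB2 : b * l ^+ q ^+ q - b' != 0 by rewrite -E2 mulf_neq0.
have Bq x : (b * x - b') ^+ q = b * x ^+ q - b' by rewrite exprBq exprMn bq b'q.
have Aq x : (a * x - a') ^+ q = a * x ^+ q - a' by rewrite exprBq exprMn aq a'q.
have nzB1 : b * l ^+ q - b' != 0.
  by apply: contraNneq nzB2 => E; rewrite -Bq E expr0n gtn_eqF // ltnW.
have nzB : b * l - b' != 0.
  by apply: contraNneq nzB1 => E; rewrite -Bq E expr0n gtn_eqF // ltnW.
have nzA1 : a * l ^+ q - a' != 0 by rewrite -Aq expf_neq0.
have E : (a * l - a') * (l ^+ q - l ^+ q ^+ q) = (b * l ^+ q ^+ q - b') * (l ^+ q - l).
  by rewrite -E1 -E2; ring.
have fr x : x ^+ q = x -> x \in fixq L q r.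
  by move=> xq; apply: fixq_dvd (dvd1n r) _; apply/fixqP; rewrite expn1.
(* Lowering the order: the relation says exactly that [e = y^q - c y] is fixed by Frobenius, so
   [y^q = c y + e] is an affine map over [F]. *)
have affine (y c : L) : y \in fixq L q r -> c != 0 -> c ^+ q = c ->
    y ^+ q ^+ q - y ^+ q = c * (y ^+ q - y) -> y ^+ q = y.
  move=> yr nzc cq Ey; pose e := y ^+ q - c * y.
  have eq : e ^+ q = e by rewrite /e exprBq exprMn cq -[X in X - _](subrK (y ^+ q)) Ey; ring.
  apply: (@fixq_moebiusL F L r c e 0 1); rewrite ?expr0n ?expr1n ?gtn_eqF //.
  - by rewrite ltnW.
  - by rewrite mulr1 mulr0 subr0.
  by rewrite /e; ring.
case/negP: nl; apply/eqP.
have [D0|nzD] := eqVneq (a' * b) (a * b'); last first.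
  have [rho rhoE] : exists rho, rho = (a * l - a') / (b * l - b') by eexists.
  have rhor : rho \in fixq L q r.
    by rewrite rhoE; apply: fixqf; apply: (fixqB q_gt1 exprDq); try apply: fixqM; auto.
  have rho1 : rho ^+ q = (a * l ^+ q - a') / (b * l ^+ q - b').
    by rewrite rhoE exprMn exprVn Aq Bq.
  have rho2 : rho ^+ q ^+ q = (a * l ^+ q ^+ q - a') / (b * l ^+ q ^+ q - b').
    by rewrite rho1 exprMn exprVn Aq Bq.
  have nzrho : rho != 0 by rewrite rhoE mulf_neq0 ?invr_eq0.
  have R : rho ^+ q ^+ q = rho ^+ q + 1 - rho ^+ q / rho.
    rewrite rho2 rho1 rhoE; move: E nzA nzB nzB1 nzB2.
    move: (l ^+ q) (l ^+ q ^+ q) => k1 k2 E nzA nzB nzB1 nzB2.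
    apply/eqP; rewrite -subr_eq0.
    have -> : (a * k2 - a') / (b * k2 - b') - ((a * k1 - a') / (b * k1 - b') + 1
        - (a * k1 - a') / (b * k1 - b') / ((a * l - a') / (b * l - b')))
      = (a * b' - a' * b) * ((a * l - a') * (k1 - k2) - (b * k2 - b') * (k1 - l))
         / ((b * k2 - b') * (b * k1 - b') * (a * l - a')).
      by field; rewrite nzA nzB nzB1 nzB2.
    by rewrite E subrr mulr0 mul0r.
  have rho_fix : rho ^+ q = rho.
    pose J := (rho ^+ q - 1) * (rho - 1) / rho.
    have nzrho1 : rho ^+ q != 0 by rewrite expf_neq0.
    have Jq : J ^+ q = J.
      rewrite /J !exprMn exprVn !exprBq !expr1n R.
      by move: (rho ^+ q) nzrho1 => k1 nzk1; field; rewrite nzrho nzk1.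
    have [J0|nzJ] := eqVneq J 0.
      move/eqP: J0; rewrite !mulf_eq0 invr_eq0 (negPf nzrho) orbF !subr_eq0.
      case/orP=> /eqP k1; last by rewrite k1 expr1n.
      rewrite k1; have := expq_inj q_gt1 exprDq (d := 1); rewrite expn1 => H.
      by apply: H; rewrite k1 expr1n.
    have q1 : (-1 : L) ^+ q = -1.
      have := exprBq 0 1; rewrite !sub0r expr0n gtn_eqF ?sub0r ?expr1n //.
      by rewrite ltnW.
    (* Solving [J rho = (rho^q - 1) (rho - 1)] for [rho^q] gives this matrix. Its determinant is
       [-J], which is why [J = 0] was treated apart. *)
    apply: (@fixq_moebiusL F L r (J + 1) (-1) 1 (-1)); rewrite ?expr1n //.
    - by rewrite exprDq Jq expr1n.
    - by rewrite (_ : _ - _ = - J) ?oppr_eq0 //; ring.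
    by rewrite /J; field.
  (* Inverting the definition of [rho] expresses [l] rationally in elements of [F]. *)
  have Erho : (a - rho * b) * l = a' - rho * b'.
    have : rho * (b * l - b') = a * l - a' by rewrite rhoE divfK.
    by move=> H; rewrite mulrBl -[a * l](subrK a') -H; ring.
  have nzc : a - rho * b != 0.
    apply: contraNneq nzD => c0; move/eqP: (Erho); rewrite c0 mul0r eq_sym subr_eq0.
    by move=> /eqP->; move/subr0_eq: c0 => ->; apply/eqP; ring.
  have -> : l = (a' - rho * b') / (a - rho * b) by rewrite -Erho mulrC mulKf.
  by rewrite exprMn exprVn !exprBq !exprMn rho_fix aq a'q bq b'q.
have [b0|nzb] := eqVneq b 0.
  have nzb' : b' != 0 by move: nzB; rewrite b0 mul0r sub0r oppr_eq0.
  have a0 : a = 0 by move/esym/eqP: D0; rewrite b0 mulr0 mulf_eq0 (negPf nzb') orbF => /eqP.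
  have nza' : a' != 0 by move: nzA; rewrite a0 mul0r sub0r oppr_eq0.
  apply: (affine l (- (b' / a'))) => //.
  - by rewrite oppr_eq0 mulf_neq0 ?invr_eq0.
  - have := exprBq 0 (b' / a'); rewrite !sub0r expr0n gtn_eqF ?sub0r; last by rewrite ltnW.
    by move=> ->; rewrite exprMn exprVn b'q a'q.
  move: E; rewrite a0 b0 !mul0r !sub0r.
  move: (l ^+ q) (l ^+ q ^+ q) => k1 k2 E; apply: (mulfI nza').
  transitivity (- a' * (k1 - k2)); first by ring.
  by rewrite E; field.
have nza : a != 0.
  apply: contraNneq nzA => a0; move/eqP: D0.
  by rewrite a0 mul0r mulf_eq0 (negPf nzb) orbF => /eqP->; rewrite mul0r subrr.
(* The pairs are now proportional, so [a l - a'] and [b l - b'] vanish at the same [b' / b]. After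
   this shift, division by [k k^q k^(q^2)] makes the relation affine in [k^-1]. *)
have [k kE] : exists k, k = l - b' / b by eexists.
have Ek : l = k + b' / b by rewrite kE subrK.
have b'bq : (b' / b) ^+ q = b' / b by rewrite exprMn exprVn bq b'q.
have Ek1 : l ^+ q = k ^+ q + b' / b by rewrite {1}Ek exprDq b'bq.
have Ek2 : l ^+ q ^+ q = k ^+ q ^+ q + b' / b by rewrite Ek1 exprDq b'bq.
have Ea' : a' = a * (b' / b) by rewrite mulrA -D0 mulfK.
have nzk : k != 0.
  apply: contraNneq nzB => k0; rewrite Ek k0 add0r mulrC divfK // subrr.
  by [].
suff : k^-1 ^+ q = k^-1.
  by rewrite exprVn => /invr_inj kq; rewrite Ek1 kq -Ek.
have kr : k \in fixq L q r by rewrite kE; apply: (fixqB q_gt1 exprDq) => //; apply: fr.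
apply: (affine _ (- (b / a))).
- exact: fixqV.
- by rewrite oppr_eq0 mulf_neq0 ?invr_eq0.
- have := exprBq 0 (b / a); rewrite !sub0r expr0n gtn_eqF ?sub0r; last by rewrite ltnW.
  by move=> ->; rewrite exprMn exprVn bq aq.
rewrite !exprVn; move: E; rewrite Ek2 Ek1 Ek Ea'.
have nzk1 : k ^+ q != 0 by rewrite expf_neq0.
have nzk2 : k ^+ q ^+ q != 0 by rewrite expf_neq0.
move: (k ^+ q) (k ^+ q ^+ q) nzk1 nzk2 => k1 k2 nzk1 nzk2 E.
have {}E : a * k * (k1 - k2) = b * k2 * (k1 - k).
  transitivity ((a * (k + b' / b) - a * (b' / b)) * (k1 + b' / b - (k2 + b' / b))).
    by ring.
  by rewrite E; field.
apply/eqP; rewrite -subr_eq0.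
have -> : k2^-1 - k1^-1 - - (b / a) * (k1^-1 - k^-1)
    = (a * k * (k1 - k2) - b * k2 * (k1 - k)) / (a * k * k1 * k2).
  by field; rewrite nza nzk nzk1 nzk2.
by rewrite E subrr mul0r.
Qed.

Theorem coprime_min_length : min_length_saturating L 3 2 (r + 2).
Proof.
pose A : {pred Lf * Lf * Lf} := [pred t | [&& t.1.1 \in fixq L q r,
  t.1.2 \in fixq L q 1 & t.2 \in fixq L q 1]].
pose f (t : Lf * Lf * Lf) : {ffun 'I_3 -> Lf} :=
  mk3 (t.1.1 ^+ q) (t.1.1 ^+ q ^+ q + t.1.2) (t.1.1 + t.2).
pose S : {pred {ffun 'I_3 -> Lf}} := mem [set f t | t in A].
have SP (u : V) : reflect (exists y a b : L, [/\ y \in fixq L q r, a ^+ q = a,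
    b ^+ q = b & u = mk3 (y ^+ q) (y ^+ q ^+ q + a) (y + b)]) (u \in S).
  apply: (iffP imsetP) => [[[[y a] b]] | [y [a [b [yr aq bq ->]]]]].
    move=> /and3P[/= yr /eqP aq /eqP bq] ->; exists y, a, b.
    by rewrite expn1 in aq bq.
  exists (y, a, b) => //; apply/and3P; split=> //=.
    by apply/fixqP; rewrite expn1.
  by apply/fixqP; rewrite expn1.
have q0 : (0 : L) ^+ q = 0 by have := expq0 L q_gt1 1; rewrite expn1.
have fr x : x ^+ q = x -> x \in fixq L q r.
  by move=> xq; apply: fixq_dvd (dvd1n r) _; apply/fixqP; rewrite expn1.
apply: (scattered_set_min_length r_gt0 dimL exprDq (S := S)).
- apply/SP; exists 0, 0, 0; split=> //; first exact: fixq0.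
  by apply: ffun3P; rewrite ?mk3_0 ?mk3_1 ?mk3_2 ffunE ?q0 ?addr0 // q0.
- move=> u v /SP[y [a [b [yr aq bq ->]]]] /SP[y' [a' [b' [yr' aq' bq' ->]]]].
  apply/SP; exists (y + y'), (a + a'), (b + b'); split; rewrite ?exprDq ?aq ?aq' ?bq ?bq' //.
    exact: fixqD.
  by apply: ffun3P; rewrite ffunE ?mk3_0 ?mk3_1 ?mk3_2 //; ring.
- move=> c u cq /SP[y [a [b [yr aq bq ->]]]].
  apply/SP; exists (c * y), (c * a), (c * b); split; rewrite ?exprMn ?cq ?aq ?bq //.
    by apply: fixqM => //; apply: fr.
  by apply: ffun3P; rewrite ffunE ?mk3_0 ?mk3_1 ?mk3_2 //; ring.
- move=> u j /SP[y [a [b [yr aq bq ->]]]]; rewrite ffunE.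
  have := ltn_ord j; case: (nat_of_ord j) => [|[|[|//]]] _ /=.
  + exact: fixqX.
  + by apply: (fixqD exprDq); [do 2!apply: fixqX | apply: fr].
  by apply: (fixqD exprDq); last apply: fr.
- move=> u c /SP[y [a [b [yr aq bq Eu]]]] nzu cr /SP[y' [a' [b' [yr' aq' bq' Ec]]]].
  have ecu k : c * u k = mk3 (y' ^+ q) (y' ^+ q ^+ q + a') (y' + b') k.
    by rewrite -Ec ffunE.
  have := ecu 0; have := ecu 1; have := ecu (inord 2); rewrite {1 2 3}Eu.
  rewrite !mk3_0 !mk3_1 !mk3_2 => e2 e1 e0.
  (* The first coordinate gives [y'^q = c y^q], which eliminates [y'] from the other two. The third
     equation is raised to the power [q] twice, so that both results carry the same factor
     [y^(q^2)]. *)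
  have e0' : y' ^+ q ^+ q = c ^+ q * y ^+ q ^+ q by rewrite -e0 exprMn.
  have e1' : (c ^+ q - c) * y ^+ q ^+ q = a * c - a'.
    rewrite mulrBl -e0' -[y' ^+ q ^+ q](addrK a') -e1; ring.
  have e2' : (c ^+ q - c ^+ q ^+ q) * y ^+ q ^+ q = b * c ^+ q ^+ q - b'.
    have : (c - c ^+ q) * y ^+ q = b * c ^+ q - b'.
      move/(congr1 (fun x => x ^+ q)): e2; rewrite exprMn !exprDq bq bq' -e0 => e2.
      rewrite mulrBl -[c * _](addrK b') -e2; ring.
    move/(congr1 (fun x => x ^+ q)); rewrite exprMn !exprBq exprMn bq bq'.
    by [].
  (* For [y = 0] the vector is [(0, a, b)] over [F], and [c] is a quotient of elements of [F]. *)
  have [y0|nzy] := eqVneq y 0; last first.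
    by apply: (coprime_case_scattered cr aq aq' bq bq' _ e1' e2'); rewrite !expf_neq0.
  move: e1 e2 e0; rewrite y0 !q0 !mulr0 !add0r => e1 e2 /eqP.
  rewrite eq_sym expf_eq0 => /andP[_ /eqP y'0].
  move: e1 e2; rewrite y'0 !q0 !add0r => e1 e2.
  have [a0|nza] := eqVneq a 0; last first.
    have -> : c = a' / a by rewrite -e1 mulfK.
    by rewrite exprMn exprVn aq aq'.
  have [b0|nzb] := eqVneq b 0; last first.
    have -> : c = b' / b by rewrite -e2 mulfK.
    by rewrite exprMn exprVn bq bq'.
  case/eqP: nzu; rewrite Eu y0 a0 b0 !q0 !addr0; apply: ffun3P;
    by rewrite ?mk3_0 ?mk3_1 ?mk3_2 ffunE.
have f_inj : {in A &, injective f}.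
  move=> [[y a] b] [[y' a'] b'] _ _ E.
  have := congr1 (fun w : V => w 0) E; have := congr1 (fun w : V => w 1) E.
  have := congr1 (fun w : V => w (inord 2)) E.
  rewrite !mk3_0 !mk3_1 !mk3_2 /= => e2 e1 e0.
  have := expq_inj q_gt1 exprDq (d := 1); rewrite expn1 => /(_ _ _ e0) ey.
  by move: e1 e2; rewrite ey => /addrI-> /addrI->.
rewrite (_ : #|S| = #|[set f t | t in A]|); last exact: eq_card.
rewrite card_in_imset //.
pose B : {pred Lf * Lf * Lf} := [predX [predX fixq (FinFieldExtType L) q r
  & fixq (FinFieldExtType L) q 1] & fixq (FinFieldExtType L) q 1].
rewrite (_ : #|A| = #|B|); last by apply: eq_card => -[[y a] b]; rewrite !inE /= andbA.
by rewrite !cardX !(card_fixqL r_gt0 dimL) ?dvd1n ?dvdn_mull // -!expnD -addnA.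
Qed.

End CoprimeCase.

(** * Exponents congruent to 1 modulo 3 *)

Section Greedy.

Variables (M : finFieldType) (q r : nat).
Hypothesis q_gt1 : (1 < q)%N.
Hypothesis exprDq : forall x y : M, (x + y) ^+ q = x ^+ q + y ^+ q.
Hypotheses (r_gt1 : (1 < r)%N) (r3 : ~~ (3 %| r)%N).
Hypothesis card_fix : forall d, (d %| 3 * r)%N -> #|fixq M q d| = (q ^ d)%N.

Local Notation fix_ d := (fixq M q d).

Definition fix3_scattered (W : {set M}) : Prop :=
  [/\ 0 \in W, {in W &, forall x y, x + y \in W},
      {in fix_ 3 & W, forall c x, c * x \in W}, {subset W <= fix_ (3 * r)}
    & forall a x, x \in W -> x != 0 -> a \in fix_ r -> a * x \in W -> a \in fix_ 1].

Let fix1_3 x : x \in fix_ 1 -> x \in fix_ 3.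
Proof. exact: fixq_dvd. Qed.
Let fix1_r x : x \in fix_ 1 -> x \in fix_ r.
Proof. exact: fixq_dvd (dvd1n r). Qed.

Let fix_r3 x : x \in fix_ r -> x \in fix_ 3 -> x \in fix_ 1.
Proof.
move=> xr x3; apply/fixqP; rewrite expn1.
by apply: fixq_coprime x3 xr; rewrite prime_coprime.
Qed.

Section Step.

Variable W : {set M}.

(** For [t = ((l, c), (x, y))] the equation reads [l (x + z) = y + c z]: two vectors of [W + T z]
    are proportional by a scalar of [K] outside [F]. *)
Definition ext_wit (z : M) (t : M * M * (M * M)) : bool :=
  [&& t.1.1 \in fix_ r, t.1.1 \notin fix_ 1, t.1.2 \in fix_ 3, t.2.1 \in W
    & t.2.2 \in W] && (z * (t.1.1 - t.1.2) == t.2.2 - t.1.1 * t.2.1).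

Definition bad_ext : {set M} := [set z | [exists t, ext_wit z t]].

Lemma bad_extP z l c x y : l \in fix_ r -> l \notin fix_ 1 -> c \in fix_ 3 ->
  x \in W -> y \in W -> z * (l - c) = y - l * x -> z \in bad_ext.
Proof.
move=> lr l1 c3 xW yW E; rewrite inE; apply/existsP; exists (l, c, (x, y)).
by rewrite /ext_wit /= lr l1 c3 xW yW E eqxx.
Qed.

Hypothesis scW : fix3_scattered W.

(* The affine group of [F] acts freely on the witnesses of [z \in bad_ext]. *)
Lemma card_bad_ext :
  (#|bad_ext| * (q.-1 * q) <= (q ^ r - q) * q ^ 3 * (#|W| * #|W|))%N.
Proof.
have [W0 WD WZ Wfix Wsc] := scW.
pose t z := odflt (0, 0, (0, 0)) [pick t | ext_wit z t].
have tP z : z \in bad_ext -> ext_wit z (t z).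
  by rewrite inE /t; case: pickP => //= H /existsP[w]; rewrite H.
pose Fs d := [set x in fix_ d].
have FsE d x : (x \in Fs d) = (x \in fix_ d) by rewrite inE.
pose Fs0 := [set x in fix_ 1 | x != 0].
have Fs0E x : (x \in Fs0) = (x != 0) && (x \in fix_ 1) by rewrite inE andbC.
pose D := setX bad_ext (setX Fs0 (Fs 1%N)).
pose A := setX (setX (Fs r :\: Fs 1%N) (Fs 3)) (setX W W).
(* Multiplying [l (x + z) = y + c z] by [a] and adding [b (x + z)] gives a witness for the same [z],
   with [a l + b] and [a c + b] in place of [l] and [c]. *)
pose f (w : M * (M * M)) : M * M * (M * M) :=
  (w.2.1 * (t w.1).1.1 + w.2.2, w.2.1 * (t w.1).1.2 + w.2.2,
   ((t w.1).2.1, w.2.1 * (t w.1).2.2 + w.2.2 * (t w.1).2.1)).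
have l1P l a b : l \notin fix_ 1 -> a \in fix_ 1 -> b \in fix_ 1 ->
    a * l + b \in fix_ 1 -> a = 0.
  move=> l1 a1 b1 h; apply: contraNeq l1 => nza.
  rewrite (_ : l = (a * l + b - b) / a); last by rewrite addrK mulrC mulKf.
  by apply: fixqf => //; apply: (fixqB q_gt1 exprDq).
have fA w : w \in D -> f w \in A.
  case: w => z [a b]; rewrite /f /=; move: (tP z).
  case: (t z) => [[l c] [x y]]; rewrite /ext_wit /= => /[swap].
  rewrite !in_setX in_setD Fs0E !FsE.
  case/and3P=> zb /andP[nza a1] b1 /(_ zb)/andP[/and5P[lr l1 c3 xW yW] _].
  rewrite -!andbA; apply/and5P; split=> //.
  - by apply: contra nza => h; rewrite (l1P _ _ _ l1 a1 b1 h).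
  - by apply: (fixqD exprDq); [apply: fixqM|]; try exact: fix1_r.
  - by apply: (fixqD exprDq); [apply: fixqM|]; try exact: fix1_3.
  by rewrite WD // WZ // fix1_3.
have f_inj : {in D &, injective f}.
  move=> [z [a b]] [z' [a' b']]; rewrite !in_setX !Fs0E !FsE.
  case/and3P=> /tP zb /andP[nza a1] b1 /and3P[/tP z'b /andP[nza' a'1] b'1].
  rewrite /f /=.
  case Et: (t z) zb => [[l c] [x y]]; case Et': (t z') z'b => [[l' c'] [x' y']].
  rewrite /ext_wit /= => /andP[/and5P[lr' l1' c3' xW' yW'] /eqP E'].
  move=> /andP[/and5P[lr l1 c3 xW yW] /eqP E] [e1 e2 e3 e4].
  (* A witness determines [z], because [l - c] is nonzero: [K] and [T] meet in [F], and [l] is not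
     in [F]. The chosen witnesses then agree, and as [l] is not in [F], the value [a l + b]
     determines [a] and [b]. *)
  have Ez : z = z'.
    have nz : (a * l + b) - (a * c + b) != 0.
      rewrite subr_eq0; apply: contra nza => /eqP h.
      have h3 : a * c + b \in fix_ 3.
        by apply: (fixqD exprDq); [apply: fixqM|]; try exact: fix1_3.
      have hr : a * l + b \in fix_ r.
        by apply: (fixqD exprDq); [apply: fixqM|]; try exact: fix1_r.
      rewrite -h in h3; apply/eqP; exact: (l1P _ _ _ l1 a1 b1 (fix_r3 hr h3)).
    apply: (mulIf nz); rewrite {2}e1 {2}e2.
    transitivity (a * (z * (l - c))); first by ring.
    transitivity (a' * (z' * (l' - c'))); last by ring.
    rewrite E E'.
    transitivity (a * y + b * x - (a * l + b) * x); first by ring.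
    by rewrite e4 e1 e3; ring.
  move: Et'; rewrite -Ez Et => -[e5 _ _ _]; rewrite -e5 in e1.
  have Ea : a = a'.
    apply/eqP; rewrite -subr_eq0; apply/eqP.
    apply: (l1P l _ (b - b') l1); rewrite ?(fixqB q_gt1 exprDq) //.
    rewrite (_ : _ + _ = a * l + b - (a' * l + b')); last by ring.
    by rewrite e1 subrr fixq0.
  by move: e1; rewrite Ea => /addrI->.
have cFs d : (d %| 3 * r)%N -> #|Fs d| = (q ^ d)%N by rewrite cardsE; apply: card_fix.
have cF1 : #|Fs 1%N| = q by rewrite cFs ?dvd1n // expn1.
have cA : #|A| = ((q ^ r - q) * q ^ 3 * (#|W| * #|W|))%N.
  rewrite !cardsX cardsD (_ : _ :&: Fs 1%N = Fs 1%N) ?cF1.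
    by rewrite (cFs r (dvdn_mull _ (dvdnn r))) (cFs 3 (dvdn_mulr _ (dvdnn 3))).
  by apply/setIidPr/subsetP=> x; rewrite !FsE; apply: fix1_r.
have cD : #|D| = (#|bad_ext| * (q.-1 * q))%N.
  rewrite !cardsX cF1; congr (_ * (_ * _))%N.
  have := cardD1 0 (fix_ 1); rewrite card_fix ?dvd1n // expn1 fixq0 // add1n.
  by move=> -> /=; rewrite cardsE; apply: eq_card => x; rewrite !inE andbC.
rewrite -cA -cD -(card_in_imset f_inj).
by apply/subset_leq_card/subsetP=> _ /imsetP[w wD ->]; apply: fA.
Qed.

End Step.

Lemma scattered_step (W : {set M}) b : fix3_scattered W -> #|W| = (q ^ (3 * b))%N ->
  (3 * b < r)%N -> exists W', fix3_scattered W' /\ #|W'| = (q ^ (3 * b.+1))%N.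
Proof.
move=> scW cW br; have [W0 WD WZ Wfix Wsc] := scW.
have [z zfix zb] : exists2 z, z \in fix_ (3 * r) & z \notin bad_ext W.
  apply/subsetPn; apply/negP=> /subset_leq_card; rewrite card_fix // => h.
  have := leq_trans (leq_mul h (leqnn (q.-1 * q))) (card_bad_ext scW).
  (* From [3 b <= r - 1] the number of witnesses is at most [(q^r - q) q^(2r+1) < q^(3r+1)]. If all
     [q^(3r)] elements were bad, it would be at least [q^(3r) q (q - 1)]. *)
  apply/negP; rewrite -ltnNge cW -expnD -mulnA -expnD.
  apply: (@leq_trans (q ^ (3 * r) * q)); last first.
    by rewrite leq_mul2l -[X in (X <= _)%N]mul1n leq_mul2r -ltnS prednK ?q_gt1 ?orbT // ltnW.
  apply: (@leq_ltn_trans ((q ^ r - q) * q ^ (2 * r + 1))).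
    by rewrite leq_mul2l leq_exp2l //; lia.
  rewrite mulnBl -expnD (_ : r + (2 * r + 1) = (3 * r).+1)%N; last by lia.
  by rewrite expnSr ltn_subrL !muln_gt0 !expn_gt0 (ltnW q_gt1).
have [l lr l1] : exists2 l, l \in fix_ r & l \notin fix_ 1.
  apply/subsetPn; apply/negP=> /subset_leq_card.
  by rewrite !card_fix ?dvd1n ?dvdn_mull // leq_exp2l // leqNgt r_gt1.
(* Elements of [W] are bad: take [x = -z] and [y = c = 0]. *)
have zW : z \notin W.
  apply: contra zb => zW; apply: (bad_extP lr l1 (fixq0 M q_gt1 3) _ W0 (x := - z)).
    by rewrite -mulN1r WZ // fixqN ?fixq1.
  by ring.
pose T := [set x in fix_ 3].
pose f (w : M * M) := w.1 + w.2 * z.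
have f_inj : {in setX W T &, injective f}.
  move=> [w c] [w' c']; rewrite !in_setX ![_ \in T]inE /f /=.
  move=> /andP[wW c3] /andP[wW' c3'] E.
  have Ecz : (c - c') * z = w' - w by rewrite mulrBl -[c * z](addKr w) E; ring.
  have [Ec|nc] := eqVneq c c'.
    by move: E; rewrite Ec => /addIr->.
  case/negP: zW; have -> : z = (c - c')^-1 * (w' - w).
    by rewrite -Ecz mulKf // subr_eq0.
  apply: (WZ); first by apply/fixqV/fixqB.
  by apply: (WD) => //; rewrite -mulN1r WZ // fixqN ?fixq1.
exists [set f w | w in setX W T]; split; last first.
  rewrite card_in_imset // cardsX cW cardsE card_fix ?dvdn_mulr // -expnD.
  by congr (_ ^ _)%N; lia.
have W'P x : reflect (exists w c, [/\ w \in W, c \in fix_ 3 & x = w + c * z])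
    (x \in [set f w | w in setX W T]).
  apply: (iffP imsetP) => [[[w c]]|[w [c [wW c3 ->]]]].
    by rewrite in_setX [_ \in T]inE /= => /andP[wW c3] ->; exists w, c.
  by exists (w, c) => //; rewrite in_setX [_ \in T]inE /= wW.
split.
- by apply/W'P; exists 0, 0; rewrite W0 fixq0 // mul0r addr0.
- move=> _ _ /W'P[w [c [wW c3 ->]]] /W'P[w' [c' [wW' c3' ->]]].
  apply/W'P; exists (w + w'), (c + c'); split; rewrite ?WD ?fixqD //; ring.
- move=> a _ a3 /W'P[w [c [wW c3 ->]]].
  apply/W'P; exists (a * w), (a * c); split; rewrite ?WZ ?fixqM //; ring.
- move=> _ /W'P[w [c [wW c3 ->]]]; apply: (fixqD exprDq); first exact: Wfix.
  by apply: fixqM => //; apply: fixq_dvd c3; apply: dvdn_mulr.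
move=> a _ /W'P[w [c [wW c3 ->]]] nzx ar /W'P[w' [c' [wW' c3' E]]].
apply: contraNT zb => a1.
have nza : a != 0 by apply: contraNneq a1 => ->; rewrite fixq0.
have [c0|nzc] := eqVneq c 0.
  move: E nzx; rewrite c0 mul0r addr0 => E nzw.
  have [c'0|nzc'] := eqVneq c' 0.
    case/negP: a1; apply: (Wsc a w) => //.
    by rewrite E c'0 mul0r addr0.
  (* Only the image involves [z], so the two vectors exchange roles and the scalar becomes
     [a^-1]. *)
  apply: (@bad_extP _ _ a^-1 0 (c'^-1 * w') (c'^-1 * w)).
  - exact: fixqV.
  - by apply: contra a1 => /fixqV; rewrite invrK.
  - exact: fixq0.
  - by rewrite WZ // fixqV.
  - by rewrite WZ // fixqV.
  have -> : w = a^-1 * (w' + c' * z) by rewrite -E mulKf.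
  by field; rewrite ?nza ?nzc'.
apply: (@bad_extP _ _ a (c^-1 * c') (c^-1 * w) (c^-1 * w')) => //.
- by rewrite fixqM ?fixqV.
- by rewrite WZ // fixqV.
- by rewrite WZ // fixqV.
have -> : w' = a * (w + c * z) - c' * z by rewrite E addrK.
by field.
Qed.

Lemma exists_fix3_scattered b : (3 * b < r + 3)%N ->
  exists W, fix3_scattered W /\ #|W| = (q ^ (3 * b))%N.
Proof.
elim: b => [|b IHb] lb.
  exists [set 0]; split; last by rewrite cards1.
  split; rewrite ?inE //.
  - by move=> x y; rewrite !inE => /eqP-> /eqP->; rewrite addr0.
  - by move=> c x _; rewrite !inE => /eqP->; rewrite mulr0.
  - by move=> x; rewrite inE => /eqP->; apply: fixq0.
  by move=> a x; rewrite inE => ->.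
have [|W [scW cW]] := IHb; first by lia.
by apply: (scattered_step scW cW); lia.
Qed.

End Greedy.

Theorem mod3_min_length (F : finFieldType) (L : fieldExtType F) (r : nat) :
    (1 < r)%N -> \dim {:L} = (2 * r)%N -> (r %% 3 = 1)%N ->
  min_length_saturating L 3 2 (r + 2).
Proof.
move=> r1 dimL rm3; have r0 : (0 < r)%N by lia.
have r3 : ~~ (3 %| r)%N by rewrite /dvdn rm3.
have [M [i [c [exD cM c3 c1]]]] := exists_fixq3_ext L r0.
(* With [r = 3 m + 1], the choice [b = m + 1] gives [3 b = r + 2], the largest value that the greedy
   bound [3 b < r + 3] permits. *)
have [|W [[W0 WD WZ Wfix Wsc] cW]] :=
  exists_fix3_scattered (finNzRing_gt1 F) exD r1 r3 cM (b := (r %/ 3).+1).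
  by lia.
have exDL := finField_exprD (in_alg L).
apply: (@scattered_ext_min_length F L r r0 dimL exDL M i c exD c3 c1 r3 (mem W)) => //.
- move=> a x aq xW; apply: WZ => //; apply: (@fixq_dvd _ _ 1) => //.
  by apply/fixqP; rewrite expn1.
- by move=> a x xW nzx ar axW; have /fixqP := Wsc a x xW nzx ar axW; rewrite expn1.
by rewrite cW leq_exp2l ?finNzRing_gt1 //; lia.
Qed.

(** * Even exponents *)

Section Quadratic.

Variables (M : fieldType) (q t : nat).
Hypothesis q_gt1 : (1 < q)%N.
Hypothesis exprDq : forall x y : M, (x + y) ^+ q = x ^+ q + y ^+ q.
Local Notation fix_ d := (fixq M q d).

Variable w : M.
Hypotheses (w2t : w \in fix_ (2 * t)) (w't : w \notin fix_ t).

Let cj (x : M) := x ^+ (q ^ t).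

Let cjK x : x \in fix_ (2 * t) -> cj (cj x) = x.
Proof. by move=> /fixqP xt; rewrite /cj expqA addnn -mul2n. Qed.

Lemma quad_eq : exists A B, [/\ A \in fix_ t, B \in fix_ t, B != 0
  & w ^+ 2 = A * w + B].
Proof.
exists (w + cj w), (- (w * cj w)); split.
- by apply/fixqP; rewrite expqD // -/(cj w) -/(cj (cj w)) cjK // addrC.
- by apply/fixqP; rewrite expqN // exprMn -/(cj w) -/(cj (cj w)) cjK // mulrC.
- rewrite oppr_eq0 mulf_neq0 ?expf_neq0 //;
  by apply: contraNneq w't => ->; rewrite fixq0.
by ring.
Qed.

Lemma quad_decomp l : l \in fix_ (2 * t) ->
  exists a b, [/\ a \in fix_ t, b \in fix_ t & l = a + b * w].
Proof.
move=> l2t; have nzw : w - cj w != 0.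
  by rewrite subr_eq0 eq_sym; apply: contra w't => /eqP h; apply/fixqP.
pose b := (l - cj l) / (w - cj w).
have bt : b \in fix_ t.
  apply/fixqP; rewrite /b exprMn exprVn !expqB // -!/(cj _) !cjK //.
  by rewrite -(opprB l (cj l)) -(opprB w (cj w)) invrN mulrNN.
exists (l - b * w), b; split=> //; last by rewrite subrK.
apply/fixqP; rewrite expqB // exprMn (fixqP bt) -!/(cj _).
have : b * (w - cj w) = l - cj l by rewrite divfK.
by move=> h; rewrite -[cj l](subKr l) -h; ring.
Qed.

Lemma quad_indep D x y x' y' : w \notin fix_ D ->
  x \in fix_ D -> y \in fix_ D -> x' \in fix_ D -> y' \in fix_ D ->
  x + w * y = x' + w * y' -> x = x' /\ y = y'.
Proof.
move=> wD xD yD xD' yD' E.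
have Ew : w * (y - y') = x' - x.
  by rewrite mulrBr -[w * y](addKr x) E; ring.
have [Ey|ny] := eqVneq y y'; first by move: E; rewrite Ey => /addIr.
case/negP: wD; rewrite (_ : w = (x' - x) / (y - y')); last first.
  by rewrite -Ew mulfK // subr_eq0.
by apply: fixqf; apply: fixqB.
Qed.

End Quadratic.

(** * Norms onto the field [T] of order [q^3] *)

Section NormExists.

Variables (M : finFieldType) (q k : nat).
Hypotheses (q_gt1 : (1 < q)%N) (k_gt0 : (0 < k)%N).
Local Notation nrm := (\sum_(j < k) (q ^ 3) ^ j)%N.

(** The exponent equals [(q^(3k) - 1) / (q^3 - 1)], so the power is the norm to [T]. Its values are
    not all in [F], since [a^(nrm (q - 1)) = 1] has fewer than [q^(3k) - 1] solutions. *)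
Lemma exists_norm_fixq3 : #|fixq M q (3 * k)| = (q ^ (3 * k))%N ->
  exists a, [/\ a \in fixq M q (3 * k), a != 0, a ^+ nrm \in fixq M q 3
    & a ^+ nrm \notin fixq M q 1].
Proof.
move=> cD; have En := predn_exp (q ^ 3) k; rewrite -expnM in En.
have q3_gt1 : (q < q ^ 3)%N by rewrite -{1}(expn1 q) ltn_exp2l.
have n_gt0 : (0 < nrm)%N.
  rewrite lt0n; apply/eqP=> n0; move: En; rewrite n0 muln0.
  have : (1 < q ^ (3 * k))%N by apply: leq_ltn_trans (ltn_expl _ q_gt1); lia.
  by lia.
have [||a aD /andP[nza aN]] := @fixq_exp_neq1 M q (nrm * q.-1) (3 * k) cD.
- by rewrite muln_gt0 n_gt0 /=; lia.
- have : (nrm * q.-1 < nrm * (q ^ 3).-1)%N by rewrite ltn_mul2l n_gt0 /=; lia.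
  rewrite [X in (_ < X)%N]mulnC -En => h; rewrite -ltn_predRL; exact: h.
exists a; split=> //.
  apply/fixqP; rewrite -exprM.
  have -> : (nrm * q ^ 3 = nrm + (q ^ (3 * k)).-1)%N.
    rewrite En; have : (0 < q ^ 3)%N by lia.
    by case: (q ^ 3)%N => // m _; rewrite mulnS mulnC.
  apply: (mulIf nza); rewrite -exprSr -addnS prednK ?expn_gt0 ?(ltnW q_gt1) //.
  by rewrite exprD (fixqP aD).
apply: contra aN => /fixqP; rewrite expn1 => h; rewrite exprM.
apply/eqP/(mulIf (expf_neq0 nrm nza)); rewrite -exprSr prednK ?(ltnW q_gt1) //.
by rewrite h mul1r.
Qed.

End NormExists.

Lemma iter_semilinear (M : fieldType) (q k : nat) (a x : M) :
  iter k (fun y => a * y ^+ (q ^ 3)) x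
  = a ^+ (\sum_(j < k) (q ^ 3) ^ j) * x ^+ (q ^ (3 * k)).
Proof.
elim: k => [|k IHk] /=; first by rewrite big_ord0 mul1r muln0 expr1.
rewrite IHk exprMn big_ord_recl expn0 exprD expr1 -mulrA -exprM expqA.
rewrite big_distrl /=; congr (_ * (_ ^+ _ * _ ^+ (q ^ _))); last by lia.
by apply: eq_bigr => j _; rewrite -expnSr.
Qed.

(** * The case [r = 2 t] with [t] prime to [3] *)

Section EvenNot3.

Variables (M : finFieldType) (q t : nat).
Hypothesis q_gt1 : (1 < q)%N.
Hypothesis exprDq : forall x y : M, (x + y) ^+ q = x ^+ q + y ^+ q.
Hypotheses (t3 : ~~ (3 %| t)%N).
Local Notation fix_ d := (fixq M q d).

Variables (w alpha : M).
Local Notation nrm := (\sum_(j < t) (q ^ 3) ^ j)%N.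
Local Notation theta := (alpha ^+ nrm).
Hypotheses (w2t : w \in fix_ (2 * t)) (w't : w \notin fix_ t).
Hypotheses (alpha_fix : alpha \in fix_ (3 * t)) (alpha0 : alpha != 0).
Hypotheses (theta3 : theta \in fix_ 3) (theta1 : theta \notin fix_ 1).

Local Notation sg x := (x ^+ (q ^ 3)).
Let f x := alpha * sg x.

Let fix_t3 x : x \in fix_ t -> x \in fix_ 3 -> x \in fix_ 1.
Proof.
move=> xt x3; apply/fixqP; rewrite expn1.
by apply: fixq_coprime x3 xt; rewrite prime_coprime.
Qed.

Let fD x y : f (x + y) = f x + f y.
Proof. by rewrite /f expqD // mulrDr. Qed.
Let fZ a x : f (a * x) = sg a * f x.
Proof. by rewrite /f exprMn; ring. Qed.

(** The [t]-th iterate of [f] is multiplication by the norm [theta], which lies in [T] but not in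
    [F], hence has degree [3] over [E]. If [x] and [f x] spanned an [f]-stable [E]-subspace, [theta]
    would act on dimension at most [2] and satisfy a polynomial over [E] of degree at most [2].
    Using the [q^3]-Frobenius makes [f] commute with [T]. *)
Lemma semilinear_irred x e g : x \in fix_ (3 * t) -> e \in fix_ t ->
  g \in fix_ t -> f (f x) = e * x + g * f x -> x = 0.
Proof.
move=> x3t et gt E; apply/eqP; apply: contraT => nzx.
have span k : exists p s, [/\ p \in fix_ t, s \in fix_ t
    & iter k f x = p * x + s * f x].
  elim: k => [|k [p [s [pt st IH]]]].
    by exists 1, 0; rewrite fixq1 fixq0 // mul1r mul0r addr0.
  exists (sg s * e), (sg p + sg s * g); split.
  - by rewrite fixqM ?fixqX.
  - by rewrite fixqD // ?fixqM ?fixqX.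
  by rewrite /= IH fD (fZ p) (fZ s) E; ring.
have [p [s [pt st]]] := span t; rewrite iter_semilinear (fixqP x3t) => Et.
have th't : theta \notin fix_ t by apply: contra theta1 => h; apply: fix_t3.
have [s0|nzs] := eqVneq s 0.
  case/negP: th't; rewrite (_ : theta = p) //; apply: (mulIf nzx).
  by rewrite Et s0 mul0r addr0.
have Efx : f x = (theta - p) / s * x.
  apply: (mulfI nzs); transitivity ((theta - p) * x); last by field.
  by rewrite mulrBl Et; ring.
have Eth : theta * f x = sg p * f x + sg s * (e * x + g * f x).
  by rewrite -E -(fZ p) -(fZ s) -fD -Et (fZ theta) (fixqP theta3).
(* The characteristic polynomial at [theta] of its action on the span of [x] and [f x], obtained by
   eliminating [f x]. *)
have E2 : ((p * (sg p + sg s * g) - s * sg s * e)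
   + (- p - (sg p + sg s * g)) * theta + 1 * theta ^+ 2) * x = 0.
  transitivity (s * (theta * f x - (sg p * f x + sg s * (e * x + g * f x)))).
    by rewrite Efx; field.
  by rewrite Eth subrr mulr0.
move/eqP: E2; rewrite mulf_eq0 (negPf nzx) orbF => /eqP E2.
have th3t : theta \in fix_ (t * 3) by apply: fixq_dvd theta3; apply: dvdn_mull.
have [] := fixq_indep3 q_gt1 exprDq th3t th't _ _ _ E2.
- apply: (fixqB q_gt1 exprDq); apply: fixqM => //; last by rewrite fixqM ?fixqX.
  by apply: (fixqD exprDq); [|apply: fixqM]; rewrite ?fixqX.
- apply: (fixqB q_gt1 exprDq); first exact: fixqN.
  by apply: (fixqD exprDq); [|apply: fixqM]; rewrite ?fixqX.
- exact: fixq1.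
by move=> _ _ /eqP; rewrite oner_eq0.
Qed.

Let w'3t : w \notin fix_ (3 * t).
Proof.
apply: contra w't => w3t; have := fixq_gcd w2t w3t.
by rewrite -muln_gcdl mul1n.
Qed.

Let fix_t3t x : x \in fix_ t -> x \in fix_ (3 * t).
Proof. by apply: fixq_dvd; apply: dvdn_mull. Qed.

Let f3t x : x \in fix_ (3 * t) -> f x \in fix_ (3 * t).
Proof. by move=> xt; rewrite fixqM // fixqX. Qed.

(** Write [l = a + b w] and compare components. If [b] is nonzero, applying [f] to the expression
    for [y] puts [f (f x)] in the [E]-span of [x] and [f x], against irreducibility. If [b = 0], the
    scalar [a] of [E] is fixed by the [q^3]-Frobenius, hence lies in [F] as [3] does not divide
    [t]. *)
Lemma even_not3_scattered x y l : x \in fix_ (3 * t) -> y \in fix_ (3 * t) ->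
  x != 0 -> l \in fix_ (2 * t) -> l * (x + w * f x) = y + w * f y -> l ^+ q = l.
Proof.
move=> x3t y3t nzx l2t E.
have [A [B [At Bt nzB Ew]]] := quad_eq q_gt1 exprDq w2t w't.
have [a [b [at_ bt El]]] := quad_decomp q_gt1 exprDq w2t w't l2t.
have [|||||Ey Efy] := @quad_indep _ _ q_gt1 exprDq w (3 * t)
    (a * x + b * B * f x) (b * x + (a + b * A) * f x) y (f y) w'3t.
- apply: (fixqD exprDq); apply: fixqM => //; try exact: f3t; apply: fix_t3t => //.
  exact: fixqM.
- apply: (fixqD exprDq); apply: fixqM => //; try exact: f3t; apply: fix_t3t => //.
  by apply: (fixqD exprDq) => //; apply: fixqM.
- by [].
- exact: f3t.
- by rewrite -E El; ring: Ew.
have Ef2 : sg b * sg B * f (f x) = b * x + (a + b * A - sg a) * f x.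
  have : f y = sg a * f x + sg b * sg B * f (f x).
    by rewrite -Ey fD (fZ a) (fZ (b * B)) exprMn.
  by rewrite -Efy => h; rewrite -[LHS](addKr (sg a * f x)) -h; ring.
have nzf : f x != 0 by rewrite mulf_neq0 ?expf_neq0.
have [b0|nzb] := eqVneq b 0.
  move: Ef2; rewrite b0 expq0 // !mul0r !add0r addr0 => /esym/eqP.
  rewrite mulf_eq0 (negPf nzf) orbF subr_eq0 => /eqP Ea.
  have /fixqP : a \in fix_ 1 by apply: fix_t3 => //; apply/fixqP.
  by rewrite El b0 mul0r addr0 expn1.
have nzbB : sg b * sg B != 0 by rewrite mulf_neq0 ?expf_neq0.
case/eqP: nzx; apply: (@semilinear_irred x (b / (sg b * sg B))
  ((a + b * A - sg a) / (sg b * sg B))) => //.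
- by rewrite fixqf // fixqM ?fixqX.
- apply: fixqf; last by rewrite fixqM ?fixqX.
  by apply: (fixqB q_gt1 exprDq); rewrite ?fixqX //; apply: (fixqD exprDq); rewrite ?fixqM.
apply: (mulfI nzbB); rewrite Ef2; move: nzbB; rewrite mulf_eq0 negb_or => /andP[? ?].
by field; apply/andP.
Qed.

End EvenNot3.

Theorem even_not3_min_length (F : finFieldType) (L : fieldExtType F) (t : nat) :
    (1 < t)%N -> ~~ (3 %| t)%N -> \dim {:L} = (2 * (2 * t))%N ->
  min_length_saturating L 3 2 (2 * t + 2).
Proof.
move=> t1 t3 dimL; set q := #|F|; have q_gt1 : (1 < q)%N := finNzRing_gt1 F.
have r0 : (0 < 2 * t)%N by lia.
have t0 : (0 < t)%N by lia.
have r3 : ~~ (3 %| 2 * t)%N by rewrite Gauss_dvdr.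
have [M [i [c [exD cM c3 c1]]]] := exists_fixq3_ext L r0.
have [a [a3t nza ath3 ath1]] : exists a, [/\ a \in fixq M q (3 * t), a != 0,
    a ^+ (\sum_(j < t) (q ^ 3) ^ j) \in fixq M q 3
  & a ^+ (\sum_(j < t) (q ^ 3) ^ j) \notin fixq M q 1].
  by apply: exists_norm_fixq3 => //; apply: cM; rewrite dvdn_pmul2l ?dvdn_mull.
have dv2 : (2 * t %| 3 * (2 * t))%N by apply: dvdn_mull.
have [w w2t w't] : exists2 w, w \in fixq M q (2 * t) & w \notin fixq M q t.
  apply/subsetPn; apply/negP=> /subset_leq_card.
  have dvt : (t %| 3 * (2 * t))%N by rewrite mulnA dvdn_mull.
  by rewrite (cM t dvt) (cM _ dv2) leq_exp2l //; lia.
have w'3t : w \notin fixq M q (3 * t).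
  apply: contra w't => w3t; have := fixq_gcd w2t w3t.
  by rewrite -muln_gcdl mul1n.
pose f x := x + w * (a * x ^+ (q ^ 3)).
pose W := [set f x | x in fixq M q (3 * t)].
have WP x : reflect (exists2 y, y \in fixq M q (3 * t) & x = f y) (x \in W).
  exact: imsetP.
have fD x y : f (x + y) = f x + f y by rewrite /f expqD //; ring.
have fix6 d x : (d %| 3 * (2 * t))%N -> x \in fixq M q d -> x \in fixq M q (3 * (2 * t)).
  exact: fixq_dvd.
have dv3 : (3 * t %| 3 * (2 * t))%N by rewrite dvdn_pmul2l ?dvdn_mull.
have fx3 x : x \in fixq M q (3 * t) -> a * x ^+ (q ^ 3) \in fixq M q (3 * t).
  by move=> xt; rewrite fixqM ?fixqX.
apply: (@scattered_ext_min_length F L (2 * t) r0 dimL (finField_exprD (in_alg L))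
          M i c exD c3 c1 r3 (mem W)).
- by apply/WP; exists 0; rewrite ?fixq0 // /f expq0 // !mulr0 addr0.
- move=> _ _ /WP[x xt ->] /WP[y yt ->]; apply/WP; exists (x + y); rewrite ?fD //.
  exact: fixqD.
- move=> b _ bq /WP[x xt ->]; apply/WP; exists (b * x).
    by apply: fixqM => //; apply: fixq_dvd (dvd1n _) _; apply/fixqP; rewrite expn1.
  have b1 : b \in fixq M q 1 by apply/fixqP; rewrite expn1.
  by rewrite /f exprMn (fixqP (fixq_dvd (dvd1n 3) b1)); ring.
- move=> _ /WP[x xt ->]; apply: (fixqD exD); first exact: fix6 xt.
  by apply: fixqM; [apply: fix6 w2t | apply: fix6 (fx3 _ xt)].
- move=> l _ /WP[x xt ->] nzfx lr /WP[y yt E].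
  apply: (even_not3_scattered q_gt1 exD t3 w2t w't a3t nza ath3 ath1 xt yt _ lr E).
  by apply: contraNneq nzfx => ->; rewrite /f expq0 // !mulr0 addr0.
have f_inj : {in fixq M q (3 * t) &, injective f}.
  move=> x y xt yt E.
  by have [] := quad_indep q_gt1 exD w'3t xt (fx3 x xt) yt (fx3 y yt) E.
have -> : #|mem W| = #|W| by apply: eq_card.
rewrite card_in_imset // cM // leq_exp2l //; lia.
Qed.

(** * The case [r = 2 t] with [3] dividing [t] *)

Lemma vandermonde3 (R : fieldType) (t0 t1 t2 y0 y1 y2 : R) :
    t0 != t1 -> t0 != t2 -> t1 != t2 -> y0 + y1 + y2 = 0 ->
    t0 * y0 + t1 * y1 + t2 * y2 = 0 ->
    t0 ^+ 2 * y0 + t1 ^+ 2 * y1 + t2 ^+ 2 * y2 = 0 ->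
  [/\ y0 = 0, y1 = 0 & y2 = 0].
Proof.
move=> n01 n02 n12 e0 e1 e2.
rewrite -subr_eq0 in n01; rewrite -subr_eq0 in n02; rewrite -subr_eq0 in n12.
have aux a b : (t0 ^+ 2 * y0 + t1 ^+ 2 * y1 + t2 ^+ 2 * y2)
  - (a + b) * (t0 * y0 + t1 * y1 + t2 * y2) + a * b * (y0 + y1 + y2) = 0.
  by rewrite e0 e1 e2; ring.
split.
- apply: (mulfI (mulf_neq0 n01 n02)); rewrite mulr0 -(aux t1 t2); ring.
- apply: (mulfI (mulf_neq0 n01 n12)); rewrite mulr0 -[RHS]oppr0 -(aux t0 t2); ring.
- apply: (mulfI (mulf_neq0 n02 n12)); rewrite mulr0 -(aux t0 t1); ring.
Qed.

Lemma exists_orth3 (R : fieldType) (x0 x1 x2 y0 y1 y2 : R) :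
  exists h0 h1 h2, [/\ [|| h0 != 0, h1 != 0 | h2 != 0],
    h0 * x0 + h1 * x1 + h2 * x2 = 0 & h0 * y0 + h1 * y1 + h2 * y2 = 0].
Proof.
pose A : 'M[R]_(3, 2) := \matrix_(i, j)
  (if j == 0 then mk3 x0 x1 x2 i else mk3 y0 y1 y2 i).
have : kermx A != 0.
  rewrite kermx_eq0 /row_free; apply/eqP=> rk3.
  by have := rank_leq_col A; rewrite rk3.
case/rowV0Pn=> h /sub_kermxP hA nzh.
exists (h 0 0), (h 0 1), (h 0 (inord 2)); split.
- apply: contraNT nzh; rewrite !negb_or !negbK => /and3P[/eqP e0 /eqP e1 /eqP e2].
  apply/eqP/rowP=> j; rewrite mxE.
  have : finfun (h 0) = finfun (fun=> 0) by apply: ffun3P; rewrite !ffunE.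
  by move/ffunP/(_ j); rewrite !ffunE.
- move/matrixP/(_ 0 0): hA; rewrite !mxE big_ord3 !mxE /= mk3_0 mk3_1 mk3_2.
  by [].
move/matrixP/(_ 0 1): hA; rewrite !mxE big_ord3 !mxE /= mk3_0 mk3_1 mk3_2.
by [].
Qed.

Section Cyclic3.

Variables (M : fieldType) (q k : nat).
Hypothesis q_gt1 : (1 < q)%N.
Hypothesis exprDq : forall x y : M, (x + y) ^+ q = x ^+ q + y ^+ q.
Local Notation fix_ d := (fixq M q d).
Local Notation t := (3 * k)%N.
Local Notation V := (M * M * M)%type.

Variable d : M.
Local Notation theta := (d ^+ (\sum_(j < k) (q ^ 3) ^ j)).
Hypotheses (dt : d \in fix_ t) (d0 : d != 0).
Hypotheses (theta3 : theta \in fix_ 3) (theta1 : theta \notin fix_ 1).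

(** Here [T] lies in [E], so [E T] is no model of [E^3]. This map is [q]-semilinear, and its [3k]-th
    iterate on [E^3] is diagonal with the three conjugates of [theta] as entries. *)
Definition cyc3 (x : V) : V := (d * x.2 ^+ q, x.1.1 ^+ q, x.1.2 ^+ q).

Let expr0q : (0 : M) ^+ q = 0.
Proof. by have := expq0 M q_gt1 1; rewrite expn1. Qed.
Let expq_eq0 (x : M) : x ^+ q = 0 -> x = 0.
Proof. by move/eqP; rewrite expf_eq0 => /andP[_ /eqP]. Qed.

Let dot (h x : V) : M := h.1.1 * x.1.1 + h.1.2 * x.1.2 + h.2 * x.2.
Let comb (p s : M) (x y : V) : V :=
  (p * x.1.1 + s * y.1.1, p * x.1.2 + s * y.1.2, p * x.2 + s * y.2).

Let cyc3_comb p s x y : cyc3 (comb p s x y) = comb (p ^+ q) (s ^+ q) (cyc3 x) (cyc3 y).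
Proof. by rewrite /cyc3 /comb /= !exprDq !exprMn; congr (_, _, _); ring. Qed.

Let dot_comb h p s x y : dot h (comb p s x y) = p * dot h x + s * dot h y.
Proof. by rewrite /dot /comb /=; ring. Qed.

Let cyc3E (x : V) : cyc3 (cyc3 (cyc3 x)) = (d * x.1.1 ^+ (q ^ 3),
  d ^+ q * x.1.2 ^+ (q ^ 3), d ^+ q ^+ q * x.2 ^+ (q ^ 3)).
Proof.
rewrite /cyc3 /= !exprMn -!(exprM _ q) -!(exprM _ (q * q)).
by rewrite (_ : q * q * q = q ^ 3)%N // !expnS expn0 muln1 mulnA.
Qed.

Let iter_cyc3 (x : V) : x.1.1 \in fix_ t -> x.1.2 \in fix_ t -> x.2 \in fix_ t ->
  iter k (fun y => cyc3 (cyc3 (cyc3 y))) x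
  = (theta * x.1.1, theta ^+ q * x.1.2, theta ^+ q ^+ q * x.2).
Proof.
move=> x0 x1 x2; have -> : iter k (fun y => cyc3 (cyc3 (cyc3 y))) x
  = (iter k (fun y => d * y ^+ (q ^ 3)) x.1.1,
     iter k (fun y => d ^+ q * y ^+ (q ^ 3)) x.1.2,
     iter k (fun y => d ^+ q ^+ q * y ^+ (q ^ 3)) x.2).
  elim: k => [|j IHj] /=; first by case: x {x0 x1 x2} => [[? ?] ?].
  by rewrite IHj cyc3E.
rewrite !iter_semilinear (fixqP x0) (fixqP x1) (fixqP x2).
by rewrite -!(exprAC _ q).
Qed.

Let theta_neq : [/\ theta != theta ^+ q, theta != theta ^+ q ^+ q
  & theta ^+ q != theta ^+ q ^+ q].
Proof.
have n01 : theta != theta ^+ q.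
  by apply: contra theta1 => /eqP h; apply/fixqP; rewrite expn1 -h.
split=> //; last first.
  apply: contra n01 => /eqP h; have := expq_inj q_gt1 exprDq (d := 1).
  by rewrite expn1 => H; apply/eqP/H.
apply: contra n01 => /eqP h; apply/eqP.
rewrite -{1}(fixqP theta3) 3!expnS expn0 muln1 !exprM.
by rewrite -h.
Qed.

(** Let [h] be a nonzero form vanishing on the stable span of [x] and [cyc3 x]. It also vanishes on
    the images under the diagonal map with distinct entries [theta], [theta^q], [theta^(q^2)], and
    Vandermonde separates the coordinates: each product [h_i y_i] is zero for [y] in the span. *)
Lemma cyc3_irred (x : V) e g :
    x.1.1 \in fix_ t -> x.1.2 \in fix_ t -> x.2 \in fix_ t ->
    cyc3 (cyc3 x) = comb e g x (cyc3 x) -> x = (0, 0, 0).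
Proof.
move=> x0t x1t x2t E.
have [h0 [h1 [h2 [nzh hx hfx]]]] := exists_orth3 x.1.1 x.1.2 x.2
  (cyc3 x).1.1 (cyc3 x).1.2 (cyc3 x).2.
pose h : V := (h0, h1, h2).
have spanS p s : exists p' s', cyc3 (comb p s x (cyc3 x)) = comb p' s' x (cyc3 x).
  exists (s ^+ q * e), (p ^+ q + s ^+ q * g).
  by rewrite cyc3_comb E /comb /=; congr (_, _, _); ring.
have dot0 p s : dot h (comb p s x (cyc3 x)) = 0.
  by rewrite dot_comb [dot h x]hx [dot h (cyc3 x)]hfx !mulr0 addr0.
pose g3 y := cyc3 (cyc3 (cyc3 y)).
have span_g3 j p s : exists p' s', iter j g3 (comb p s x (cyc3 x)) = comb p' s' x (cyc3 x).
  elim: j => [|j [p1 [s1 IHj]]]; first by exists p, s.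
  have [p2 [s2 e2]] := spanS p1 s1; have [p3 [s3 e3]] := spanS p2 s2.
  have [p4 [s4 e4]] := spanS p3 s3.
  by exists p4, s4; rewrite /= IHj /g3 e2 e3 e4.
have key (y : V) p s : y = comb p s x (cyc3 x) ->
    y.1.1 \in fix_ t -> y.1.2 \in fix_ t -> y.2 \in fix_ t ->
  [/\ h0 * y.1.1 = 0, h1 * y.1.2 = 0 & h2 * y.2 = 0].
  move=> Ey y0 y1 y2.
  have th_t : theta \in fix_ t by rewrite fixqX.
  have e0 : dot h y = 0 by rewrite Ey dot0.
  have e1 := iter_cyc3 y0 y1 y2; rewrite -/g3 in e1.
  have [p1 [s1 E1]] := span_g3 k p s.
  have [p2 [s2 E2]] := span_g3 k p1 s1.
  rewrite -Ey e1 in E1.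
  have e2 := iter_cyc3 (x := (theta * y.1.1, theta ^+ q * y.1.2, theta ^+ q ^+ q * y.2)).
  rewrite -E1 /= e2 /= in E2; try by rewrite fixqM ?fixqX.
  have [n01 n02 n12] := theta_neq.
  apply: (vandermonde3 n01 n02 n12) => //.
    by rewrite -(dot0 p1 s1) -E1 /dot /=; ring.
  by rewrite -(dot0 p2 s2) -E2 /dot /=; ring.
have fixc (y : V) : y.1.1 \in fix_ t -> y.1.2 \in fix_ t -> y.2 \in fix_ t ->
  [/\ (cyc3 y).1.1 \in fix_ t, (cyc3 y).1.2 \in fix_ t & (cyc3 y).2 \in fix_ t].
  by move=> ? ? ?; rewrite /cyc3 /= fixqM ?fixqX.
have comb10 : x = comb 1 0 x (cyc3 x).
  by case: (x) => [[? ?] ?]; rewrite /comb /= !mul1r !mul0r !addr0.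
have comb01 : cyc3 x = comb 0 1 x (cyc3 x).
  by rewrite /comb /= !mul1r !mul0r !add0r.
have [c0 c1 c2] := fixc x x0t x1t x2t; have [f0 f1 f2] := fixc _ c0 c1 c2.
have [a0 a1 a2] := key _ _ _ comb10 x0t x1t x2t.
have [b0 b1 b2] := key _ _ _ comb01 c0 c1 c2.
have [g0 g1 g2] := key _ _ _ E f0 f1 f2.
(* Where [h_i] is nonzero, coordinate [i] of [x], [cyc3 x] and [cyc3 (cyc3 x)] vanishes. Up to
   Frobenius and factors [d] these are the three coordinates of [x]. *)
have can (a b : M) : a != 0 -> a * b = 0 -> b = 0.
  by move=> nza /eqP; rewrite mulf_eq0 (negPf nza) => /eqP.
move: a0 a1 a2 b0 b1 b2 g0 g1 g2; case: (x) => [[y0 y1] y2]; rewrite /cyc3 /=.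
case/or3P: nzh => nz a0 a1 a2 b0 b1 b2 g0 g1 g2.
- have -> := can _ _ nz a0.
  have -> := expq_eq0 (can _ _ d0 (can _ _ nz b0)).
  by have -> := expq_eq0 (expq_eq0 (can _ _ d0 (can _ _ nz g0))).
- have -> := can _ _ nz a1; have -> := expq_eq0 (can _ _ nz b1).
  by have -> := expq_eq0 (can _ _ d0 (expq_eq0 (can _ _ nz g1))).
have -> := can _ _ nz a2; have -> := expq_eq0 (can _ _ nz b2).
by have -> := expq_eq0 (expq_eq0 (can _ _ nz g2)).
Qed.

End Cyclic3.

Section Even3.

Variables (F : finFieldType) (L : fieldExtType F) (k : nat).
Local Notation q := #|F|.
Local Notation t := (3 * k)%N.
Local Notation V := {ffun 'I_3 -> L}.
Local Notation Lf := (finvect_type L).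
Local Notation fix_ d := (fixq L q d).
Hypotheses (k_gt0 : (0 < k)%N) (dimL : \dim {:L} = (2 * (2 * t))%N).

Let exprDq : forall x y : L, (x + y) ^+ q = x ^+ q + y ^+ q.
Proof. exact: (finField_exprD (in_alg L)). Qed.
Let q_gt1 : (1 < q)%N := finNzRing_gt1 F.
Let expr0q : (0 : L) ^+ q = 0.
Proof. by have := expq0 L q_gt1 1; rewrite expn1. Qed.

Variables (w d : L).
Local Notation theta := (d ^+ (\sum_(j < k) (q ^ 3) ^ j)).
Hypotheses (w2t : w \in fix_ (2 * t)) (w't : w \notin fix_ t).
Hypotheses (dt : d \in fix_ t) (d0 : d != 0).
Hypotheses (theta3 : theta \in fix_ 3) (theta1 : theta \notin fix_ 1).

Local Notation f := (cyc3 q d).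

Lemma even3_scattered (x y : L * L * L) l :
    x.1.1 \in fix_ t -> x.1.2 \in fix_ t -> x.2 \in fix_ t ->
    y.1.1 \in fix_ t -> y.1.2 \in fix_ t -> y.2 \in fix_ t ->
    x <> (0, 0, 0) -> l \in fix_ (2 * t) ->
    l * (x.1.1 + w * (f x).1.1) = y.1.1 + w * (f y).1.1 ->
    l * (x.1.2 + w * (f x).1.2) = y.1.2 + w * (f y).1.2 ->
    l * (x.2 + w * (f x).2) = y.2 + w * (f y).2 ->
  l ^+ q = l.
Proof.
move=> x0 x1 x2 y0 y1 y2 nzx l2t E0 E1 E2.
have [A [B [At Bt nzB Ew]]] := quad_eq q_gt1 exprDq w2t w't.
have [a [b [at_ bt El]]] := quad_decomp q_gt1 exprDq w2t w't l2t.
have fixc (z : L * L * L) : z.1.1 \in fix_ t -> z.1.2 \in fix_ t -> z.2 \in fix_ t ->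
  [/\ (f z).1.1 \in fix_ t, (f z).1.2 \in fix_ t & (f z).2 \in fix_ t].
  by move=> ? ? ?; rewrite /cyc3 /= fixqM ?fixqX.
have sep u v u' v' : u \in fix_ t -> v \in fix_ t -> u' \in fix_ t -> v' \in fix_ t ->
    l * (u + w * v) = u' + w * v' ->
    a * u + b * B * v = u' /\ b * u + (a + b * A) * v = v'.
  move=> ut vt ut' vt' E; apply: (quad_indep q_gt1 exprDq w't) => //.
  - by apply: (fixqD exprDq); rewrite !fixqM.
  - by apply: (fixqD exprDq); rewrite fixqM // fixqD // fixqM.
  by rewrite -E El; ring: Ew.
have [c0 c1 c2] := fixc x x0 x1 x2; have [z0 z1 z2] := fixc y y0 y1 y2.
have [e0 g0] := sep _ _ _ _ x0 c0 y0 z0 E0.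
have [e1 g1] := sep _ _ _ _ x1 c1 y1 z1 E1.
have [e2 g2] := sep _ _ _ _ x2 c2 y2 z2 E2.
have h0 : b * x.1.1 + (a + b * A) * (f x).1.1
    = a ^+ q * (f x).1.1 + (b * B) ^+ q * (f (f x)).1.1.
  rewrite g0 -[(f y).1.1]/(d * y.2 ^+ q) -[(f (f x)).1.1]/(d * (f x).2 ^+ q).
  by rewrite -[(f x).1.1]/(d * x.2 ^+ q) -e2 exprDq !exprMn; ring.
have h1 : b * x.1.2 + (a + b * A) * (f x).1.2
    = a ^+ q * (f x).1.2 + (b * B) ^+ q * (f (f x)).1.2.
  by rewrite g1 -[(f y).1.2]/(y.1.1 ^+ q) -e0 exprDq (exprMn _ a) (exprMn _ (b * B)).
have h2 : b * x.2 + (a + b * A) * (f x).2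
    = a ^+ q * (f x).2 + (b * B) ^+ q * (f (f x)).2.
  by rewrite g2 -[(f y).2]/(y.1.2 ^+ q) -e1 exprDq (exprMn _ a) (exprMn _ (b * B)).
have [b0|nzb] := eqVneq b 0.
  rewrite El b0 mul0r addr0; apply/eqP; apply: contra_notT nzx => na.
  have na' : a - a ^+ q != 0 by rewrite subr_eq0 eq_sym.
  move: h0 h1 h2; rewrite b0 !mul0r expr0q !mul0r !add0r !addr0 => h0 h1 h2.
  have can0 z : a * z = a ^+ q * z -> z = 0.
    by move=> h; apply: (mulfI na'); rewrite mulr0 mulrBl -h subrr.
  have eq0 (z : L) : z ^+ q = 0 -> z = 0 by move/eqP; rewrite expf_eq0 => /andP[_ /eqP].
  move: (can0 _ h0) (can0 _ h1) (can0 _ h2); case: (x) => [[u0 u1] u2].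
  rewrite /cyc3 /= => /eqP; rewrite mulf_eq0 (negPf d0) /= => /eqP/eq0-> /eq0-> /eq0->.
  by [].
have nzbB : (b * B) ^+ q != 0 by rewrite expf_neq0 ?mulf_neq0.
case: nzx; apply: (cyc3_irred q_gt1 exprDq dt d0 theta3 theta1
  (e := b / (b * B) ^+ q) (g := (a + b * A - a ^+ q) / (b * B) ^+ q)) => //.
have sol u v z : b * u + (a + b * A) * v = a ^+ q * v + (b * B) ^+ q * z ->
    z = b / (b * B) ^+ q * u + (a + b * A - a ^+ q) / (b * B) ^+ q * v.
  move: ((b * B) ^+ q) nzbB => c nzc h; apply: (mulfI nzc).
  rewrite -[LHS](addKr (a ^+ q * v)) -h; by field.
by rewrite -(sol _ _ _ h0) -(sol _ _ _ h1) -(sol _ _ _ h2).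
Qed.

Lemma even3_min_length_of : min_length_saturating L 3 2 (2 * t + 2).
Proof.
have r0 : (0 < 2 * t)%N by lia.
have t1 : (2 < t)%N by lia.
pose A : {pred Lf * Lf * Lf} := [predX [predX fixq (FinFieldExtType L) q t
  & fixq (FinFieldExtType L) q t] & fixq (FinFieldExtType L) q t].
have AE (x : L * L * L) : (x \in A)
    = [&& x.1.1 \in fix_ t, x.1.2 \in fix_ t & x.2 \in fix_ t] by rewrite andbA.
pose g (x : L * L * L) : V := mk3 (x.1.1 + w * (f x).1.1)
  (x.1.2 + w * (f x).1.2) (x.2 + w * (f x).2).
pose S : {pred {ffun 'I_3 -> Lf}} := mem [set (g x : {ffun 'I_3 -> Lf}) | x : Lf * Lf * Lf in A].
have SP (u : V) : reflect (exists x, [/\ x.1.1 \in fix_ t, x.1.2 \in fix_ t,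
    x.2 \in fix_ t & u = g x]) (u \in S).
  apply: (iffP imsetP) => [[x]|[x [x0 x1 x2 ->]]].
    by rewrite AE => /and3P[x0 x1 x2] ->; exists x.
  by exists x; rewrite // AE x0 x1 x2.
have fixc (z : L * L * L) : z.1.1 \in fix_ t -> z.1.2 \in fix_ t -> z.2 \in fix_ t ->
  [/\ (f z).1.1 \in fix_ t, (f z).1.2 \in fix_ t & (f z).2 \in fix_ t].
  by move=> ? ? ?; rewrite /cyc3 /= fixqM ?fixqX.
have t2t x : x \in fix_ t -> x \in fix_ (2 * t) by apply: fixq_dvd; apply: dvdn_mull.
have g0 : g (0, 0, 0) = 0.
  by apply: ffun3P; rewrite [RHS]ffunE ?mk3_0 ?mk3_1 ?mk3_2 /cyc3 /= expr0q !mulr0 addr0.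
apply: (scattered_set_min_length r0 dimL exprDq (S := S)).
- by apply/SP; exists (0, 0, 0); rewrite /= fixq0.
- move=> _ _ /SP[x [x0 x1 x2 ->]] /SP[y [y0 y1 y2 ->]]; apply/SP.
  exists (x.1.1 + y.1.1, x.1.2 + y.1.2, x.2 + y.2); rewrite /= !fixqD //; split=> //.
  by apply: ffun3P; rewrite ffunE ?mk3_0 ?mk3_1 ?mk3_2 /cyc3 /= exprDq; ring.
- move=> c _ cq /SP[x [x0 x1 x2 ->]]; apply/SP.
  have ct : c \in fix_ t.
    by apply: fixq_dvd (dvd1n _) _; apply/fixqP; rewrite expn1.
  exists (c * x.1.1, c * x.1.2, c * x.2); rewrite /= !fixqM //; split=> //.
  by apply: ffun3P; rewrite ffunE ?mk3_0 ?mk3_1 ?mk3_2 /cyc3 /= exprMn cq; ring.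
- move=> _ j /SP[x [x0 x1 x2 ->]]; rewrite ffunE.
  have [c0 c1 c2] := fixc x x0 x1 x2.
  have := ltn_ord j; case: (nat_of_ord j) => [|[|[|//]]] _ /=;
    by apply: (fixqD exprDq); [|apply: fixqM]; try exact: t2t.
- move=> u l /SP[x [x0 x1 x2 Eu]] nzu lr /SP[y [y0 y1 y2 Ey]].
  have ly j : l * u j = g y j by rewrite -Ey ffunE.
  apply: (even3_scattered x0 x1 x2 y0 y1 y2 _ lr).
  + by move=> x_0; case/eqP: nzu; rewrite Eu x_0.
  + by have := ly 0; rewrite Eu !mk3_0.
  + by have := ly 1; rewrite Eu !mk3_1.
  by have := ly (inord 2); rewrite Eu !mk3_2.
have g_inj : {in A &, injective (g : Lf * Lf * Lf -> {ffun 'I_3 -> Lf})}.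
  move=> x y; rewrite !AE => /and3P[x0 x1 x2] /and3P[y0 y1 y2] E.
  have [c0 c1 c2] := fixc x x0 x1 x2; have [z0 z1 z2] := fixc y y0 y1 y2.
  have := congr1 (fun u : V => u 0) E; have := congr1 (fun u : V => u 1) E.
  have := congr1 (fun u : V => u (inord 2)) E; rewrite !mk3_0 !mk3_1 !mk3_2.
  case/(quad_indep q_gt1 exprDq w't x2 c2 y2 z2) => e2 _.
  case/(quad_indep q_gt1 exprDq w't x1 c1 y1 z1) => e1 _.
  case/(quad_indep q_gt1 exprDq w't x0 c0 y0 z0) => e0 _.
  by case: (x) (y) e0 e1 e2 => [[? ?] ?] [[? ?] ?] /= -> -> ->.
rewrite (_ : #|S| = #|[set (g x : {ffun 'I_3 -> Lf}) | x : Lf * Lf * Lf in A]|); last exact: eq_card.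
have dv : (t %| 2 * (2 * t))%N by rewrite mulnA dvdn_mull.
(* The space has dimension [3 t], at least [2 t + 2] because [t >= 3]. *)
rewrite card_in_imset // !cardX !(card_fixqL r0 dimL dv) -!expnD leq_exp2l //.
lia.
Qed.

End Even3.

Theorem even3_min_length (F : finFieldType) (L : fieldExtType F) (t : nat) :
    (0 < t)%N -> (3 %| t)%N -> \dim {:L} = (2 * (2 * t))%N ->
  min_length_saturating L 3 2 (2 * t + 2).
Proof.
move=> t0 /dvdnP[k Et]; move: t0; rewrite {t}Et mulnC => t0 dimL.
have k0 : (0 < k)%N by lia.
have r0 : (0 < 2 * (3 * k))%N by lia.
have dv : (3 * k %| 2 * (2 * (3 * k)))%N by rewrite mulnA dvdn_mull.
have dv2 : (2 * (3 * k) %| 2 * (2 * (3 * k)))%N by apply: dvdn_mull.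
have cd := card_fixqL r0 dimL.
have q_gt1 := finNzRing_gt1 F.
have [d [dt d0 th3 th1]] := exists_norm_fixq3 q_gt1 k0 (cd _ dv).
have [w w2t w't] : exists2 w, w \in fixq (FinFieldExtType L) #|F| (2 * (3 * k))
    & w \notin fixq (FinFieldExtType L) #|F| (3 * k).
  apply/subsetPn; apply/negP=> /subset_leq_card.
  by rewrite (cd _ dv) (cd _ dv2) leq_exp2l //; lia.
exact: (even3_min_length_of k0 dimL w2t w't dt d0 th3 th1).
Qed.

(** * Exponent 5 *)

(* A list of naturals of length [n] stands for a polynomial of degree less than [n]
   over [Z/p], reduced modulo [X^n - c]. *)
Section ModularPoly.

Variables (p : nat) (c : seq nat).

Definition mp_add (l1 l2 : seq nat) := [seq (a.1 + a.2) %% p | a <- zip l1 l2]%N.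
Definition mp_scale (k : nat) (l : seq nat) := [seq (k * a) %% p | a <- l]%N.
Definition mp_mulX (l : seq nat) :=
  mp_add (0%N :: take (size c).-1 l) (mp_scale (last 0%N l) c).
Definition mp_mul (l1 l2 : seq nat) :=
  foldr (fun k l => mp_add (mp_scale k l2) (mp_mulX l)) (nseq (size c) 0%N) l1.
Definition mp_exp (l : seq nat) (k : nat) := iter k.-1 (mp_mul l) l.
Definition mp_X := 0%N :: 1%N :: nseq (size c - 2) 0%N.
Definition mp_horner (k : nat) := foldr (fun a y => a + k * y)%N 0%N c.

(** Together with [mp_rootfree], a test by evaluation: the roots of [X^n - c] lie in the field of
    order [p^m], and none lies in the prime field. *)
Definition mp_fixed (m : nat) := iter m (mp_exp^~ p) mp_X == mp_X.
Definition mp_rootfree :=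
  all (fun k => (k ^ size c) %% p != mp_horner k %% p)%N (iota 0 p).

Variables (M : fieldType) (x : M).
Hypotheses (p_pr : prime p) (p0 : p%:R = 0 :> M).

Definition mp_eval (l : seq nat) : M := foldr (fun a y => a%:R + x * y) 0 l.

Hypotheses (size_c : (1 < size c)%N) (Dx : x ^+ size c = mp_eval c).

Let natr_modp a : (a %% p)%:R = a%:R :> M.
Proof. by rewrite [in RHS](divn_eq a p) natrD natrM p0 mulr0 add0r. Qed.

Let size_add l1 l2 : size l1 = size c -> size l2 = size c ->
  size (mp_add l1 l2) = size c.
Proof. by move=> e1 e2; rewrite size_map size_zip e1 e2 minnn. Qed.

Let size_mulX l : size l = size c -> size (mp_mulX l) = size c.
Proof.
move=> e; rewrite size_add /= ?size_map //.
by rewrite size_takel ?prednK ?e ?leq_pred // ltnW.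
Qed.

Let eval_add l1 l2 : size l1 = size l2 ->
  mp_eval (mp_add l1 l2) = mp_eval l1 + mp_eval l2.
Proof.
elim: l1 l2 => [|a l1 IH] [|b l2] //= => [_|[e]]; first by rewrite addr0.
by rewrite -/(mp_add l1 l2) IH // natr_modp natrD; ring.
Qed.

Let eval_scale k l : mp_eval (mp_scale k l) = k%:R * mp_eval l.
Proof.
elim: l => [|a l IH] /=; first by rewrite mulr0.
by rewrite -/(mp_scale k l) IH natr_modp natrM; ring.
Qed.

Let eval_rcons l a : mp_eval (rcons l a) = mp_eval l + a%:R * x ^+ size l.
Proof. by elim: l => [|b l IH] /=; rewrite ?IH ?exprS ?expr0; ring. Qed.

Let eval_mulX l : size l = size c -> mp_eval (mp_mulX l) = x * mp_eval l.
Proof.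
case/lastP: l => [|l a]; first by move=> e; move: size_c; rewrite -e.
rewrite size_rcons => e; rewrite /mp_mulX -e /= last_rcons -cats1 take_size_cat //.
rewrite eval_add; last by rewrite /= size_map.
by rewrite eval_scale cats1 eval_rcons -Dx -e /= exprS; ring.
Qed.

Let eval_mul l1 l2 : size l2 = size c ->
  size (mp_mul l1 l2) = size c /\ mp_eval (mp_mul l1 l2) = mp_eval l1 * mp_eval l2.
Proof.
move=> e2; elim: l1 => [|a l1 [IHs IHe]] /=.
  rewrite size_nseq mul0r; split=> //.
  by elim: (size c) => //= n ->; rewrite mulr0 addr0.
split; first by apply: size_add; [rewrite size_map | apply: size_mulX].
have E : size (mp_scale a l2) = size (mp_mulX (mp_mul l1 l2)).
  by rewrite size_map size_mulX.
by rewrite (eval_add E) eval_scale eval_mulX // IHe; ring.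
Qed.

Let eval_exp l k : (0 < k)%N -> size l = size c ->
  size (mp_exp l k) = size c /\ mp_eval (mp_exp l k) = mp_eval l ^+ k.
Proof.
case: k => // k _ e; rewrite /mp_exp /=; elim: k => [|k [IHs IHe]] //=.
by have [-> ->] := eval_mul l IHs; rewrite IHe -exprS.
Qed.

Let size_X : size mp_X = size c.
Proof. by rewrite /= size_nseq; lia. Qed.

Let eval_X : mp_eval mp_X = x.
Proof.
rewrite /=; have -> : mp_eval (nseq (size c - 2) 0%N) = 0.
  by elim: (size c - 2)%N => //= n ->; rewrite mulr0 addr0.
by ring.
Qed.

Lemma mp_fixedP m : mp_fixed m -> x ^+ (p ^ m) = x.
Proof.
move/eqP => E; rewrite -[RHS]eval_X -E {E}.
suff [_ ->] : size (iter m (mp_exp^~ p) mp_X) = size c /\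
  mp_eval (iter m (mp_exp^~ p) mp_X) = x ^+ (p ^ m) by [].
elim: m => [|m [IHs IHe]]; first by split; [exact: size_X | rewrite eval_X expr1].
by rewrite iterS; have [-> ->] := eval_exp (prime_gt0 p_pr) IHs; rewrite IHe expnSr exprM.
Qed.

Lemma natr_eqp a b : a%:R = b%:R :> M -> a = b %[mod p].
Proof.
wlog le_ba : a b / (b <= a)%N => [H|].
  by case/orP: (leq_total a b) => h E; [apply/esym/H|apply: H].
move=> E; apply/eqP; rewrite eqn_mod_dvd //.
have pM : p \in [pchar M] by rewrite inE p_pr p0 eqxx.
by rewrite (dvdn_pcharf pM) natrB // E subrr.
Qed.

Lemma fixp_natr (y : M) : y ^+ p = y -> exists2 k, (k < p)%N & y = k%:R.
Proof.
move=> yp; pose s := [seq k%:R : M | k <- iota 0 p].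
suff : y \in s by case/mapP=> k; rewrite mem_iota => kp ->; exists k.
have ps : size ('X^p - 'X : {poly M}) = p.+1.
  by rewrite size_polyDl size_polyXn // size_polyN size_polyX ltnS prime_gt1.
have us : uniq s.
  rewrite map_inj_in_uniq ?iota_uniq // => a b; rewrite !mem_iota /= add0n => ap bp.
  by move/natr_eqp; rewrite !modn_small.
apply/negPn/negP=> y's.
have := @max_poly_roots M ('X^p - 'X) (y :: s).
rewrite ps /= size_map size_iota ltnn y's us => H; suff : false by []; apply: H => //.
  by rewrite -size_poly_eq0 ps.
rewrite rootE !hornerE yp subrr eqxx /=; apply/allP=> _ /mapP[k _ ->].
have pM : p \in [pchar M] by rewrite inE p_pr p0 eqxx.
by rewrite rootE !hornerE -(pFrobenius_autE pM) pFrobenius_aut_nat subrr.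
Qed.

Lemma mp_rootfreeP : mp_rootfree -> x ^+ p != x.
Proof.
move/allP=> H; apply/eqP=> /fixp_natr[k kp xk].
have := H k; rewrite mem_iota kp => /(_ isT)/eqP; apply; apply: natr_eqp.
rewrite natrX -xk Dx /mp_horner; elim: (c) => //= a l ->.
by rewrite natrD natrM -xk.
Qed.

End ModularPoly.

(** * Scatteredness of [T + T g + F z] for [r = 5] *)

Section Degree5.

Variables (M : finFieldType) (q : nat).
Hypothesis q_gt1 : (1 < q)%N.
Hypothesis exprDq : forall x y : M, (x + y) ^+ q = x ^+ q + y ^+ q.
Hypothesis card_fix : forall d, (d %| 15)%N -> #|fixq M q d| = (q ^ d)%N.
Local Notation fix_ d := (fixq M q d).

Variables (th tau A B C : M).
Hypotheses (th5 : th \in fix_ 5) (th1 : th \notin fix_ 1).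
Hypotheses (tau3 : tau \in fix_ 3) (tau1 : tau \notin fix_ 1).
Hypotheses (A1 : A \in fix_ 1) (B1 : B \in fix_ 1) (C1 : C \in fix_ 1).
Hypothesis Dth : th ^+ 5 = A + B * th + C * th ^+ 2.

Let fix13 x : x \in fix_ 1 -> x \in fix_ 3.
Proof. exact: fixq_dvd. Qed.
Let fix15 x : x \in fix_ 1 -> x \in fix_ 5.
Proof. exact: fixq_dvd. Qed.
Let fix3_15 x : x \in fix_ 3 -> x \in fix_ 15.
Proof. exact: fixq_dvd. Qed.
Let fix5_15 x : x \in fix_ 5 -> x \in fix_ 15.
Proof. exact: fixq_dvd. Qed.

Let th'3 : th \notin fix_ 3.
Proof.
apply: contra th1 => th3; apply/fixqP; rewrite expn1.
exact: fixq_coprime th3 th5.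
Qed.

Let indep3 := @fixq_indep5 M q q_gt1 exprDq 3 th.

(* In the basis [1, th, .., th^4], up to a shift of [mu] by [F],
   [det (1, g, mu, mu g, z)] for [g = tau th^2 + th^3], [z = tau th + th^4]. *)
Definition det5 (m1 m2 m3 m4 : M) : M :=
  (m2 - tau * m3)
    * (B * m2 + A * m3 + tau * (B * m3 + (A - C) * m4 - m1) - tau ^+ 2 * m2)
  - (m1 - tau * m4) * (C * m2 + B * m3 + A * m4 - tau ^+ 2 * (m1 + C * m4)).

Hypothesis det5_neq0 : forall m1 m2 m3 m4, m1 \in fix_ 1 -> m2 \in fix_ 1 ->
  m3 \in fix_ 1 -> m4 \in fix_ 1 -> det5 m1 m2 m3 m4 = 0 ->
  [/\ m1 = 0, m2 = 0, m3 = 0 & m4 = 0].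

Let g := tau * th ^+ 2 + th ^+ 3.
Let z := tau * th + th ^+ 4.

Let ev5 (m : M * M * M * M * M) :=
  m.1.1.1.1 + m.1.1.1.2 * th + m.1.1.2 * th ^+ 2 + m.1.2 * th ^+ 3 + m.2 * th ^+ 4.

Lemma fix5_decomp mu : mu \in fix_ 5 -> exists m0 m1 m2 m3 m4,
  [/\ m0 \in fix_ 1, m1 \in fix_ 1, m2 \in fix_ 1 & m3 \in fix_ 1] /\
  m4 \in fix_ 1 /\ mu = m0 + m1 * th + m2 * th ^+ 2 + m3 * th ^+ 3 + m4 * th ^+ 4.
Proof.
move=> mu5; pose F1 := [set x in fix_ 1].
have FE x : (x \in F1) = (x \in fix_ 1) by rewrite inE.
pose D := setX (setX (setX (setX F1 F1) F1) F1) F1.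
have DE m : (m \in D) = [&& m.1.1.1.1 \in fix_ 1, m.1.1.1.2 \in fix_ 1,
    m.1.1.2 \in fix_ 1, m.1.2 \in fix_ 1 & m.2 \in fix_ 1].
  by case: m => [[[[? ?] ?] ?] ?]; rewrite !in_setX !FE -!andbA.
have ev_inj : {in D &, injective ev5}.
  move=> m n; rewrite !DE => /and5P[a0 a1 a2 a3 a4] /and5P[b0 b1 b2 b3 b4] E.
  have [|||||||| e0 e1 e2 e3 e4] := @fixq_indep5 M q q_gt1 exprDq 1 th
    (m.1.1.1.1 - n.1.1.1.1) (m.1.1.1.2 - n.1.1.1.2) (m.1.1.2 - n.1.1.2)
    (m.1.2 - n.1.2) (m.2 - n.2); rewrite ?(fixqB q_gt1 exprDq) //.
    by transitivity (ev5 m - ev5 n); [rewrite /ev5; ring | rewrite E subrr].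
  move: e0 e1 e2 e3 e4; case: (m) (n) => [[[[? ?] ?] ?] ?] [[[[? ?] ?] ?] ?] /=.
  by do 5!move=> /subr0_eq->.
have : mu \in [set ev5 m | m in D].
  have -> : [set ev5 m | m in D] = [set x in fix_ 5].
    apply/eqP; rewrite eqEcard card_in_imset // !cardsX !cardsE !card_fix //.
    rewrite expn1 (_ : (q * q * q * q * q = q ^ 5)%N) ?leqnn ?andbT; last first.
      by rewrite !expnS expn0 muln1 !mulnA.
    apply/subsetP=> x /imsetP[m]; rewrite DE => /and5P[a0 a1 a2 a3 a4] ->.
    rewrite inE /ev5.
    by do ?[exact: fix15 | by [] | by rewrite fixqX | apply: (fixqD exprDq) | apply: fixqM].
  by rewrite inE.
case/imsetP=> m; rewrite DE => /and5P[a0 a1 a2 a3 a4] ->.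
by exists m.1.1.1.1, m.1.1.1.2, m.1.1.2, m.1.2, m.2.
Qed.

(** [1], [th], .., [th^4] stay independent over [T], so coefficients can be compared. Eliminating
    [s], [t] and [a] leaves two homogeneous equations in [s'] and [t'] whose determinant is [det5],
    nonzero because [mu] is not in [F]. *)
Lemma degree5_indep mu s' t' s t a : mu \in fix_ 5 -> mu \notin fix_ 1 ->
    s' \in fix_ 3 -> t' \in fix_ 3 -> s \in fix_ 3 -> t \in fix_ 3 -> a \in fix_ 1 ->
    mu * (s' + t' * g) = s + t * g + a * z -> s' = 0 /\ t' = 0.
Proof.
move=> mu5 mu1 s'3 t'3 s3 t3 a1 E.
have [m0 [m1 [m2 [m3 [m4 [[h0 h1 h2 h3] [h4 Dmu]]]]]]] := fix5_decomp mu5.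
have th15 : th \in fix_ (3 * 5) by apply: fix5_15.
have [] := @indep3
  (m0 * s' + t' * (A * (m2 + tau * m3)) - s)
  (m1 * s' + t' * (tau * (B * m3 + A * m4) + B * m2 + A * m3) - a * tau)
  (m2 * s' + t' * (tau * (C * m3 + B * m4) + C * m2 + B * m3 + A * m4 + m0 * tau) - t * tau)
  (m3 * s' + t' * (tau * (m1 + C * m4) + C * m3 + B * m4 + m0) - t)
  (m4 * s' + t' * (tau * m2 + m1 + C * m4) - a) th15 th'3.
1-5: by do ?[exact: fix13 | by [] | apply: (fixqB q_gt1 exprDq) | apply: (fixqD exprDq)
            | apply: fixqM].
  transitivity (mu * (s' + t' * g) - (s + t * g + a * z)
    - (th ^+ 5 - (A + B * th + C * th ^+ 2))
      * (t' * (tau * m3 + m2 + (tau * m4 + m3) * th + m4 * th ^+ 2))).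
    by rewrite Dmu /g /z; ring.
  by rewrite E Dth !subrr mul0r subr0.
move=> _ e1 e2 e3 e4.
(* Since [g = tau th^2 + th^3], subtracting [tau] times the [th^3] coefficient from the [th^2] one
   removes [t]. In [r2] the coefficients of [th] and [th^4] remove [a] in the same way. *)
have r1 : s' * (m2 - tau * m3) + t' * (C * m2 + B * m3 + A * m4 - tau ^+ 2 * (m1 + C * m4)) = 0.
  by rewrite -[RHS](subrr 0) -{1}e2 -(mulr0 tau) -e3; ring.
have r2 : s' * (m1 - tau * m4) + t' * (B * m2 + A * m3
    + tau * (B * m3 + (A - C) * m4 - m1) - tau ^+ 2 * m2) = 0.
  by rewrite -[RHS](subrr 0) -{1}e1 -(mulr0 tau) -e4; ring.
have nzD : det5 m1 m2 m3 m4 != 0.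
  apply: contraNneq mu1 => /(det5_neq0 h1 h2 h3 h4)[z1 z2 z3 z4].
  by rewrite Dmu z1 z2 z3 z4 !mul0r !addr0.
split; apply: (mulIf nzD); rewrite mul0r.
  transitivity ((B * m2 + A * m3 + tau * (B * m3 + (A - C) * m4 - m1) - tau ^+ 2 * m2)
    * (s' * (m2 - tau * m3) + t' * (C * m2 + B * m3 + A * m4 - tau ^+ 2 * (m1 + C * m4)))
    - (C * m2 + B * m3 + A * m4 - tau ^+ 2 * (m1 + C * m4))
    * (s' * (m1 - tau * m4) + t' * (B * m2 + A * m3
    + tau * (B * m3 + (A - C) * m4 - m1) - tau ^+ 2 * m2))).
    by rewrite /det5; ring.
  by rewrite r1 r2 !mulr0 subrr.
transitivity ((m2 - tau * m3) * (s' * (m1 - tau * m4) + t' * (B * m2 + A * m3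
    + tau * (B * m3 + (A - C) * m4 - m1) - tau ^+ 2 * m2))
  - (m1 - tau * m4) * (s' * (m2 - tau * m3)
    + t' * (C * m2 + B * m3 + A * m4 - tau ^+ 2 * (m1 + C * m4)))).
  by rewrite /det5; ring.
by rewrite r1 r2 !mulr0 subrr.
Qed.

Let mem_g : g \in fix_ 15.
Proof.
by apply: (fixqD exprDq); [apply: fixqM; [exact: fix3_15|]|]; apply/fixqX/fix5_15.
Qed.
Let mem_z : z \in fix_ 15.
Proof.
apply: (fixqD exprDq); last by rewrite fixqX ?fix5_15.
by apply: fixqM; [apply: fix3_15|apply: fix5_15].
Qed.

Let zero3 s t a : s \in fix_ 3 -> t \in fix_ 3 -> a \in fix_ 1 ->
  s + t * g + a * z = 0 -> [/\ s = 0, t = 0 & a = 0].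
Proof.
move=> s3 t3 a1 E; have th15 : th \in fix_ (3 * 5) by apply: fix5_15.
have a3 := fix13 a1; have h1 : a * tau \in fix_ 3 by rewrite fixqM.
have h2 : t * tau \in fix_ 3 by rewrite fixqM.
have {}E : s + a * tau * th + t * tau * th ^+ 2 + t * th ^+ 3 + a * th ^+ 4 = 0.
  by rewrite -[RHS]E /g /z; ring.
by have [-> _ _ -> ->] := indep3 th15 th'3 s3 h1 h2 t3 a3 E.
Qed.

Definition W5 : {set M} := [set t.1.1 + t.1.2 * g + t.2 * z
  | t in setX (setX [set x in fix_ 3] [set x in fix_ 3]) [set x in fix_ 1]].

Lemma W5P x : reflect (exists s t a, [/\ s \in fix_ 3, t \in fix_ 3, a \in fix_ 1
  & x = s + t * g + a * z]) (x \in W5).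
Proof.
have FE d y : (y \in [set y in fix_ d]) = (y \in fix_ d) by rewrite inE.
apply: (iffP imsetP) => [[[[s t] a]]|[s [t [a [s3 t3 a1 ->]]]]].
  by rewrite !in_setX !FE /= => /andP[/andP[s3 t3] a1] ->; exists s, t, a.
by exists (s, t, a); rewrite // !in_setX !FE s3 t3.
Qed.

Lemma card_W5 : #|W5| = (q ^ 7)%N.
Proof.
rewrite card_in_imset ?cardsX ?cardsE ?card_fix // -?expnD //.
have FE d y : (y \in [set y in fix_ d]) = (y \in fix_ d) by rewrite inE.
move=> [[s t] a] [[s' t'] a']; rewrite !in_setX !FE /=.
move=> /andP[/andP[s3 t3] a1] /andP[/andP[s3' t3'] a1'] E.
have [||||] := @zero3 (s - s') (t - t') (a - a'); try exact: (fixqB q_gt1 exprDq).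
  by rewrite -[RHS](subrr (s + t * g + a * z)) {2}E; ring.
by move=> /subr0_eq-> /subr0_eq-> /subr0_eq->.
Qed.

(** If [x] has a [z]-component, subtracting an element of [F] from [l] removes the [z]-component of
    [l x]. The inverse of the new scalar then maps a vector of [T + T g] to [x], which is the
    situation of [degree5_indep]. *)
Lemma W5_scattered l x : x \in W5 -> x != 0 -> l \in fix_ 5 -> l * x \in W5 -> l ^+ q = l.
Proof.
move=> /W5P[s1 [t1 [a1 [s13 t13 a11 ->]]]] nzx l5 /W5P[s2 [t2 [a2 [s23 t23 a21 E]]]].
suff /fixqP : l \in fix_ 1 by rewrite expn1.
apply: contraT => l1.
have [a0|nza] := eqVneq a1 0.
  have [|e1 e2] := degree5_indep l5 l1 s13 t13 s23 t23 a21.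
    by rewrite -E a0 mul0r addr0.
  by case/eqP: nzx; rewrite e1 e2 a0 !mul0r !addr0.
have c1 : a2 / a1 \in fix_ 1 by rewrite fixqf.
have k1 : l - a2 / a1 \notin fix_ 1.
  by apply: contra l1 => h; rewrite -[l](subrK (a2 / a1)) (fixqD exprDq).
have k5 : l - a2 / a1 \in fix_ 5 by apply: (fixqB q_gt1 exprDq) => //; apply: fix15.
have nzk : l - a2 / a1 != 0 by apply: contraNneq k1 => ->; rewrite fixq0.
have Ek : (l - a2 / a1) * (s1 + t1 * g + a1 * z)
    = (s2 - a2 / a1 * s1) + (t2 - a2 / a1 * t1) * g.
  rewrite mulrBl E; by field.
have [||||||||e1 e2] := @degree5_indep (l - a2 / a1)^-1 (s2 - a2 / a1 * s1)
  (t2 - a2 / a1 * t1) s1 t1 a1.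
- exact: fixqV.
- by apply: contra k1 => /fixqV; rewrite invrK.
- by rewrite (fixqB q_gt1 exprDq) // fixqM // fix13.
- by rewrite (fixqB q_gt1 exprDq) // fixqM // fix13.
- by [].
- by [].
- by [].
- by rewrite -Ek mulKf.
case/eqP: nzx; apply: (mulfI nzk); rewrite Ek e1 e2; ring.
Qed.

Lemma W5_closed : [/\ 0 \in W5, {in W5 &, forall x y, x + y \in W5},
  forall a x, a ^+ q = a -> x \in W5 -> a * x \in W5 & {subset W5 <= fix_ 15}].
Proof.
split.
- by apply/W5P; exists 0, 0, 0; rewrite !fixq0 // !mul0r !addr0.
- move=> _ _ /W5P[s [t [a [s3 t3 a1 ->]]]] /W5P[s' [t' [a' [s3' t3' a1' ->]]]].
  apply/W5P; exists (s + s'), (t + t'), (a + a').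
  by rewrite !(fixqD exprDq) //; split=> //; ring.
- move=> b _ bq /W5P[s [t [a [s3 t3 a1 ->]]]].
  have b1 : b \in fix_ 1 by apply/fixqP; rewrite expn1.
  apply/W5P; exists (b * s), (b * t), (b * a).
  have b3 := fix13 b1; by rewrite !fixqM //; split=> //; ring.
move=> _ /W5P[s [t [a [s3 t3 a1 ->]]]]; do ?apply: (fixqD exprDq).
- exact: fix3_15.
- by rewrite fixqM // fix3_15.
by rewrite fixqM // fix3_15 // fix13.
Qed.

End Degree5.

(** * Exponent 5 in characteristics 2, 3 and 5 *)

Lemma exists_root_dvd_split (R : fieldType) (Q : {poly R}) (zs : seq R) :
  Q %| \prod_(z <- zs) ('X - z%:P) -> (1 < size Q)%N -> exists z, root Q z.
Proof.
case/dvdp_prod_XsubC=> m Em; rewrite (eqp_size Em) (size_prod_XsubC _ id).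
case Dm: (mask m zs) => [|z s] //= _; exists z.
by rewrite (eqp_root Em) root_prod_XsubC Dm mem_head.
Qed.

Definition mp_poly (R : nzRingType) (c : seq nat) : {poly R} :=
  'X^(size c) - Poly [seq k%:R | k <- c].

Lemma size_mp_poly (R : nzRingType) c : size (mp_poly R c) = (size c).+1.
Proof.
by rewrite size_polyDl size_polyXn // size_polyN ltnS (leq_trans (size_Poly _)) ?size_map.
Qed.

Lemma map_mp_poly (R S : nzRingType) (i : {rmorphism R -> S}) c :
  map_poly i (mp_poly R c) = mp_poly S c.
Proof.
rewrite rmorphB /= map_polyXn map_Poly_id0 ?rmorph0 // -map_comp.
by congr (_ - Poly _); apply: eq_map => k /=; rewrite rmorph_nat.
Qed.

Lemma root_mp_poly (R : fieldType) c (x : R) :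
  root (mp_poly R c) x -> x ^+ size c = mp_eval x c.
Proof.
rewrite rootE !hornerE horner_Poly subr_eq0 => /eqP ->.
by elim: c => //= k c ->; rewrite addrC mulrC.
Qed.

Lemma fixq_expn (M : fieldType) p e d (x : M) :
  (x \in fixq M (p ^ e) d) = (x \in fixq M p (e * d)).
Proof. by rewrite !inE -expnM. Qed.

Section PrimeDegree5.

Variables (F : finFieldType) (L : fieldExtType F) (p e : nat).
Variables (a b c : nat) (ctau : seq nat).
Local Notation q := #|F|.
Hypotheses (dimL : \dim {:L} = (2 * 5)%N).
Hypotheses (p_pr : prime p) (cardF : q = (p ^ e)%N) (co_e : coprime e 15).
Let cth := [:: a; b; c; 0; 0]%N.
Hypotheses (th_fix : mp_fixed p cth 5) (th_free : mp_rootfree p cth).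
Hypotheses (size_tau : size ctau = 3).
Hypotheses (tau_fix : mp_fixed p ctau 3) (tau_free : mp_rootfree p ctau).

Hypothesis det_neq0 : forall (M : finFieldType) (tau m1 m2 m3 m4 : M),
  p%:R = 0 :> M -> (forall x y : M, (x + y) ^+ q = x ^+ q + y ^+ q) ->
  tau ^+ 3 = mp_eval tau ctau -> tau \in fixq M q 3 -> tau \notin fixq M q 1 ->
  m1 \in fixq M q 1 -> m2 \in fixq M q 1 -> m3 \in fixq M q 1 -> m4 \in fixq M q 1 ->
  det5 tau a%:R b%:R c%:R m1 m2 m3 m4 = 0 ->
  [/\ m1 = 0, m2 = 0, m3 = 0 & m4 = 0].

(** [th] and [tau] are roots of polynomials over the prime field, of degrees [5] and [3]. As [e] is
    prime to [15], they stay outside [F] while lying in the fields of orders [q^5] and [q^3]. *)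
Lemma degree5_min_length_of : min_length_saturating L 3 2 (5 + 2).
Proof.
have q_gt1 : (1 < q)%N := finNzRing_gt1 F.
have [||M [i [zs [exD c15 Dzs]]]] :=
    @exists_fixq_ext F L 15 (mp_poly L cth * mp_poly L ctau) => //.
  by rewrite mulf_neq0 // -size_poly_eq0 size_mp_poly.
rewrite rmorphM /= !map_mp_poly in Dzs.
have [th /root_mp_poly Dth] : exists z, root (mp_poly M cth) z.
  apply: (exists_root_dvd_split (zs := zs)); rewrite ?size_mp_poly //.
  by rewrite -(eqp_dvdr _ Dzs) dvdp_mulr.
have [tau /root_mp_poly Dtau] : exists z, root (mp_poly M ctau) z.
  apply: (exists_root_dvd_split (zs := zs)); rewrite ?size_mp_poly ?size_tau //.
  by rewrite -(eqp_dvdr _ Dzs) dvdp_mull.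
have pF := card_finPcharP cardF p_pr.
have p0 : p%:R = 0 :> M.
  have pM : p \in [pchar M].
    by apply: (rmorph_pchar (i \o in_alg L : {rmorphism F -> M})).
  exact: pcharf0 pM.
have co5 : coprime e 5 by apply: coprime_dvdr co_e.
have co3 : coprime e 3 by apply: coprime_dvdr co_e.
have th_fixp : th \in fixq M p 5.
  by apply/fixqP; apply: (@mp_fixedP p cth M th) => //.
have tau_fixp : tau \in fixq M p 3.
  by apply/fixqP; apply: (@mp_fixedP p ctau M tau) => //; rewrite size_tau.
have th5 : th \in fixq M q 5.
  by rewrite cardF fixq_expn; apply: fixq_dvd th_fixp; apply: dvdn_mull.
have tau3 : tau \in fixq M q 3.
  by rewrite cardF fixq_expn; apply: fixq_dvd tau_fixp; apply: dvdn_mull.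
have th1 : th \notin fixq M q 1.
  apply: contra (mp_rootfreeP p_pr p0 Dth th_free) => h; apply/eqP.
  by rewrite cardF fixq_expn muln1 in h; apply: fixq_coprime co5 h th_fixp.
have tau1 : tau \notin fixq M q 1.
  apply: contra (mp_rootfreeP p_pr p0 Dtau tau_free) => h; apply/eqP.
  by rewrite cardF fixq_expn muln1 in h; apply: fixq_coprime co3 h tau_fixp.
have Dth' : th ^+ 5 = a%:R + b%:R * th + c%:R * th ^+ 2.
  by rewrite [LHS]Dth /=; ring.
have cM d : (d %| 15)%N -> #|fixq M q d| = (q ^ d)%N.
  by move=> dv; apply: card_fixq c15.
have nat1 n : n%:R \in fixq M q 1 by apply: fixq_nat.
have detP m1 m2 m3 m4 : m1 \in fixq M q 1 -> m2 \in fixq M q 1 ->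
    m3 \in fixq M q 1 -> m4 \in fixq M q 1 ->
    det5 tau a%:R b%:R c%:R m1 m2 m3 m4 = 0 -> [/\ m1 = 0, m2 = 0, m3 = 0 & m4 = 0].
  by apply: det_neq0 => //; rewrite -Dtau size_tau.
have [W0 WD WZ Wfix] := W5_closed q_gt1 exD th5 tau3.
apply: (@scattered_ext_min_length F L 5 isT dimL (finField_exprD (in_alg L))
          M i tau exD tau3 tau1 isT (mem (W5 q th tau))) => //.
- move=> l x xW nzx l5 lxW.
  exact: (W5_scattered q_gt1 exD cM th5 th1 tau3 (nat1 a) (nat1 b) (nat1 c) Dth' detP xW).
have -> : #|mem (W5 q th tau)| = #|W5 q th tau| by apply: eq_card.
by rewrite (card_W5 q_gt1 exD cM th5 th1 tau3).
Qed.

End PrimeDegree5.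

(** All roots lie in the field of order [p^15], which meets the one of order [p^e] in the prime
    field, where there is no root. *)
Lemma fixq_mp_root_false (M : fieldType) (p e : nat) (c : seq nat) (s : M) :
    prime p -> p%:R = 0 :> M -> coprime e 15 -> s \in fixq M (p ^ e) 1 ->
    (1 < size c)%N -> mp_fixed p c 15 -> mp_rootfree p c ->
  s ^+ size c <> mp_eval s c.
Proof.
move=> p_pr p0 co s1 szc cfix cfree Ds.
case/negP: (mp_rootfreeP p_pr p0 Ds cfree); apply/eqP.
rewrite fixq_expn muln1 in s1; apply: (fixq_coprime co s1).
by apply/fixqP/(mp_fixedP (c := c)).
Qed.

(** The two quadrics meet in the rational quartic with points [(1 : s^4 : s^3 : s^2)], and
    [s = m3 / m4] recovers the parameter over [F]. *)
Lemma quartic_param (M : fieldType) (q : nat) (m1 m2 m3 m4 : M) :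
    m1 \in fixq M q 1 -> m3 \in fixq M q 1 -> m4 \in fixq M q 1 -> m1 != 0 -> m4 != 0 ->
    m4 ^+ 2 = m1 * m2 -> m3 ^+ 2 = m2 * m4 ->
  exists2 s, s \in fixq M q 1 & [/\ m2 = s ^+ 4 * m1, m3 = s ^+ 3 * m1 & m4 = s ^+ 2 * m1].
Proof.
move=> h1 h3 h4 n1 n4 e4 e3; exists (m3 / m4); first exact: fixqf.
have Em2 : m2 = m4 ^+ 2 / m1 by rewrite e4 mulrC mulKf.
have E3 : m3 ^+ 2 = m4 ^+ 3 / m1 by rewrite e3 Em2; field.
rewrite Em2 !expr_div_n (exprS m3 2) (exprM m3 2 2) E3; split; by field; rewrite n1 n4.
Qed.

Section Primes235.

Variables (F : finFieldType) (L : fieldExtType F) (e : nat).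
Hypotheses (dimL : \dim {:L} = (2 * 5)%N) (co_e : coprime e 15).
Local Notation q := #|F|.

Lemma degree5_char2 : q = (2 ^ e)%N -> min_length_saturating L 3 2 (5 + 2).
Proof.
move=> cardF; have q_gt1 : (1 < q)%N := finNzRing_gt1 F.
apply: (@degree5_min_length_of F L 2 e 1 0 1 [:: 1; 0; 1]%N) => //.
move=> M tau m1 m2 m3 m4 p0 exD Dtau tau3 tau1 h1 h2 h3 h4 D0.
have {}Dtau : tau ^+ 3 = 1 + tau ^+ 2 by rewrite Dtau /=; ring.
have eq0 (x : M) : x ^+ 2 = 0 -> x = 0 by move/eqP; rewrite expf_eq0 => /eqP.
(* Reducing [det5] by the cubic relation of [tau] leaves coefficients of [1], [tau] and [tau^2] in
   [F], which vanish separately: these are the three quadrics. Multiples of [2] are kept, since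
   [ring] does not know the characteristic. *)
have [] := @fixq_indep3 M q q_gt1 exD 1 tau
  (m2 * m3 * 2 - m1 * m2 - m1 * m4 * 2 - m4 ^+ 2)
  (m2 * m4 - m1 * m2 - m3 ^+ 2 + m4 ^+ 2)
  (m1 ^+ 2 + m1 * m3 - m2 ^+ 2 + m2 * m3 - m4 ^+ 2) tau3 tau1.
1-3: by do ?[by [] | exact: fixq_nat | apply: (fixqB q_gt1 exD) | apply: (fixqD exD)
            | apply: fixqM | apply: fixqX].
  rewrite -[RHS]D0.
  transitivity (det5 tau 1%:R 0%:R 1%:R m1 m2 m3 m4
    - (tau ^+ 3 - (1 + tau ^+ 2)) * (m2 * m3 - m1 * m4 - m4 ^+ 2)).
    by rewrite /det5; ring.
  by rewrite Dtau subrr mul0r subr0.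
move=> Q0 Q1 Q2.
have e4 : m4 ^+ 2 = m1 * m2.
  apply/eqP; rewrite -subr_eq0; apply/eqP.
  transitivity (2%:R * (m2 * m3 - m1 * m4 - m1 * m2)
    - (m2 * m3 * 2 - m1 * m2 - m1 * m4 * 2 - m4 ^+ 2)); first by ring.
  by rewrite Q0 p0 mul0r subrr.
have e3 : m3 ^+ 2 = m2 * m4.
  apply/eqP; rewrite -subr_eq0; apply/eqP.
  transitivity (m4 ^+ 2 - m1 * m2 - (m2 * m4 - m1 * m2 - m3 ^+ 2 + m4 ^+ 2)).
    by ring.
  by rewrite Q1 e4 subrr subr0.
have [z1|n1] := eqVneq m1 0.
  have z4 : m4 = 0 by apply: eq0; rewrite e4 z1 mul0r.
  have z3 : m3 = 0 by apply: eq0; rewrite e3 z4 mulr0.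
  have z2 : m2 = 0.
    by apply: eq0; apply: oppr_inj; rewrite oppr0 -Q2 z1 z3 z4; ring.
  by [].
have [z4|n4] := eqVneq m4 0.
  have z2 : m2 = 0 by apply: (mulfI n1); rewrite -e4 z4; ring.
  have z3 : m3 = 0 by apply: eq0; rewrite e3 z4 mulr0.
  by case/eqP: n1; apply: eq0; rewrite -[RHS]Q2 z2 z3 z4; ring.
have [s s1 [E2 E3 E4]] := quartic_param h1 h3 h4 n1 n4 e4 e3.
rewrite cardF in s1.
(* On the quartic the third quadric becomes, modulo [2], [s^8 = 1 + s^3 + s^4 + s^7]. *)
case: (@fixq_mp_root_false M 2 e [:: 1; 0; 0; 1; 1; 0; 0; 1]%N s) => //=.
apply/eqP; rewrite -subr_eq0; apply/eqP; apply: (mulIf (expf_neq0 2 n1)).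
transitivity (- (m1 ^+ 2 + m1 * m3 - m2 ^+ 2 + m2 * m3 - m4 ^+ 2)
   - 2%:R * s ^+ 4 * m1 ^+ 2); first by rewrite E2 E3 E4; ring.
by rewrite Q2 p0; ring.
Qed.

Lemma degree5_char5 : q = (5 ^ e)%N -> min_length_saturating L 3 2 (5 + 2).
Proof.
move=> cardF; have q_gt1 : (1 < q)%N := finNzRing_gt1 F.
apply: (@degree5_min_length_of F L 5 e 1 0 2 [:: 4; 0; 3]%N) => //.
move=> M tau m1 m2 m3 m4 p0 exD Dtau tau3 tau1 h1 h2 h3 h4 D0.
have {}Dtau : tau ^+ 3 = 4 + 3 * tau ^+ 2 by rewrite Dtau /=; ring.
have eq0 (x : M) : x ^+ 2 = 0 -> x = 0 by move/eqP; rewrite expf_eq0 => /eqP.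
have [] := @fixq_indep3 M q q_gt1 exD 1 tau
  (5%:R * m2 * m3 - 2%:R * m1 * m2 - 5%:R * m1 * m4 - 8%:R * m4 ^+ 2)
  (m2 * m4 - m1 * m2 - m3 ^+ 2 + m4 ^+ 2)
  (m1 ^+ 2 + m1 * m3 - m2 ^+ 2 + 3%:R * m2 * m3 + m3 * m4 - m1 * m4 - 6%:R * m4 ^+ 2)
  tau3 tau1.
1-3: by do ?[by [] | exact: fixq_nat | apply: (fixqB q_gt1 exD) | apply: (fixqD exD)
            | apply: fixqM | apply: fixqX].
  rewrite -[RHS]D0.
  transitivity (det5 tau 1%:R 0%:R 2%:R m1 m2 m3 m4
    - (tau ^+ 3 - (4 + 3 * tau ^+ 2)) * (m2 * m3 - m1 * m4 - 2%:R * m4 ^+ 2)).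
    by rewrite /det5; ring.
  by rewrite Dtau subrr mul0r subr0.
move=> Q0 Q1 Q2.
have e4 : m4 ^+ 2 = m1 * m2.
  apply/eqP; rewrite -subr_eq0; apply/eqP.
  transitivity (5%:R * (5%:R * m4 ^+ 2 + m1 * m2 - 3%:R * m2 * m3 + 3%:R * m1 * m4)
    + 3%:R * (5%:R * m2 * m3 - 2%:R * m1 * m2 - 5%:R * m1 * m4 - 8%:R * m4 ^+ 2)).
    by ring.
  by rewrite Q0 p0 mul0r mulr0 addr0.
have e3 : m3 ^+ 2 = m2 * m4.
  apply/eqP; rewrite -subr_eq0; apply/eqP.
  transitivity (m4 ^+ 2 - m1 * m2 - (m2 * m4 - m1 * m2 - m3 ^+ 2 + m4 ^+ 2)).
    by ring.
  by rewrite Q1 e4 subrr subr0.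
have [z1|n1] := eqVneq m1 0.
  have z4 : m4 = 0 by apply: eq0; rewrite e4 z1 mul0r.
  have z3 : m3 = 0 by apply: eq0; rewrite e3 z4 mulr0.
  have z2 : m2 = 0.
    by apply: eq0; apply: oppr_inj; rewrite oppr0 -Q2 z1 z3 z4; ring.
  by [].
have [z4|n4] := eqVneq m4 0.
  have z2 : m2 = 0 by apply: (mulfI n1); rewrite -e4 z4; ring.
  have z3 : m3 = 0 by apply: eq0; rewrite e3 z4 mulr0.
  by case/eqP: n1; apply: eq0; rewrite -[RHS]Q2 z2 z3 z4; ring.
have [s s1 [E2 E3 E4]] := quartic_param h1 h3 h4 n1 n4 e4 e3.
rewrite cardF in s1.
case: (@fixq_mp_root_false M 5 e [:: 1; 0; 4; 1; 4; 1; 0; 3]%N s) => //=.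
apply/eqP; rewrite -subr_eq0; apply/eqP; apply: (mulIf (expf_neq0 2 n1)).
transitivity (- (m1 ^+ 2 + m1 * m3 - m2 ^+ 2 + 3%:R * m2 * m3 + m3 * m4 - m1 * m4
    - 6%:R * m4 ^+ 2) - 5%:R * ((s ^+ 2 + 2%:R * s ^+ 4) * m1 ^+ 2)).
  by rewrite E2 E3 E4; ring.
by rewrite Q2 p0; ring.
Qed.

Lemma degree5_char3 : q = (3 ^ e)%N -> min_length_saturating L 3 2 (5 + 2).
Proof.
move=> cardF; have q_gt1 : (1 < q)%N := finNzRing_gt1 F.
apply: (@degree5_min_length_of F L 3 e 1 1 0 [:: 2; 1; 0]%N) => //.
move=> M tau m1 m2 m3 m4 p0 exD Dtau tau3 tau1 h1 h2 h3 h4 D0.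
have {}Dtau : tau ^+ 3 = 2 + tau by rewrite Dtau /=; ring.
have eq0 (x : M) : x ^+ 2 = 0 -> x = 0 by move/eqP; rewrite expf_eq0 => /eqP.
have [] := @fixq_indep3 M q q_gt1 exD 1 tau
  (m2 ^+ 2 + 3%:R * m2 * m3 - m1 * m3 - 3%:R * m1 * m4)
  (m2 * m4 - m1 * m2 - m3 ^+ 2 + m3 * m4 + m4 ^+ 2 + m2 * m3 - m1 * m4)
  (m1 ^+ 2 + m1 * m3 - m2 ^+ 2 - m3 ^+ 2 - m3 * m4) tau3 tau1.
1-3: by do ?[by [] | exact: fixq_nat | apply: (fixqB q_gt1 exD) | apply: (fixqD exD)
            | apply: fixqM | apply: fixqX].
  rewrite -[RHS]D0.
  transitivity (det5 tau 1%:R 1%:R 0%:R m1 m2 m3 m4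
    - (tau ^+ 3 - (2 + tau)) * (m2 * m3 - m1 * m4)).
    by rewrite /det5; ring.
  by rewrite Dtau subrr mul0r subr0.
move=> Q0 Q1 Q2.
have e2 : m2 ^+ 2 = m1 * m3.
  apply/eqP; rewrite -subr_eq0; apply/eqP.
  transitivity (3%:R * (m1 * m4 - m2 * m3)
    + (m2 ^+ 2 + 3%:R * m2 * m3 - m1 * m3 - 3%:R * m1 * m4)); first by ring.
  by rewrite Q0 p0 mul0r addr0.
have e1 : m1 ^+ 2 = m3 * (m3 + m4).
  apply/eqP; rewrite -subr_eq0; apply/eqP.
  transitivity (m2 ^+ 2 - m1 * m3 + (m1 ^+ 2 + m1 * m3 - m2 ^+ 2 - m3 ^+ 2 - m3 * m4)).
    by ring.
  by rewrite Q2 e2 subrr addr0.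
have [z1|n1] := eqVneq m1 0.
  have z2 : m2 = 0 by apply: eq0; rewrite e2 z1 mul0r.
  have z3 : m3 = 0.
    apply/eqP; apply: contraT => n3; have := e1; rewrite z1 expr0n /= => /esym/eqP.
    rewrite mulf_eq0 (negPf n3) addr_eq0 => /eqP E.
    case/eqP: n3; apply: eq0; apply: oppr_inj; rewrite oppr0 -Q1 z1 z2 E; ring.
  have z4 : m4 = 0 by apply: eq0; rewrite -[RHS]Q1 z1 z2 z3; ring.
  by [].
have n3 : m3 != 0 by apply: contraNneq n1 => z3; apply/eqP/eq0; rewrite e1 z3 mul0r.
(* Here the first and third quadrics reduce to [m2^2 = m1 m3] and [m1^2 = m3 (m3 + m4)], so their
   curve has the other parametrization [(1 : s : s^2 : (1 - s^4) / s^2)]. Clearing the denominator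
   [s^4] in the second quadric gives the degree [8] equation. *)
pose s := m2 / m1.
have s1 : s \in fixq M (3 ^ e) 1 by rewrite -cardF; apply: fixqf.
have E2 : m2 = s * m1 by rewrite divfK.
have E3 : m3 = s ^+ 2 * m1.
  by apply: (mulfI n1); rewrite -e2 E2; ring.
have ns : s != 0 by apply: contraNneq n3 => z; rewrite E3 z expr0n mul0r.
have E4 : m4 = (1 - s ^+ 4) / s ^+ 2 * m1.
  have Em4 : m4 = m1 ^+ 2 / m3 - m3 by rewrite e1 mulrC mulKf // addrC addKr.
  by rewrite Em4 E3; field; rewrite n1 ns.
case: (@fixq_mp_root_false M 3 e [:: 1; 0; 2; 1; 2; 2; 1; 0]%N s) => //=.
apply/eqP; rewrite -subr_eq0; apply/eqP; apply: (mulIf (expf_neq0 2 n1)).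
transitivity (- (s ^+ 4 * (m2 * m4 - m1 * m2 - m3 ^+ 2 + m3 * m4 + m4 ^+ 2 + m2 * m3
    - m1 * m4)) - 3%:R * ((s ^+ 2 + s ^+ 4 + s ^+ 5) * m1 ^+ 2)).
  by rewrite E4 E3 E2; field.
by rewrite Q1 p0; ring.
Qed.

End Primes235.

(* Arithmetic of the five cases *)
Local Close Scope ring_scope.

Lemma coprime_GL2_card q r :
  coprime r q -> coprime r q.-1 -> coprime r q.+1 ->
  coprime r (q * q.-1 ^ 2 * q.+1).
Proof. by move=> h1 h2 h3; rewrite !coprimeMr h1 h2 h3. Qed.

Lemma coprime5_GL2_card q : q = 2 %[mod 5] \/ q = 3 %[mod 5] ->
  coprime 5 (q * q.-1 ^ 2 * q.+1).
Proof. by move=> qm; apply: coprime_GL2_card; rewrite prime_coprime //; lia. Qed.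

Lemma odd_exp2_mod5 h : 2 ^ (2 * h + 1) = 2 %[mod 5] \/ 2 ^ (2 * h + 1) = 3 %[mod 5].
Proof.
elim: h => [|h IHh]; first by left.
by rewrite mulnS -addnA 2!expnS; lia.
Qed.

Lemma coprime_fact_dvd r n m : coprime r n`! -> 0 < m <= n -> coprime r m.
Proof. by move=> co mn; apply: coprime_dvdr co; apply: dvdn_fact. Qed.

Lemma coprime_shift15 h s : gcdn s 15 = 1 -> coprime (15 * h + s) 15.
Proof. by move=> co; rewrite /coprime gcdnC mulnC gcdnMDl gcdnC co. Qed.

Theorem theorem4p9 (q r : nat) (F : finFieldType) (L : fieldExtType F)
    (q_pp : prime_power q) (r_gt0 : 0 < r)
    (cardF : #|F| = q) (dimL : \dim {:L} = 2 * r)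
    (cases :
      (* (a) *)
      [/\ r <> 3 %[mod 6], r <> 5 %[mod 6] & 4 <= r]
      (* (b) *)
      \/ (odd r /\
          exists s : nat,
            [/\ 1 <= s, s <= r, gcdn r s = 1
              & gcdn r (q ^ (2 * s) - q ^ s + 1)`! = 1])
      (* (c) *)
      \/ (r = 5 /\
          exists p h s : nat,
            [/\ p = 2 \/ p = 3, gcdn s 15 = 1 & q = p ^ (15 * h + s)])
      (* (d) *)
      \/ (r = 5 /\ exists h : nat, q = 5 ^ (15 * h + 1))
      (* (e) *)
      \/ (r = 5 /\
          ((odd q /\ (q = 2 %[mod 5] \/ q = 3 %[mod 5]))
           \/ exists h : nat, 1 <= h /\ q = 2 ^ (2 * h + 1)))) :
  min_length_saturating L 3 2 (r + 2).
Proof.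
case: cases => [[r3 r5 r4]|[[_ [s [s1 _ _ co]]]|[[r5 [p [h [s [p23 co Eq]]]]]
    |[[r5 [h Eq]]|[r5 qmod]]]]].
(* The residues left modulo [6] are [0], [1], [2] and [4]: those not congruent to [1] modulo [3] are
   even. *)
- have [r31|r31] := eqVneq (r %% 3) 1; first by apply: mod3_min_length => //; lia.
  have Er : r = 2 * (r %/ 2) by lia.
  rewrite Er in dimL *; have [t3|t3] := boolP (3 %| r %/ 2).
    by apply: even3_min_length => //; lia.
  by apply: even_not3_min_length => //; lia.
- apply: coprime_min_length => //; rewrite cardF; move: co.
  have q_gt1 : 1 < q by rewrite -cardF finNzRing_gt1.
  have qs : q <= q ^ s by rewrite -{1}(expn1 q) leq_exp2l.
  have -> : q ^ (2 * s) = q ^ s * q ^ s by rewrite mul2n -addnn expnD.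
  (* As [s >= 1] and [q >= 2], the number [q^(2s) - q^s + 1] is at least [q + 1], so its factorial
     is divisible by [q - 1], [q] and [q + 1]. *)
  move=> /eqP co; apply: coprime_GL2_card; apply: (coprime_fact_dvd co); nia.
- rewrite r5 in dimL *; have {}co := coprime_shift15 h co.
  case: p23 => Ep; rewrite Ep in Eq.
    by apply: (degree5_char2 dimL co); rewrite cardF.
  by apply: (degree5_char3 dimL co); rewrite cardF.
- rewrite r5 in dimL *.
  by apply: (degree5_char5 dimL (e := 15 * h + 1)); rewrite ?cardF ?coprime_shift15.
(* Both alternatives amount to [q = 2] or [3] modulo [5], and then [5] divides none of [q - 1], [q],
   [q + 1]. *)
rewrite r5 in dimL *; apply: coprime_min_length => //; rewrite cardF.
apply: coprime5_GL2_card; case: qmod => [[_ //]|[h [_ ->]]].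
exact: odd_exp2_mod5.
Qed.
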